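(* Let $A$ generate a uniformly bounded, strongly stable $C_0$-semigroup on a Hilbert space $H$, let $T>0$, $\omega_n=2\pi n/T$, and assume $i\omega_n\in\rho(A)$ for all $n\in\mathbb Z$. (i) Every $H$-valued trigonometric polynomial $F$ (a finite sum $\sum_n e^{i\omega_nt}F_n$ with $F_n\in H$) admits a unique $T$-periodic mild solution of $\dot u=Au+F$, which is classical and a trigonometric polynomial with values in $\mathcal D(A)$. Since the trigonometric polynomials are dense in $L^p_{\#}(0,T;H)$, $1\le p<\infty$, they form an explicit dense periodic well-posedness class. (ii) If $F\in L^2_{\#}(0,T;H)$ admits a $T$-periodic mild solution, then $F\in\mathfrak W_T(A)$. Conversely, every $F\in\mathfrak W_T(A)$ admits a unique $T$-periodic solution in the $L^2$-Fourier sense, that is, a unique function $U\in L^2_{\#}(0,T;H)$ whose Fourier coefficients satisfy $\hat U_n\in\mathcal D(A)$ and $(i\omega_nI-A)\hat U_n=F_n$ for all $n\in\mathbb Z$, and $\|U\|_{L^2(0,T;H)}^2=T\,\|F\|_{\mathfrak W_T(A)}^2$.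
   Context: The subscript $\#$ denotes spaces of $T$-periodic functions. For $F\in L^2_{\#}(0,T;H)$ write $F=\sum_ne^{i\omega_nt}F_n$ with Fourier coefficients $F_n=\hat F_n=\frac1T\int_0^Te^{-i\omega_nt}F(t)\,dt$. The sampled response space is $\mathfrak W_T(A):=\{F=\sum_ne^{i\omega_nt}F_n\in L^2_{\#}(0,T;H):\ \|F\|_{\mathfrak W_T(A)}^2:=\sum_{n\in\mathbb Z}\|(i\omega_nI-A)^{-1}F_n\|^2<\infty\}$. A mild solution of $\dot u=Au+F$ is $u(t)=S(t)u_0+\int_0^tS(t-s)F(s)\,ds$, $t\ge0$, $u_0\in H$, where $S(t)$ is the semigroup generated by $A$. The system is periodically well-posed on a set $\mathcal Q\subset L^1_{\#}(0,T;H)$ if for every $f\in\mathcal Q$ there exists a unique $T$-periodic mild solution of $\dot u=Au+f$. Strongly stable means $S(t)x\to0$ for every $x\in H$. *)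

(* Defs.v *)
From mathcomp Require Import all_boot all_order all_algebra.
From mathcomp Require Import complex.
From mathcomp Require Import all_classical all_reals all_analysis.

Set Implicit Arguments.
Unset Strict Implicit.
Unset Printing Implicit Defensive.

Import Order.TTheory GRing.Theory Num.Theory.
Import numFieldNormedType.Exports.

Local Open Scope classical_set_scope.
Local Open Scope complex_scope.
Local Open Scope ring_scope.

(* The norm of a normed module over R[i] takes its values in R[i]; since it is
   nonnegative there, it is real, and normR is that real number. *)
Definition normR (R : realType) (H : normedModType R[i]) (x : H) : R :=
  complex.Re `|x|.

Definition hilbert_norm (R : realType) (H : normedModType R[i])
    (dot : {dot H for (@Num.conj R[i])}) :=
  forall x : H, `|x| ^+ 2 = dot x x.

Section Bochner.
Context (R : realType) (H : normedModType R[i]).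
Implicit Types (D : set R) (f : R -> H) (s : nat -> {fimfun R >-> H}).
Local Notation mu := (@lebesgue_measure R).

Definition is_simple (s : {fimfun R >-> H}) :=
  forall x : H, measurable (s @^-1` [set x]).

(* Only meaningful when D has finite measure. *)
Definition simple_integral D (s : {fimfun R >-> H}) : H :=
  \sum_(x \in range s) (fine (mu (D `&` s @^-1` [set x])))%:C *: x.

Definition approximates_ae D s f :=
  (forall n, is_simple (s n)) /\
  {ae mu, forall t, D t -> s n t @[n --> \oo] --> f t}.

Definition strongly_measurable D f := exists s, approximates_ae D s f.

Definition is_bochner_integral D f (v : H) :=
  exists s, [/\ approximates_ae D s f,
    (\int[mu]_(t in D) (normR (f t - s n t)%R)%:E)%E @[n --> \oo] --> 0%E &
    simple_integral D (s n) @[n --> \oo] --> v].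

(* Equal to 0 when f is not Bochner integrable on D. *)
Definition bochner_integral D f : H := xget 0 (is_bochner_integral D f).

End Bochner.

Section PeriodicSpaces.
Context (R : realType) (H : normedModType R[i]) (T : R).
Implicit Types (F U : R -> H) (p : R).
Local Notation mu := (@lebesgue_measure R).

Definition Lp_norm p F : \bar R :=
  ((\int[mu]_(t in `[0%R, T]) (normR (F t) `^ p)%R%:E) `^ p^-1)%E.

(* Elements are representatives, taken to be periodic at every point; equality
   in L^p_# is almost everywhere equality. *)
Definition Lp_per p : set (R -> H) := [set F |
  [/\ periodic F T, strongly_measurable `[0, T] F & (Lp_norm p F < +oo)%E]].

Definition omega (n : int) : R := 2 * pi * n%:~R / T.

Definition i_omega (n : int) : R[i] := (0 +i* omega n)%C.

(* exp (i omega_n t) *)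
Definition fourier_mode (n : int) (t : R) : R[i] :=
  (cos (omega n * t) +i* sin (omega n * t))%C.

Definition fourier_coef F (n : int) : H :=
  (T^-1)%:C *: bochner_integral `[0, T] (fun t => fourier_mode (- n) t *: F t).

Definition trig_poly (E : set H) : set (R -> H) := [set F |
  exists (s : seq int) (c : int -> H), [/\ uniq s,
    (forall n, n \in s -> E (c n)) &
    forall t, F t = \sum_(n <- s) fourier_mode n t *: c n]].

End PeriodicSpaces.

(* A possibly unbounded operator; its values outside of dom are irrelevant. *)
Record operator (H : Type) := Operator { dom : set H; op :> H -> H }.

Section Resolvent.
Context (R : realType) (H : normedModType R[i]).
Implicit Types (A : operator H) (l : R[i]).

Definition resolvent_eq A l (y x : H) := dom A x /\ l *: x - A x = y.

Definition resolvent A l (y : H) : H := xget 0 (resolvent_eq A l y).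

Definition resolvent_set A : set R[i] := [set l |
  (forall y, exists! x, resolvent_eq A l y x) /\
  exists M : R, forall y, normR (resolvent A l y) <= M * normR y].

End Resolvent.

Section Semigroup.
Context (R : realType) (H : normedModType R[i]).
(* Only the values at nonnegative times matter. *)
Implicit Types (S : R -> H -> H) (A : operator H) (u F : R -> H).

Definition C0_semigroup S :=
  [/\ forall t, 0 <= t -> linear (S t) /\ continuous (S t),
      forall x, S 0 x = x,
      forall s t x, 0 <= s -> 0 <= t -> S (s + t) x = S s (S t x) &
      forall x, S t x @[t --> 0^'+] --> x].

Definition generates A S :=
  let diff_quotient x (h : R) := (h^-1)%:C *: (S h x - x) in
  (forall x, dom A x <-> exists y : H, diff_quotient x h @[h --> 0^'+] --> y) /\
  (forall x, dom A x -> diff_quotient x h @[h --> 0^'+] --> A x).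

Definition uniformly_bounded S :=
  exists M : R, forall t x, 0 <= t -> normR (S t x) <= M * normR x.

Definition strongly_stable S := forall x, S t x @[t --> +oo] --> (0 : H).

Definition mild_solution S F u := exists u0 : H, forall t, 0 <= t ->
  u t = S t u0 + bochner_integral `[0, t] (fun s => S (t - s) (F s)).

(* A periodic function on [0, +oo[ is identified with its periodic extension
   to the whole line, so that uniqueness is plain equality of functions. *)
Definition periodic_mild_solution T S F u :=
  periodic u T /\ mild_solution S F u.

Definition periodically_well_posed T S (Q : set (R -> H)) :=
  Q `<=` Lp_per T 1 /\
  forall F, Q F -> exists! u, periodic_mild_solution T S F u.

(* C^1 solution on the whole line; for periodic u and F this is the same as
   being one on [0, +oo[. *)
Definition classical_solution A F u := exists u' : R -> H,
  continuous u' /\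
  forall t, [/\ (h^-1)%:C *: (u (t + h) - u t) @[h --> (0 : R)^'] --> u' t,
                dom A (u t) & u' t = A (u t) + F t].

(* The square of the norm of the sampled response space, in [0, +oo]. *)
Definition response_norm2 T A F : \bar R :=
  \esum_(n in [set: int])
    (normR (resolvent A (i_omega T n) (fourier_coef T F n)) ^+ 2)%:E.

Definition response_space T A : set (R -> H) := [set F |
  Lp_per T 2 F /\ (response_norm2 T A F < +oo)%E].

Definition fourier_solution T A F U := forall n : int,
  dom A (fourier_coef T U n) /\
  i_omega T n *: fourier_coef T U n - A (fourier_coef T U n)
    = fourier_coef T F n.

End Semigroup.

(* Main.v *)
Require Import Defs.
From mathcomp Require Import all_boot all_order all_algebra.
From mathcomp Require Import complex finmap.
From mathcomp Require Import all_classical all_reals all_analysis.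
From mathcomp Require Import measurable_realfun.
From mathcomp Require Import ring lra.

Set Implicit Arguments.
Unset Strict Implicit.
Unset Printing Implicit Defensive.

Import Order.TTheory GRing.Theory Num.Theory.
Import numFieldNormedType.Exports.

Local Open Scope classical_set_scope.
Local Open Scope complex_scope.
Local Open Scope ring_scope.

(** Write e_n(t) = exp (i omega_n t) and R_n for the resolvent of A at
    i omega_n. For x in the domain of A, the rescaled semigroup e_(-n)(t) S(t)
    has generator A - i omega_n, so the fundamental theorem of calculus gives
    the convolution of S with e_n (i omega_n - A) x: it is e_n(t) x - S(t) x
    (mode_mild_integral). Hence e_n R_n c is a periodic mild solution for the
    forcing e_n c, and finite sums give the periodic solution for every
    trigonometric polynomial (trig_forcing_solution, trig_forcing_classical).
    Two periodic mild solutions differ by a periodic orbit of the semigroup,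
    which strong stability forces to be 0 (periodic_mild_solution_unique).

    Density of the trigonometric polynomials (trig_poly_dense) reduces to
    indicators of Borel sets, and by a Dynkin argument to indicators of
    intervals. Such an indicator is a step function of a cosine, hence the
    bounded limit of polynomials of that cosine (trig_approximable_ray).
    In L^2 the finite Parseval identity then extends to Bessel's inequality,
    uniqueness of Fourier coefficients, the theorem of Riesz-Fischer and
    Plancherel's identity (bessel, fourier_uniqueness, riesz_fischer,
    plancherel).

    Let u be a periodic mild solution for a square integrable forcing F. For a
    trigonometric polynomial P near F with periodic solution w, the difference
    u - w is the sum of an orbit S(t) d and of the convolution of S with F - P,
    which is uniformly small on [0, T] (orbit_perturbation). The orbit has
    Fourier coefficients R_n (d - S(T) d) / T (resolvent_orbit_integral), and
    periodicity of u and w makes d - S(T) d small. In the limit u has the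
    coefficients R_n F_n (mild_solution_coef), and they are square summable
    because u is square integrable. Conversely, if the R_n F_n are square
    summable, they are the coefficients of a unique element of L^2
    (response_fourier_solution).

    Integrals of vector valued functions are handled by approximation in mean
    by simple functions, with the error measured by an upper integral
    (upper_bounded). Upper integrals are monotone and subadditive for arbitrary
    functions, so that convolutions and almost everywhere limits need no
    separate proof of measurability. Identities between Bochner integrals are
    obtained by taking real inner products with a fixed vector, as in the
    fundamental theorem of calculus (bochner_FTC). *)

(** * The real norm of a normed space over the complex numbers *)

Section NormR.
Context (R : realType) (H : normedModType R[i]).
Implicit Types (x y : H).

Lemma normRE x : `|x| = (normR x)%:C.
Proof.
rewrite /normR; have := normr_ge0 x.
by case: `|x| => a b; rewrite lecE /= => /andP[/eqP -> _].
Qed.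

Lemma normR_ge0 x : 0 <= normR x.
Proof. by rewrite -lecR -normRE rmorph0. Qed.

Lemma normRD x y : normR (x + y) <= normR x + normR y.
Proof. by rewrite -lecR rmorphD /= -!normRE ler_normD. Qed.

Lemma normRN x : normR (- x) = normR x.
Proof. by rewrite /normR normrN. Qed.

Lemma normRBC x y : normR (x - y) = normR (y - x).
Proof. by rewrite -normRN opprB. Qed.

Lemma normRB_add z x y : normR (x - y) <= normR (x - z) + normR (z - y).
Proof. by apply: le_trans (normRD _ _); rewrite addrA subrK. Qed.

Lemma normR0 : normR (0 : H) = 0.
Proof. by rewrite /normR normr0. Qed.

Lemma normR_eq0 x : normR x = 0 -> x = 0.
Proof. by move=> h; apply/normr0_eq0; rewrite normRE h. Qed.

Lemma normRZ (c : R[i]) x : normR (c *: x) = complex.Re `|c| * normR x.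
Proof. by rewrite /normR normrZ normRE; case: c => a b /=; rewrite mulr0 subr0. Qed.

Lemma normRZr (r : R) x : normR (r%:C *: x) = `|r| * normR x.
Proof. by rewrite normRZ /= expr0n /= addr0 sqrtr_sqr. Qed.

Lemma normR_sum (I : Type) (s : seq I) (P : pred I) (f : I -> H) :
  normR (\sum_(i <- s | P i) f i) <= \sum_(i <- s | P i) normR (f i).
Proof.
elim/big_ind2 : _ => [|a b c d h1 h2|//]; first by rewrite normR0.
by rewrite (le_trans (normRD _ _))// lerD.
Qed.

Lemma ler_dist_normR x y : `|normR x - normR y| <= normR (x - y).
Proof.
have h (z w : H) : normR z - normR w <= normR (z - w).
  by rewrite lerBlDr; apply: le_trans (normRD _ _); rewrite subrK.
by rewrite ler_norml h andbT lerNl opprB normRBC.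
Qed.

Lemma cvg_normRP (I : Type) (F : set_system I) {FF : Filter F} (f : I -> H) l :
  f @ F --> l <-> forall e : R, 0 < e -> \forall t \near F, normR (l - f t) < e.
Proof.
split.
  move=> /cvgrPdist_lt h e e0.
  have := h e%:C; rewrite ltcR => /(_ e0); apply: filterS => t.
  by rewrite normRE ltcR.
move=> h; apply/cvgrPdist_lt => -[e1 e2].
rewrite ltcE /= => /andP[/eqP -> e0]; have := h _ e0.
by apply: filterS => t; rewrite normRE ltcR.
Qed.

Lemma cvg_normR (I : Type) (F : set_system I) {FF : Filter F} (f : I -> H) l :
  f @ F --> l -> normR (f t) @[t --> F] --> normR l.
Proof.
move=> /cvg_normRP h; apply/cvgrPdist_lt => e /h; apply: filterS => t.
exact/le_lt_trans/ler_dist_normR.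
Qed.

Lemma cvg_normR_le (I : Type) (F : set_system I) {FF : Filter F} (f : I -> H) l
    (g : I -> R) : (\forall t \near F, normR (l - f t) <= g t) ->
  g t @[t --> F] --> 0 -> f @ F --> l.
Proof.
move=> h /cvgrPdist_lt g0; apply/cvg_normRP => e e0.
have := g0 _ e0; apply: filterS2 h => t h1; rewrite sub0r normrN => h2.
by rewrite (le_lt_trans h1)// (le_lt_trans (ler_norm _) h2).
Qed.

End NormR.

Lemma cvg_toE (R : realFieldType) (I : Type) (F : set_system I)
    {FF : Filter F} (f : I -> R) (l : R) :
  f t @[t --> F] --> l -> (f t)%:E @[t --> F] --> l%:E.
Proof. by move=> fl; apply: cvg_EFin; [apply: nearW|exact: fl]. Qed.

Lemma cvg_le_cst (R : realType) (I : Type) (F : set_system I)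
    {FF : ProperFilter F} (f : I -> R) (l c : R) :
  f t @[t --> F] --> l -> (\forall t \near F, f t <= c) -> l <= c.
Proof.
move=> /cvgrPdist_lt fl fc; rewrite leNgt; apply/negP => cl.
have := fl (l - c); rewrite subr_gt0 => /(_ cl) h.
have [t [h1 h2]] := filter_ex (filterI fc h).
by have := le_lt_trans (ler_norm _) h2; rewrite ltrD2l ltrN2 ltNge h1.
Qed.

(** * Upper bounds of integrals of arbitrary functions *)

Section RawIntegral.
Context d (X : measurableType d) (R : realType).
Variable mu : {measure set X -> \bar R}.
Implicit Types (D : set X) (f : X -> R).

Import HBNNSimple.

Lemma ae_mono (P Q : X -> Prop) : {ae mu, forall t, P t} ->
  (forall t, P t -> Q t) -> {ae mu, forall t, Q t}.
Proof. by move=> h PQ; apply: filterS h. Qed.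

Lemma ae_mono2 (P P' Q : X -> Prop) : {ae mu, forall t, P t} ->
  {ae mu, forall t, P' t} -> (forall t, P t -> P' t -> Q t) ->
  {ae mu, forall t, Q t}.
Proof. by move=> h h' PQ; apply: filterS2 h h'. Qed.

(** The integral of a nonnegative function is the supremum of the integrals of
    the simple functions below it, whether or not the function is measurable.
    Setting such a simple function to 0 on the exceptional null set keeps its
    integral and puts it below the larger function, so that monotonicity almost
    everywhere needs no measurability. *)
Lemma ae_ge0_le_integral_raw D (f1 f2 : X -> \bar R) :
  (forall x, D x -> 0 <= f1 x)%E -> (forall x, D x -> 0 <= f2 x)%E ->
  {ae mu, forall x, D x -> (f1 x <= f2 x)%E} ->
  (\int[mu]_(x in D) f1 x <= \int[mu]_(x in D) f2 x)%E.
Proof.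
move=> f10 f20 [N [mN N0 f12]].
rewrite [leLHS]ge0_integralE// [leRHS]ge0_integralE//.
apply: ge_ereal_sup => _ [h /= hf1 <-].
have hE x : proj_nnsfun h (measurableC mN) x = if x \in N then 0 else h x.
  by rewrite -mrestrict patchE in_setC; case: (x \in N).
apply: ereal_sup_ge; exists (sintegral mu (proj_nnsfun h (measurableC mN))).
  exists (proj_nnsfun h (measurableC mN)) => // x.
  rewrite hE; have [xN|xN] /= := boolP (x \in N).
    exact: erestrict_ge0.
  have := hf1 x; rewrite !patchE; case: ifPn => // xD h1.
  apply: le_trans h1 _; rewrite inE in xD; apply: contrapT => h2.
  move/negP: xN; apply; rewrite inE; apply: f12 => /= h3.
  exact/h2/h3.
rewrite -!integralT_nnsfun.
apply: ae_ge0_le_integral => //.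
- by move=> x _; rewrite lee_fin fun_ge0.
- exact/measurable_EFinP.
- by move=> x _; rewrite lee_fin fun_ge0.
- exact/measurable_EFinP.
- exists N; split => // x h2; apply: contrapT => xN; apply: h2 => _.
  by rewrite hE (memNset xN).
Qed.

End RawIntegral.

Lemma bounded_series_cvg0 (R : realType) (u : nat -> R) (M : R) : (forall n, 0 <= u n) ->
  (forall n, \sum_(k < n) u k <= M) -> u n @[n --> \oo] --> 0.
Proof.
move=> u0 uM; apply: cvg_series_cvg_0; apply: nondecreasing_is_cvgn.
  by apply: nondecreasing_series => n _ _.
by exists M => _ [n _ <-]; rewrite /series /= big_mkord.
Qed.

Section UpperIntegral.
Context (R : realType).
Local Notation mu := (@lebesgue_measure R).
Implicit Types (D : set R) (f : R -> R).

(** The upper integral of f on D is at most c. Upper integrals are subadditive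
    without any measurability assumption, which is why every distance in L^1 or
    L^2 below is expressed in this way: pointwise limits and differences of
    H-valued functions then raise no measurability question. *)
Definition upper_bounded D f (c : R) := exists g : R -> \bar R,
  [/\ measurable_fun D g, forall t, (0 <= g t)%E,
      {ae mu, forall t, D t -> ((f t)%:E <= g t)%E} &
      (\int[mu]_(t in D) g t <= c%:E)%E].

Lemma upper_bounded_le D f1 f2 (c1 c2 : R) :
  {ae mu, forall t, D t -> f1 t <= f2 t} -> c2 <= c1 ->
  upper_bounded D f2 c2 -> upper_bounded D f1 c1.
Proof.
move=> f12 c12 [g [mg g0 f2g gc]]; exists g; split => //.
  by apply: (ae_mono2 f12 f2g) => t h1 h2 Dt; apply: le_trans (h2 Dt); rewrite lee_fin h1.
by rewrite (le_trans gc)// lee_fin.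
Qed.

Lemma upper_boundedS D f1 f2 (c : R) : (forall t, D t -> f1 t <= f2 t) ->
  upper_bounded D f2 c -> upper_bounded D f1 c.
Proof. by move=> h; apply: upper_bounded_le => //; apply: aeW. Qed.

Lemma upper_boundedD D f1 f2 (c1 c2 : R) : measurable D ->
  upper_bounded D f1 c1 -> upper_bounded D f2 c2 ->
  upper_bounded D (fun t => f1 t + f2 t) (c1 + c2).
Proof.
move=> mD [g1 [mg1 g10 fg1 gc1]] [g2 [mg2 g20 fg2 gc2]].
exists (fun t => g1 t + g2 t)%E; split => //.
- exact: emeasurable_funD.
- by move=> t; rewrite adde_ge0.
- by apply: (ae_mono2 fg1 fg2) => t h1 h2 Dt; rewrite EFinD leeD ?h1 ?h2.
- by rewrite ge0_integralD// EFinD leeD.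
Qed.

Lemma upper_boundedZ D f (k c : R) : measurable D -> 0 <= k ->
  upper_bounded D f c -> upper_bounded D (fun t => k * f t) (k * c).
Proof.
move=> mD k0 [g [mg g0 fg gc]].
exists (fun t => k%:E * g t)%E; split => //.
- exact: measurable_funeM.
- by move=> t; rewrite mule_ge0 ?lee_fin.
- by apply: (ae_mono fg) => t h1 Dt; rewrite EFinM lee_wpmul2l ?lee_fin ?h1.
- by rewrite ge0_integralZl// ?lee_fin// EFinM lee_wpmul2l// lee_fin.
Qed.

Lemma upper_bounded_cst D (k : R) : measurable D -> (mu D < +oo)%E -> 0 <= k ->
  upper_bounded D (cst k) (k * fine (mu D)).
Proof.
move=> mD Dfin k0; exists (cst k%:E); split => //.
- by apply: aeW => t _ /=; exact: lexx.
- by rewrite integral_cst// EFinM fineK// ge0_fin_numE.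
Qed.

(** For a nonnegative function that is measurable up to a null set, the upper
    integral is the integral; together with integral_le_upper_bound this passes
    between the two. *)
Lemma upper_bounded_integral D f (g : R -> R) (c : R) : measurable D ->
  measurable_fun D g -> (forall t, D t -> 0 <= f t) ->
  {ae mu, forall t, D t -> f t = g t} ->
  (\int[mu]_(t in D) (f t)%:E <= c%:E)%E -> upper_bounded D f c.
Proof.
move=> mD mg f0 fg h; exists (fun t => `|g t|%:E)%E; split => //.
- by apply/measurable_EFinP; exact: measurableT_comp.
- by apply: (ae_mono fg) => t h1 Dt; rewrite lee_fin h1// ler_norm.
- apply: le_trans h; apply: ae_ge0_le_integral_raw => //.
  by apply: (ae_mono fg) => t h1 Dt; rewrite -h1// ger0_norm// f0.
Qed.

Lemma integral_le_upper_bound D f (c : R) : (forall t, D t -> 0 <= f t) ->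
  upper_bounded D f c -> (\int[mu]_(t in D) (f t)%:E <= c%:E)%E.
Proof.
move=> f0 [g [mg g0 fg gc]]; apply: le_trans gc.
by apply: ae_ge0_le_integral_raw => // t Dt; rewrite lee_fin f0.
Qed.

(** The sum of the majorants has integral at most 1, hence is finite almost
    everywhere. This turns fast convergence in mean into convergence almost
    everywhere. *)
Lemma upper_bounded_series D (f : nat -> R -> R) : measurable D ->
  (forall n t, 0 <= f n t) ->
  (forall n, upper_bounded D (f n) (2^-1 ^+ n.+1)) ->
  {ae mu, forall t, D t -> exists M, forall n, \sum_(k < n) f k t <= M}.
Proof.
move=> mD f0 /choice[g hg].
have mg k : measurable_fun D (g k) by case: (hg k).
have g0 k t : (0 <= g k t)%E by case: (hg k).
have fg : {ae mu, forall t, forall k, D t -> ((f k t)%:E <= g k t)%E}.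
  by apply: ae_foralln => k; case: (hg k).
have I : (\int[mu]_(t in D) (\sum_(k <oo) g k t) <= 1)%E.
  rewrite integral_nneseries//.
  apply: le_trans (epsilon_trick0 xpredT (@ler01 R)).
  apply: lee_nneseries => n _; first by rewrite integral_ge0.
  case: (hg n) => _ _ _ h; apply: le_trans h _.
  by rewrite lee_fin exprVn mul1r natrX.
have msum : measurable_fun D (fun t => \sum_(k <oo) g k t)%E.
  exact: (@ge0_emeasurable_sum _ _ _ D g xpredT).
have int : mu.-integrable D (fun t => \sum_(k <oo) g k t)%E.
  apply/integrableP; split => //; apply: le_lt_trans (ltry 1).
  apply: le_trans I; rewrite le_eqVlt; apply/orP; left; apply/eqP.
  by apply: eq_integral => t _; rewrite gee0_abs// nneseries_ge0.
have fin : {ae mu, forall t, D t -> (\sum_(k <oo) g k t)%E \is a fin_num}.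
  exact: (integrable_ae _ int).
apply: (ae_mono2 fg fin) => t h1 /[swap] Dt /(_ Dt) h2.
exists (fine (\sum_(k <oo) g k t)%E) => n.
rewrite -lee_fin fineK// -sumEFin.
apply: (@le_trans _ _ (\sum_(k < n) g k t)%E).
  by apply: lee_sum => k _; apply: h1.
rewrite -(big_mkord xpredT (fun k => g k t)).
by apply: nneseries_lim_ge.
Qed.

End UpperIntegral.

(** * Real inner product and simple functions *)

Lemma Re_conj (R : realType) (z : R[i]) : complex.Re (Num.conj z) = complex.Re z.
Proof. by case: z. Qed.

Lemma Re_realM (R : realType) (r : R) (z : R[i]) :
  complex.Re (r%:C * z) = r * complex.Re z.
Proof. by case: z => a b /=; rewrite mul0r subr0. Qed.

Section RealInnerProduct.
Context (R : realType) (H : normedModType R[i]).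
Context (dot : {dot H for (@Num.conj R[i])}) (dotH : hilbert_norm dot).
Implicit Types (x y : H).

(** The real part of a Hermitian form is a real inner product with the same
    norm, and it already determines vectors. Vector identities between integrals
    are tested against it, which reduces them to integrals of real functions. *)
Definition rdot x y : R := complex.Re (dot x y).

Lemma rdotDl x y z : rdot (x + y) z = rdot x z + rdot y z.
Proof. by rewrite /rdot linearDl raddfD. Qed.

Lemma rdotC x y : rdot x y = rdot y x.
Proof. by rewrite /rdot hermC expr0 mul1r; exact: Re_conj. Qed.

Lemma rdotDr x y z : rdot x (y + z) = rdot x y + rdot x z.
Proof. by rewrite rdotC rdotDl rdotC [rdot z x]rdotC. Qed.

Lemma rdotZl (c : R[i]) x y : rdot (c *: x) y = rdot x (Num.conj c *: y).
Proof. by rewrite /rdot linearZl_LR linearZr_LR /= conjCK. Qed.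

Lemma rdotZrl (r : R) x y : rdot (r%:C *: x) y = r * rdot x y.
Proof. by rewrite /rdot linearZl_LR; exact: Re_realM. Qed.

Lemma rdot0l x : rdot 0 x = 0.
Proof. by rewrite -(scale0r (0 : H)) -(rmorph0 (@real_complex R)) rdotZrl mul0r. Qed.

Lemma rdotNl x y : rdot (- x) y = - rdot x y.
Proof. by apply/eqP; rewrite -subr_eq0 opprK -rdotDl addNr rdot0l. Qed.

Lemma rdotBl x y z : rdot (x - y) z = rdot x z - rdot y z.
Proof. by rewrite rdotDl rdotNl. Qed.

Lemma rdot_suml (I : Type) (s : seq I) (P : pred I) (f : I -> H) y :
  rdot (\sum_(i <- s | P i) f i) y = \sum_(i <- s | P i) rdot (f i) y.
Proof.
by elim/big_rec2: _ => [|i a b _ <-]; [rewrite rdot0l|rewrite rdotDl].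
Qed.

Lemma rdot_sumr (I : Type) (s : seq I) (P : pred I) (f : I -> H) y :
  rdot y (\sum_(i <- s | P i) f i) = \sum_(i <- s | P i) rdot y (f i).
Proof. by rewrite rdotC rdot_suml; apply: eq_bigr => i _; rewrite rdotC. Qed.

Lemma rdotxx x : rdot x x = normR x ^+ 2.
Proof. by rewrite /rdot -dotH normRE -rmorphXn. Qed.

Lemma normR_sqrD x y : normR (x + y) ^+ 2 = normR x ^+ 2 + 2 * rdot x y + normR y ^+ 2.
Proof. rewrite -!rdotxx !rdotDl !rdotDr [rdot y x]rdotC; ring. Qed.

(** Cauchy-Schwarz, read off the triangle inequality: expanding
    |x + y|^2 <= (|x| + |y|)^2 leaves exactly the bound on the inner product. *)
Lemma ler_norm_rdot x y : `|rdot x y| <= normR x * normR y.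
Proof.
have h z : rdot z y <= normR z * normR y.
  have := normRD z y; rewrite -(@ler_pXn2r _ 2)// ?nnegrE ?addr_ge0 ?normR_ge0//.
  by rewrite normR_sqrD sqrrD; lra.
by rewrite ler_norml h andbT lerNl -rdotNl -[normR x]normRN h.
Qed.

Lemma rdot_inj x y : (forall z, rdot x z = rdot y z) -> x = y.
Proof.
move=> h; apply/eqP; rewrite -subr_eq0; apply/eqP/normR_eq0/eqP.
by rewrite -sqrf_eq0 -rdotxx rdotBl h subrr.
Qed.

Lemma cvg_rdot (I : Type) (F : set_system I) {FF : Filter F} (f : I -> H) l y :
  f @ F --> l -> rdot (f t) y @[t --> F] --> rdot l y.
Proof.
move=> /cvg_normRP fl; apply/cvgrPdist_lt => e e0.
have y0 : 0 < normR y + 1 by rewrite ltr_wpDl// normR_ge0.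
have := fl _ (divr_gt0 e0 y0); apply: filterS => t.
rewrite ltr_pdivlMr// => h; apply: le_lt_trans h; rewrite -rdotBl.
by rewrite (le_trans (ler_norm_rdot _ _))// ler_wpM2l ?normR_ge0// lerDl.
Qed.

End RealInnerProduct.

Lemma bounded_integrable d (X : measurableType d) (R : realType)
    (mu : {measure set X -> \bar R}) D (f : X -> R) M : measurable D ->
  (mu D < +oo)%E -> measurable_fun D f -> (forall t, D t -> `|f t| <= M) ->
  mu.-integrable D (fun t => (f t)%:E).
Proof.
move=> mD Dfin mf fM; apply: measurable_bounded_integrable => //.
exists M; split; first by rewrite num_real.
by move=> N MN t Dt /=; rewrite (le_trans (fM _ Dt))// ltW.
Qed.

Section SimpleFunctions.
Context (R : realType) (H : normedModType R[i]).
Local Notation mu := (@lebesgue_measure R).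
Implicit Types (D : set R) (f g : R -> H).

Definition simple_function f :=
  finite_set (range f) /\ forall x, measurable (f @^-1` [set x]).

(** The integral of a simple function, for a bare function instead of a bundled
    one: simple_integral with the bundling removed. *)
Definition simple_sum D f : H :=
  \sum_(x \in range f) (fine (mu (D `&` f @^-1` [set x])))%:C *: x.

Lemma simple_functionP f : simple_function f ->
  exists2 s : {fimfun R >-> H}, is_simple s & s = f :> (R -> H).
Proof.
move=> [fin mf]; have h : f \in @fimfun R H by exact: mem_set.
by exists (fimfun_Sub h) => //; rewrite fimfun_valP.
Qed.

Lemma simple_function_fimfun (s : {fimfun R >-> H}) :
  is_simple s -> simple_function s.
Proof. by move=> hs; split. Qed.

Lemma simple_preimage f (B : set H) : simple_function f -> measurable (f @^-1` B).
Proof.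
move=> [fin mf].
rewrite [X in measurable X](_ : _ = \bigcup_(x in range f `&` B) f @^-1` [set x]).
  by apply: fin_bigcup_measurable => //; exact: finite_setIl.
apply/seteqP; split => [t Bft|t [x [_ Bx] /= ftx]]; last by rewrite /preimage/= ftx.
by exists (f t) => //; split => //; exists t.
Qed.

Lemma simple_function_cst x : simple_function (cst x).
Proof.
split; first exact: finite_image_cst.
by move=> y; rewrite preimage_cst; case: ifP.
Qed.

Lemma simple_function_op2 (op : H -> H -> H) f g :
  simple_function f -> simple_function g -> simple_function (fun t => op (f t) (g t)).
Proof.
move=> sf sg; have [finf _] := sf; have [fing mg] := sg; split.
  apply: (@sub_finite_set _ _ [set op x y | x in range f & y in range g]).
    by move=> _ [t _ <-]; exists (f t); [exists t|exists (g t) => //; exists t].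
  exact: finite_image2.
move=> x.
rewrite [X in measurable X](_ : _ =
    \bigcup_(y in range g) (f @^-1` [set z | op z y = x] `&` g @^-1` [set y])).
  by apply: fin_bigcup_measurable => // y _; apply: measurableI => //; exact: simple_preimage.
apply/seteqP; split => [t <-|t [y _ [/= h gy]]]; last by rewrite /preimage/= gy.
by exists (g t) => //; exists t.
Qed.

Lemma simple_functionD f g :
  simple_function f -> simple_function g -> simple_function (fun t => f t + g t).
Proof. exact: (@simple_function_op2 (fun x y => x + y)). Qed.

Lemma simple_functionB f g :
  simple_function f -> simple_function g -> simple_function (fun t => f t - g t).
Proof. exact: (@simple_function_op2 (fun x y => x - y)). Qed.

Lemma simple_function_comp (h : H -> H) f :
  simple_function f -> simple_function (fun t => h (f t)).
Proof. by move=> sf; exact: (simple_function_op2 (fun x _ => h x) sf sf). Qed.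

Lemma simple_function_patch (A : set R) f : measurable A ->
  simple_function f -> simple_function (fun t => if t \in A then f t else 0).
Proof.
move=> mA sf; have [finf mf] := sf; split.
  apply: (@sub_finite_set _ _ (range f `|` [set 0])).
    move=> _ [t _ <-]; case: ifP => _; last by right.
    by left; exists t.
  by rewrite finite_setU; split => //; exact: finite_set1.
move=> x; have [x0|/eqP x0] := eqVneq x 0.
  rewrite [X in measurable X](_ : _ = ~` A `|` f @^-1` [set x]).
    by apply: measurableU => //; exact: measurableC.
  apply/seteqP; split => t; rewrite /preimage/=.
    by case: ifPn => [_|]; [right|rewrite notin_setE; left].
  by case: ifPn => [|_ _]; [rewrite inE => tA []|rewrite x0].
rewrite [X in measurable X](_ : _ = A `&` f @^-1` [set x]).
  exact: measurableI.
apply/seteqP; split => t; rewrite /preimage/=.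
  by case: ifPn => [|_ /esym//]; rewrite inE.
by move=> [At]; rewrite mem_set.
Qed.

Lemma simple_function_sum (I : Type) (r : seq I) (P : pred I) (f : I -> R -> H) :
  (forall i, P i -> simple_function (f i)) ->
  simple_function (fun t => \sum_(i <- r | P i) f i t).
Proof.
move=> sf; elim: r => [|i r IH].
  rewrite (_ : (fun _ => _) = cst 0); first exact: simple_function_cst.
  by apply/funext => t; rewrite big_nil.
have [Pi|/negPf Pi] := boolP (P i); last first.
  rewrite (_ : (fun _ => _) = (fun t => \sum_(i <- r | P i) f i t))//.
  by apply/funext => t; rewrite big_cons Pi.
rewrite (_ : (fun _ => _) = (fun t => f i t + \sum_(i <- r | P i) f i t)).
  by apply: simple_functionD => //; exact: sf.
by apply/funext => t; rewrite big_cons Pi.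
Qed.

Lemma simple_measurable_comp (phi : H -> R) f (D : set R) : simple_function f ->
  measurable_fun D (fun t => phi (f t)).
Proof.
move=> sf; apply: (@measurable_funS _ _ _ _ setT) => // _ Y mY.
by rewrite setTI; exact: (simple_preimage (phi @^-1` Y)).
Qed.

Lemma simple_integrable_comp (phi : H -> R) f D : measurable D ->
  (mu D < +oo)%E -> simple_function f ->
  mu.-integrable D (fun t => (phi (f t))%:E).
Proof.
move=> mD Dfin sf; have [/finite_seqP[s fs] _] := sf.
apply: (@bounded_integrable _ _ _ _ _ _ (\sum_(x <- s) `|phi x|)) => //.
  exact: simple_measurable_comp.
move=> t _; have /= : [set` s] (f t) by rewrite -fs; exists t.
elim: s {fs} => // x s IH; rewrite inE big_cons => /orP[/eqP <-|/IH h].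
  by rewrite lerDl sumr_ge0.
by rewrite (le_trans h)// lerDr.
Qed.

Context (dot : {dot H for (@Num.conj R[i])}) (dotH : hilbert_norm dot).
Local Notation rdot := (rdot dot).
Variable D : set R.
Hypotheses (mD : measurable D) (Dfin : (mu D < +oo)%E).

(** Testing against y turns the integral of a simple function into a Lebesgue
    integral of a real function. Linearity of simple_sum follows from that of
    the Lebesgue integral, with no common refinement of level sets. *)
Lemma rdot_simple_sum f y : simple_function f ->
  rdot (simple_sum D f) y = (\int[mu]_(t in D) rdot (f t) y)%R.
Proof.
move=> sf; have [finf mf] := sf.
rewrite /simple_sum fsbig_finite//= rdot_suml.
have fE t : rdot (f t) y =
    \sum_(x <- fset_set (range f)) rdot x y * \1_(f @^-1` [set x]) t.
  have ft : f t \in fset_set (range f) by rewrite in_fset_set// inE; exists t.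
  rewrite (bigD1_seq (f t) ft (fset_uniq _)) /=.
  rewrite indicE mem_set// mulr1 big1 ?addr0// => x xft.
  rewrite indicE memNset ?mulr0// => /= h.
  by rewrite h eqxx in xft.
transitivity (\int[mu]_(t in D) (\sum_(x <- fset_set (range f))
  rdot x y * \1_(f @^-1` [set x]) t))%R; last by apply: eq_Rintegral => t _.
rewrite /Rintegral; under eq_integral do rewrite -sumEFin.
have int1 x : mu.-integrable D (fun t => (\1_(f @^-1` [set x]) t)%:E).
  apply: (@bounded_integrable _ _ _ _ _ _ 1) => //.
    by apply: measurable_indic; exact: mf.
  move=> t _; by rewrite indicE; case: (_ \in _); rewrite normr_nat.
have int x : mu.-integrable D (fun t => (rdot x y * \1_(f @^-1` [set x]) t)%:E).
  apply: (@eq_integrable _ _ _ mu D mD (fun t => (rdot x y)%:E * (\1_(f @^-1` [set x]) t)%:E)%E).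
    by move=> t _; rewrite EFinM.
  exact: integrableZl.
rewrite integral_sum//.
have E x : (\int[mu]_(t in D) (rdot x y * \1_(f @^-1` [set x]) t)%:E =
            (rdot x y * fine (mu (D `&` f @^-1` [set x])))%:E)%E.
  under eq_integral do rewrite EFinM.
  rewrite integralZl//.
  rewrite integral_indic; [|exact: mD|exact: mf].
  rewrite setIC [RHS]EFinM fineK//.
  rewrite ge0_fin_numE//; apply: le_lt_trans Dfin.
  by apply: le_measure => //; rewrite inE//; apply: measurableI => //; exact: mf.
under [in RHS]eq_bigr do rewrite E.
rewrite sumEFin /=; apply: eq_bigr => x _.
by rewrite rdotZrl mulrC.
Qed.

Lemma simple_sumD f g : simple_function f -> simple_function g ->
  simple_sum D (fun t => f t + g t) = simple_sum D f + simple_sum D g.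
Proof.
move=> sf sg; apply: (rdot_inj dotH) => y.
rewrite rdotDl !rdot_simple_sum//; last exact: simple_functionD.
rewrite -RintegralD//; [|exact: (simple_integrable_comp (rdot^~ y))..].
by apply: eq_Rintegral => t _; rewrite rdotDl.
Qed.

Lemma simple_sumZ c f : simple_function f ->
  simple_sum D (fun t => c *: f t) = c *: simple_sum D f.
Proof.
move=> sf; apply: (rdot_inj dotH) => y.
rewrite rdotZl !rdot_simple_sum//; last exact: simple_function_comp.
by apply: eq_Rintegral => t _; rewrite rdotZl.
Qed.

Lemma simple_sumB f g : simple_function f -> simple_function g ->
  simple_sum D (fun t => f t - g t) = simple_sum D f - simple_sum D g.
Proof.
move=> sf sg; rewrite -scaleN1r -simple_sumZ// -simple_sumD//; last first.
  exact: simple_function_comp.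
by congr (simple_sum D _); apply/funext => t; rewrite scaleN1r.
Qed.

(** Testing the integral v against itself gives |v|^2 <= |v| c by
    Cauchy-Schwarz under the integral sign. *)
Lemma normR_simple_sum f c : simple_function f ->
  upper_bounded D (fun t => normR (f t)) c -> normR (simple_sum D f) <= c.
Proof.
move=> sf fc; have h : (\int[mu]_(t in D) (normR (f t))%:E <= c%:E)%E.
  by apply: integral_le_upper_bound fc => t _; exact: normR_ge0.
set v := simple_sum D f.
have h0 : 0 <= c.
  by rewrite -lee_fin (le_trans _ h)// integral_ge0// => t _; rewrite lee_fin normR_ge0.
have : normR v ^+ 2 <= normR v * c.
  rewrite -(rdotxx dotH) {1}/v rdot_simple_sum//.
  apply: (@le_trans _ _ (\int[mu]_(t in D) (normR v * normR (f t)))%R).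
    apply: le_Rintegral => //.
    - exact: (simple_integrable_comp (rdot^~ v)).
    - exact: (simple_integrable_comp (fun x => normR v * normR x)).
    - move=> t _; rewrite mulrC; apply: le_trans (ler_norm_rdot dotH _ _).
      exact: ler_norm.
  have int := simple_integrable_comp (@normR R H) mD Dfin sf.
  rewrite RintegralZl// ler_wpM2l ?normR_ge0//.
  rewrite -lee_fin /Rintegral fineK//; exact: integrable_fin_num.
have [-> //|v0] := eqVneq (normR v) 0.
by rewrite expr2 ler_pM2l// lt_neqAle eq_sym v0 normR_ge0.
Qed.

End SimpleFunctions.

(** * The Bochner integral *)

Lemma cvg_half_pow (R : realType) : (2^-1 : R) ^+ n @[n --> \oo] --> 0.
Proof. by apply: cvg_expr; rewrite ger0_norm// invf_lt1// ltr1n. Qed.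

Lemma cvg_half_powS (R : realType) : (2^-1 : R) ^+ n.+1 @[n --> \oo] --> 0.
Proof.
rewrite (cvg_shiftS (fun n => (2^-1 : R) ^+ n)); exact: cvg_half_pow.
Qed.

Section BochnerTheory.
Context (R : realType) (H : completeNormedModType R[i]).
Context (dot : {dot H for (@Num.conj R[i])}) (dotH : hilbert_norm dot).
Local Notation mu := (@lebesgue_measure R).
Implicit Types (f g s : R -> H) (u v w : H).

(** Estimates below hold up to a multiple of an approximation error that can be
    made arbitrarily small. *)
Lemma normR_le_eps (x : H) (c k : R) : 0 <= k ->
  (forall e, 0 < e -> normR x <= c + k * e) -> normR x <= c.
Proof.
move=> k0 h; apply/ler_addgt0Pr => e e0.
have k1 : 0 < k + 1 by rewrite ltr_wpDl.
apply: le_trans (h _ (divr_gt0 e0 k1)) _; rewrite lerD2l mulrA ler_pdivrMr//.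
by rewrite mulrC ler_wpM2l ?lerDl// ltW.
Qed.

Lemma normR_cauchy_cvg (x : nat -> H) :
  (forall e : R, 0 < e -> exists N, forall n, (N <= n)%N -> normR (x n - x N) <= e) ->
  exists l : H, x n @[n --> \oo] --> l.
Proof.
move=> h; suff cx : cvg (x @ \oo) by exists (lim (x @ \oo)).
apply/cauchy_cvgP; apply: cauchy_exP.
move=> -[e1 e2]; rewrite ltcE /= => /andP[/eqP -> e0].
have [N hN] := h _ (divr_gt0 e0 (ltr0Sn R 1)); exists (x N).
exists N => // n /= Nn; rewrite -ball_normE /= normRE ltcR normRBC.
by rewrite (le_lt_trans (hN _ Nn))// ltr_pdivrMr// ltr_pMr// ltr1n.
Qed.

(** The upper limit of measurable functions is measurable everywhere and agrees
    with the limit where there is one. *)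
Lemma ae_cvg_measurable (D : set R) (h : nat -> R -> R) (phi : R -> R) :
  measurable D -> (forall m, measurable_fun D (h m)) ->
  {ae mu, forall t, D t -> h m t @[m --> \oo] --> phi t} ->
  exists2 g, measurable_fun D g & {ae mu, forall t, D t -> phi t = g t}.
Proof.
move=> mD mh hphi.
exists (fun t => fine (limn_esup (fun m => (h m t)%:E))).
  apply: (@measurableT_comp _ _ _ _ _ _ fine) => //.
  by apply: measurable_fun_limn_esup => m; exact/measurable_EFinP.
apply: (ae_mono hphi) => t /[apply] ht.
have c : (h m t)%:E @[m --> \oo] --> (phi t)%:E by exact: cvg_toE.
by rewrite is_cvg_limn_esupE; [rewrite (cvg_lim _ c)|apply/cvg_ex; exists (phi t)%:E].
Qed.

Section OnDomain.
Variable D : set R.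
Hypotheses (mD : measurable D) (Dfin : (mu D < +oo)%E).
Local Notation ubounded := (upper_bounded D).

Definition bochner_integrable f := forall e : R, 0 < e ->
  exists2 s, simple_function s & ubounded (fun t => normR (f t - s t)) e.

(** The same notion as is_bochner_integral, stated with one simple function per
    error instead of a sequence that also converges almost everywhere. It is
    stable under sums without choosing subsequences. *)
Definition has_bochner f v := forall e : R, 0 < e -> exists s,
  [/\ simple_function s, ubounded (fun t => normR (f t - s t)) e &
      normR (v - simple_sum D s) <= e].

Lemma upper_bounded_normR_add f g c e :
  ubounded (fun t => normR (f t)) c ->
  ubounded (fun t => normR (f t - g t)) e ->
  ubounded (fun t => normR (g t)) (c + e).
Proof.
move=> fc fge; apply: upper_boundedS (upper_boundedD mD fc fge) => t _.
by rewrite -[X in _ + X]normRN opprB -{1}[g t](subrK (f t)) addrC normRD.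
Qed.

Lemma normR_bochner f v c : has_bochner f v ->
  ubounded (fun t => normR (f t)) c -> normR v <= c.
Proof.
move=> fv fc; apply: (@normR_le_eps _ _ 2) => // e e0.
have [s [ss fs vs]] := fv _ e0.
have := normR_simple_sum dotH mD Dfin ss (upper_bounded_normR_add fc fs).
have := normRD (v - simple_sum D s) (simple_sum D s); rewrite subrK; lra.
Qed.

Lemma has_bochner_simple s : simple_function s -> has_bochner s (simple_sum D s).
Proof.
move=> ss e e0; exists s; split => //; last by rewrite subrr normR0 ltW.
have := upper_bounded_cst mD Dfin (lexx (0 : R)); rewrite mul0r.
apply: upper_bounded_le; last exact: ltW.
by apply: aeW => t _ /=; rewrite subrr normR0.
Qed.

Lemma has_bochnerD f g v w : has_bochner f v -> has_bochner g w ->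
  has_bochner (fun t => f t + g t) (v + w).
Proof.
move=> fv gw e e0; have e2 : 0 < e / 2 by rewrite divr_gt0.
have [s [ss fs vs]] := fv _ e2; have [s' [ss' gs ws]] := gw _ e2.
exists (fun t => s t + s' t); split; first exact: simple_functionD.
  have := upper_boundedD mD fs gs; rewrite -splitr; apply: upper_boundedS => t _.
  by rewrite opprD addrACA normRD.
rewrite (simple_sumD dotH)// opprD addrACA.
by apply: le_trans (normRD _ _) _; rewrite [leRHS]splitr lerD.
Qed.

Lemma has_bochnerZ c f v : has_bochner f v ->
  has_bochner (fun t => c *: f t) (c *: v).
Proof.
move=> fv e e0; set k := complex.Re `|c|.
have k0 : 0 <= k.
  have : 0 <= `|c| by [].
  by rewrite /k lecE => /andP[_].
have k1 : 0 < k + 1 by rewrite ltr_wpDl.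
have [s [ss fs vs]] := fv _ (divr_gt0 e0 k1).
have ke : k * (e / (k + 1)) <= e.
  by rewrite mulrA ler_pdivrMr// mulrC ler_wpM2l ?lerDl// ltW.
exists (fun t => c *: s t); split; first exact: simple_function_comp.
  apply: upper_bounded_le ke (upper_boundedZ mD k0 fs); apply: aeW => t _.
  by rewrite -scalerBr normRZ.
rewrite (simple_sumZ dotH)// -scalerBr normRZ -/k.
by rewrite (le_trans _ ke)// ler_wpM2l.
Qed.

Lemma has_bochnerB f g v w : has_bochner f v -> has_bochner g w ->
  has_bochner (fun t => f t - g t) (v - w).
Proof.
move=> fv /(has_bochnerZ (-1)) gw; have := has_bochnerD fv gw; rewrite scaleN1r.
by congr has_bochner; apply/funext => t; rewrite scaleN1r.
Qed.

Lemma has_bochner0 : has_bochner (fun=> 0) 0.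
Proof.
move=> e e0; have := has_bochner_simple (simple_function_cst (0 : H)) e0.
have -> // : simple_sum D (cst (0 : H)) = 0.
have := simple_sumZ dotH mD Dfin 0 (simple_function_cst (0 : H)).
rewrite scale0r => {2}<-; congr simple_sum.
by apply/funext => t; rewrite scaler0.
Qed.

Lemma has_bochner_sum (I : eqType) (r : seq I) (f : I -> R -> H) (v : I -> H) :
  (forall i, i \in r -> has_bochner (f i) (v i)) ->
  has_bochner (fun t => \sum_(i <- r) f i t) (\sum_(i <- r) v i).
Proof.
elim: r => [|i r IH] h.
  rewrite big_nil (_ : (fun _ => _) = fun=> 0); first exact: has_bochner0.
  by apply/funext => t; rewrite big_nil.
rewrite big_cons (_ : (fun _ => _) = fun t => f i t + \sum_(i <- r) f i t).
  apply: has_bochnerD; first by apply: h; rewrite mem_head.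
  by apply: IH => j jr; apply: h; rewrite inE jr orbT.
by apply/funext => t; rewrite big_cons.
Qed.

Lemma has_bochner_ae f g v : {ae mu, forall t, D t -> f t = g t} ->
  has_bochner f v -> has_bochner g v.
Proof.
move=> fg fv e /fv[s [ss fs vs]]; exists s; split => //.
apply: upper_bounded_le (lexx e) fs; apply: (ae_mono fg) => t /[apply] ->.
exact: lexx.
Qed.

Lemma has_bochner_unique f v w : has_bochner f v -> has_bochner f w -> v = w.
Proof.
move=> fv fw; apply/eqP; rewrite -subr_eq0; apply/eqP/normR_eq0/eqP.
rewrite eq_le normR_ge0 andbT.
apply: normR_bochner (has_bochnerB fv fw) _.
have := upper_bounded_cst mD Dfin (lexx (0 : R)); rewrite mul0r.
by apply: upper_boundedS => t _; rewrite subrr normR0.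
Qed.

(** Integrals of simple functions at distance 2^-(n+1) form a Cauchy sequence,
    since the norm of an integral is at most the upper integral of the norm;
    completeness of H provides the value. *)
Lemma bochner_integrable_exists f : bochner_integrable f ->
  exists v, has_bochner f v.
Proof.
move=> fi; have h n : exists s, simple_function s /\
    ubounded (fun t => normR (f t - s t)) (2^-1 ^+ n.+1).
  by have [|s ss fs] := fi (2^-1 ^+ n.+1); [rewrite exprn_gt0|exists s].
have {h}[s hs] := choice h.
have d n m : (n <= m)%N ->
    normR (simple_sum D (s m) - simple_sum D (s n)) <= 2^-1 ^+ n.
  move=> nm; have [sn fn] := hs n; have [sm fm] := hs m.
  rewrite -(simple_sumB dotH)//.
  apply: (normR_simple_sum dotH) => //; first exact: simple_functionB.
  apply: upper_bounded_le (upper_boundedD mD fm fn).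
    apply: aeW => t _; rewrite -[X in _ <= X + _]normRN opprB.
    by apply: le_trans (normRD _ _); rewrite addrA subrK.
  rewrite -[leRHS]mulr1 [X in _ <= _ * X](splitr 1) div1r mulrDr -exprSr lerD2r.
  by rewrite ler_wiXn2l// ?invf_le1// ler1n.
have p0 := @cvg_half_pow R.
have small (e : R) : 0 < e -> exists N, 2^-1 ^+ N <= e.
  move=> e0; have /cvgrPdist_lt/(_ _ e0)[N _ hN] := p0; exists N.
  by have := hN N (leqnn N); rewrite sub0r normrN => /(le_lt_trans (ler_norm _))/ltW.
have [v hv] : exists v, simple_sum D (s n) @[n --> \oo] --> v.
  apply: normR_cauchy_cvg => e /small[N hN]; exists N => n Nn.
  exact: le_trans (d _ _ Nn) hN.
exists v => e /small[N hN]; exists (s N); have [sN fN] := hs N; split => //.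
  apply: upper_bounded_le fN => //; first by apply: aeW => t _; exact: lexx.
  apply: le_trans hN; rewrite exprS ger_pMl ?exprn_gt0//.
  by rewrite invf_le1// ler1n.
have lim : normR (simple_sum D (s n) - simple_sum D (s N)) @[n --> \oo] -->
    normR (v - simple_sum D (s N)).
  by apply: cvg_normR; apply: cvgB => //; exact: cvg_cst.
apply: le_trans hN; apply: cvg_le_cst lim _.
by exists N => // n /= Nn; exact: d.
Qed.

Lemma bochner_integrable_closed f : (forall e : R, 0 < e ->
    exists2 g, bochner_integrable g & ubounded (fun t => normR (f t - g t)) e) ->
  bochner_integrable f.
Proof.
move=> h e e0; have e2 : 0 < e / 2 by rewrite divr_gt0.
have [g gi fg] := h _ e2; have [s ss gs] := gi _ e2; exists s => //.
have := upper_boundedD mD fg gs; rewrite -splitr; apply: upper_boundedS => t _.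
exact: normRB_add.
Qed.

(** Simple functions at distance 2^-(n+1) in mean converge almost everywhere,
    because the sum of these distances is finite almost everywhere. *)
Lemma is_bochner_of_has f v : has_bochner f v -> is_bochner_integral D f v.
Proof.
move=> fv; have h n : exists s : {fimfun R >-> H}, is_simple s /\
    (ubounded (fun t => normR (f t - s t)) (2^-1 ^+ n.+1) /\
     normR (v - simple_sum D s) <= 2^-1 ^+ n.+1).
  have [|s [/simple_functionP[s' ss' <-] fs vs]] := fv (2^-1 ^+ n.+1).
    by rewrite exprn_gt0.
  by exists s'.
have {h}[s hs] := choice h.
have p0 := @cvg_half_powS R.
exists s; split.
- split=> [n|]; first by case: (hs n).
  have := @upper_bounded_series R D (fun n t => normR (f t - s n t)) mD.
  move=> /(_ (fun n t => normR_ge0 _) (fun n => (hs n).2.1)).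
  move=> /ae_mono; apply => t /[swap] Dt /(_ Dt)[M hM].
  have := bounded_series_cvg0 (fun n => normR_ge0 (f t - s n t)) hM.
  by apply: cvg_normR_le; apply: nearW => n; exact: lexx.
- apply: (@squeeze_cvge _ _ _ _ (cst 0%E) _ (fun n => (2^-1 ^+ n.+1)%:E)).
  + apply: nearW => n; rewrite integral_ge0 /=; last by move=> t _; rewrite lee_fin normR_ge0.
    by apply: integral_le_upper_bound => [t _|]; [exact: normR_ge0|case: (hs n) => _ []].
  + exact: cvg_cst.
  + exact: cvg_toE.
- by apply: cvg_normR_le p0; apply: nearW => n; case: (hs n) => _ [].
Qed.

(** Here the distances are bounded in the sense of the raw integral; they are
    measurable up to a null set as limits of norms of simple functions, so their
    upper integrals are bounded too. *)
Lemma has_bochner_of_is f v : is_bochner_integral D f v -> has_bochner f v.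
Proof.
move=> [s [[ss sf] If Iv]] e e0.
have : \forall n \near \oo, (\int[mu]_(t in D) (normR (f t - s n t))%:E <= e%:E)%E.
  move/fine_cvgP : If => [fin /cvgrPdist_lt/(_ _ e0)].
  apply: filterS2 fin => n fin; rewrite sub0r normrN => /(le_lt_trans (ler_norm _))/ltW.
  by rewrite -lee_fin fineK.
move/cvg_normRP : Iv => /(_ _ e0)/filterS2/[apply].
move=> /(_ _ (fun n (p : _ < _) (q : is_true _) => conj p q))[N _ /(_ N (leqnn N))[vs fs]].
exists (s N); split; [exact: simple_function_fimfun| |exact: ltW].
have [||g mg fg] := @ae_cvg_measurable D (fun m t => normR (s m t - s N t))
    (fun t => normR (f t - s N t)) mD.
- move=> m; apply: (@simple_measurable_comp _ _ (@normR _ _)).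
  by apply: simple_functionB; exact: simple_function_fimfun.
- apply: (ae_mono sf) => t /[apply] st.
  by apply: cvg_normR; apply: cvgB => //; exact: cvg_cst.
by apply: upper_bounded_integral fg fs => // t _; exact: normR_ge0.
Qed.

Lemma bochner_integralE f v : has_bochner f v -> bochner_integral D f = v.
Proof.
move=> fv; rewrite /bochner_integral; apply: xget_unique.
  exact: is_bochner_of_has.
by move=> w /has_bochner_of_is fw; exact: has_bochner_unique fw fv.
Qed.

Lemma bochner_integrableP f :
  bochner_integrable f -> has_bochner f (bochner_integral D f).
Proof. by move=> /bochner_integrable_exists[v fv]; rewrite (bochner_integralE fv). Qed.

End OnDomain.

End BochnerTheory.

(** * Continuous functions and the fundamental theorem of calculus *)

Lemma near0_dnbhsP (R : realType) (P : R -> Prop) :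
  (\forall h \near (0 : R)^', P h) <->
  exists2 d : R, 0 < d & forall h, h != 0 -> `|h| < d -> P h.
Proof.
split=> [|[d d0 hP]].
  move=> /nbhs_ballP[d /= d0 hd]; exists d => // h h0 hlt.
  by apply: hd => //; rewrite /ball /= sub0r normrN.
apply/nbhs_ballP; exists d => // h; rewrite /ball /= sub0r normrN => h1 h2.
exact: hP.
Qed.

Lemma near0_rightP (R : realType) (P : R -> Prop) :
  (\forall h \near (0 : R)^'+, P h) <->
  exists2 d : R, 0 < d & forall h, 0 < h -> h < d -> P h.
Proof.
split=> [|[d d0 hP]].
  move=> /nbhs_ballP[d /= d0 hd]; exists d => // h h0 hlt.
  by apply: hd => //; rewrite /ball /= sub0r normrN gtr0_norm.
apply/nbhs_ballP; exists d => // h; rewrite /ball /= sub0r normrN => h1 h2.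
by apply: hP => //; exact: le_lt_trans (ler_norm _) h1.
Qed.

Lemma lebesgue_segment_lty (R : realType) (a b : R) :
  (@lebesgue_measure R `[a, b] < +oo)%E.
Proof.
by rewrite lebesgue_measure_itv /=; case: ifPn => // _; rewrite -EFinB ltry.
Qed.

Section ContinuousFunctions.
Context (R : realType) (H : normedModType R[i]).
Implicit Types (f : R -> H) (A : set R).

Lemma within_continuousP f A : {within A, continuous f} <->
  forall t, A t -> forall e : R, 0 < e ->
    exists2 d : R, 0 < d & forall s, A s -> `|s - t| < d -> normR (f s - f t) < e.
Proof.
split.
  move=> /subspace_continuousP cf t At e e0.
  have /cvg_normRP/(_ _ e0)/nbhs_ballP[d /= d0 hd] := cf _ At.
  exists d => // s As std; rewrite normRBC; apply: hd => //.
  by rewrite /ball /= distrC.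
move=> cf; apply/subspace_continuousP => t At; apply/cvg_normRP => e e0.
have [d d0 hd] := cf _ At _ e0.
apply/nbhs_ballP; exists d => // s; rewrite /ball /= => std As.
by rewrite normRBC hd// distrC.
Qed.

(** The set of x up to which f is uniformly close to a simple function has a
    supremum c. Continuity at c extends the approximation beyond c by the
    constant f c, so c cannot lie inside the interval. *)
Lemma step_approximation f (a b e : R) : a <= b ->
  {within `[a, b], continuous f} -> 0 < e ->
  exists2 s, simple_function s & forall t, a <= t <= b -> normR (f t - s t) <= e.
Proof.
move=> ab /within_continuousP cf e0.
pose A := [set x | a <= x <= b /\
  exists2 s, simple_function s & forall t, a <= t <= x -> normR (f t - s t) <= e].
have Aa : A a.
  split; first by rewrite lexx.
  exists (cst (f a)); first exact: simple_function_cst.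
  by move=> t /le_anti <-; rewrite /cst subrr normR0 ltW.
have supA : has_sup A.
  by split; [exists a|exists b => x [/andP[]]].
set c := sup A.
have ac : a <= c by apply: sup_upper_bound.
have cb : c <= b by apply: ge_sup; [exists a|move=> x [/andP[]]].
have [|d d0 hd] := cf c _ e e0; first by rewrite /= in_itv /= ac.
have [x [/andP[ax xb] [s ss hs]] cx] := sup_adherent d0 supA.
have xc : x <= c by apply: sup_upper_bound => //; split; [rewrite ax|exists s].
pose y := Num.min b (c + d / 2).
have cd : c < c + d / 2 by rewrite ltrDl divr_gt0.
have Ay : A y.
  split; first by rewrite ge_min lexx /= andbT le_min ab (le_trans ac (ltW cd)).
  (* The old approximation up to x, then the value at c. *)
  exists (fun t => (if t \in [set t | t <= x] then s t else 0) +
                   (if t \in [set t | x < t] then f c else 0)).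
    apply: simple_functionD; apply: simple_function_patch.
    - by rewrite -set_itvNyc.
    - exact: ss.
    - by rewrite -set_itvoy.
    - exact: simple_function_cst.
  move=> t /andP[at_]; rewrite le_min => /andP[tb tc].
  have [tx|xt] := leP t x.
    have -> : (t \in [set t | t <= x]) = true by rewrite mem_set.
    have -> : (t \in [set t | x < t]) = false by rewrite memNset//= ltNge tx.
    by rewrite addr0; apply: hs; rewrite at_ tx.
  have -> : (t \in [set t | x < t]) = true by rewrite mem_set.
  have -> : (t \in [set t | t <= x]) = false by rewrite memNset//= leNgt xt.
  rewrite add0r; apply/ltW/hd; first by rewrite /= in_itv /= at_.
  rewrite ltr_norml ltrBrDl (lt_trans cx xt)/= ltrBlDl (le_lt_trans tc)//.
  by rewrite ltrD2l ltr_pdivrMr// ltr_pMr// ltr1n.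
have yc : y <= c by apply: sup_upper_bound.
have yb : y = b.
  by move: yc; rewrite /y /Num.min; case: ifP => // _; rewrite leNgt cd.
have [_ [s' ss' hs']] := Ay; exists s' => // t htb.
by apply: hs'; rewrite yb.
Qed.

End ContinuousFunctions.

Section VectorFTC.
Context (R : realType) (H : completeNormedModType R[i]).
Context (dot : {dot H for (@Num.conj R[i])}) (dotH : hilbert_norm dot).
Local Notation mu := (@lebesgue_measure R).
Local Notation rdot := (rdot dot).
Implicit Types (f : R -> H).

Lemma upper_bounded_uniform (a b : R) (phi : R -> R) (c : R) : 0 <= c ->
  (forall t, a <= t <= b -> phi t <= c) ->
  upper_bounded `[a, b] phi (c * fine (mu `[a, b])).
Proof.
move=> c0 h; apply: upper_boundedS (upper_bounded_cst _ (lebesgue_segment_lty a b) c0) => //.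
Qed.

Lemma continuous_bochner_integrable f (a b : R) : a <= b ->
  {within `[a, b], continuous f} -> bochner_integrable `[a, b] f.
Proof.
move=> ab cf e e0; set m := fine (mu `[a, b]).
have m0 : 0 <= m by rewrite fine_ge0.
have m1 : 0 < m + 1 by rewrite ltr_wpDl.
have [s ss hs] := step_approximation ab cf (divr_gt0 e0 m1).
exists s => //; apply: upper_bounded_le (upper_bounded_uniform _ hs).
- by apply: aeW => t _; exact: lexx.
- by rewrite -/m mulrAC ler_pdivrMr// ler_wpM2l ?lerDl// ltW.
- by rewrite divr_ge0 ?ltW.
Qed.

(** Both sides are within |y| e of the corresponding quantity for a simple
    function at distance e. *)
Lemma rdot_bochner (D : set R) f v y : measurable D -> (mu D < +oo)%E ->
  measurable_fun D (fun t => rdot (f t) y) -> has_bochner D f v ->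
  mu.-integrable D (fun t => (rdot (f t) y)%:E) /\
  (\int[mu]_(t in D) rdot (f t) y)%R = rdot v y.
Proof.
move=> mD Dfin mf fv.
have y0 : 0 <= normR y by exact: normR_ge0.
have B (s : R -> H) (e : R) : upper_bounded D (fun t => normR (f t - s t)) e ->
    (\int[mu]_(t in D) `|rdot (f t) y - rdot (s t) y|%:E <= (normR y * e)%:E)%E.
  move=> fs; apply: integral_le_upper_bound => //.
  apply: upper_boundedS (upper_boundedZ mD y0 fs) => t _.
  by rewrite -rdotBl mulrC ler_norm_rdot.
have int (s : R -> H) : simple_function s ->
    mu.-integrable D (fun t => (rdot (s t) y)%:E).
  by move=> ss; exact: (simple_integrable_comp (rdot^~ y)).
have intB (s : R -> H) e : simple_function s ->
    upper_bounded D (fun t => normR (f t - s t)) e ->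
    mu.-integrable D (fun t => (rdot (f t) y - rdot (s t) y)%:E).
  move=> ss fs; apply/integrableP; split.
    apply/measurable_EFinP; apply: measurable_funB => //.
    exact: (simple_measurable_comp (rdot^~ y)).
  by apply: le_lt_trans (ltry _); exact: (B s e).
have intf : mu.-integrable D (fun t => (rdot (f t) y)%:E).
  have [s [ss fs _]] := fv _ ltr01.
  have : mu.-integrable D ((fun t => (rdot (f t) y - rdot (s t) y)%:E) \+
      (fun t => (rdot (s t) y)%:E))%E.
    by apply: integrableD => //; [exact: (intB s 1)|exact: int].
  by apply: eq_integrable => // t _ /=; rewrite -EFinD subrK.
split=> //; apply/eqP; rewrite -subr_eq0 -normr_eq0 eq_le normr_ge0 andbT.
apply/ler_addgt0Pr => e e0; rewrite add0r.
have k0 : 0 < 2 * (normR y + 1) by rewrite mulr_gt0// ltr_wpDl.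
have [s [ss fs vs]] := fv _ (divr_gt0 e0 k0).
set e' := e / _ in fs vs.
have e'0 : 0 < e' by rewrite divr_gt0.
have h1 : `|(\int[mu]_(t in D) rdot (f t) y)%R - rdot (simple_sum D s) y| <= normR y * e'.
  rewrite (rdot_simple_sum dot mD Dfin _ ss) -RintegralB//; last exact: int.
  apply: le_trans (le_normr_Rintegral _ _) _ => //; first exact: (intB _ _ ss fs).
  rewrite -lee_fin /Rintegral fineK; first exact: B.
  apply: integrable_fin_num => //.
  apply: (@eq_integrable _ _ _ mu D mD (abse \o (fun t => (rdot (f t) y - rdot (s t) y)%:E))).
    by move=> t _.
  by apply: integrable_abse; exact: (intB _ _ ss fs).
have h2 : `|rdot (simple_sum D s) y - rdot v y| <= normR y * e'.
  rewrite -rdotBl; apply: le_trans (ler_norm_rdot dotH _ _) _.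
  by rewrite normRBC mulrC ler_wpM2l.
have h3 : 2 * (normR y + 1) * e' = e by rewrite mulrC divfK// gt_eqF.
rewrite -(subrK (rdot (simple_sum D s) y) (Rintegral _ _ _)) -addrA.
apply: le_trans (ler_normD _ _) _; rewrite -h3; nra.
Qed.

Lemma rdot_bochner_continuous f v y (a b : R) :
  {within `[a, b], continuous f} -> has_bochner `[a, b] f v ->
  mu.-integrable `[a, b] (fun t => (rdot (f t) y)%:E) /\
  (\int[mu]_(t in `[a, b]) rdot (f t) y)%R = rdot v y.
Proof.
move=> cf fv; apply: rdot_bochner => //; first exact: lebesgue_segment_lty.
apply: subspace_continuous_measurable_fun => // t.
by apply: cvg_rdot => //; exact: cf.
Qed.

(** Two vectors are equal when all their real inner products are, and the inner
    product of F with a fixed vector is a real antiderivative to which the real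
    theorem applies. *)
Lemma bochner_FTC (F f : R -> H) (a b : R) : a <= b ->
  {within `[a, b], continuous f} -> {within `[a, b], continuous F} ->
  (forall t, a < t < b ->
     (h^-1)%:C *: (F (t + h) - F t) @[h --> (0 : R)^'] --> f t) ->
  has_bochner `[a, b] f (F b - F a).
Proof.
move=> ab cf cF F'f.
have [v fv] := bochner_integrable_exists dotH (measurable_itv _)
  (lebesgue_segment_lty a b) (continuous_bochner_integrable ab cf).
suff -> : F b - F a = v by [].
apply: (rdot_inj dotH) => y.
have [_ <-] := rdot_bochner_continuous y cf fv.
rewrite rdotBl; move: ab; rewrite le_eqVlt => /predU1P[ab|ab].
  by rewrite -ab set_itv1 Rintegral_set1 subrr.
have crdot (g : R -> H) : {within `[a, b], continuous g} ->
    {within `[a, b], continuous (fun t => rdot (g t) y)}.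
  by move=> cg t; apply: cvg_rdot => //; exact: cg.
have D t : t \in `]a, b[ -> is_derive t 1 (fun s => rdot (F s) y) (rdot (f t) y).
  rewrite in_itv /= => /F'f Ft.
  have h : (fun h : R => h^-1 *: (((fun s => rdot (F s) y) \o shift t) (h *: 1) -
      rdot (F t) y)) @ (0 : R)^' --> rdot (f t) y.
    have : rdot ((h^-1)%:C *: (F (t + h) - F t)) y @[h --> (0 : R)^'] --> rdot (f t) y.
      exact: cvg_rdot.
    apply: cvg_trans; apply: near_eq_cvg.
    by apply: nearW => h /=; rewrite rdotZrl rdotBl [h *: 1]mulr1 [h + t]addrC.
  by apply: DeriveDef; [apply/cvg_ex; exists (rdot (f t) y)|exact: cvg_lim h].
have [_ Fa Fb] := (continuous_within_itvP _ ab).1 (crdot _ cF).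
have := @continuous_FTC2 R (fun t => rdot (f t) y) (fun t => rdot (F t) y) a b ab (crdot _ cf).
rewrite /Rintegral => ->//.
- by split=> // t /D[].
- by move=> t /D[dt <-]; rewrite derive1E.
Qed.

End VectorFTC.

(** * Bounded semigroups *)

Section SemigroupTheory.
Context (R : realType) (H : completeNormedModType R[i]).
Context (dot : {dot H for (@Num.conj R[i])}) (dotH : hilbert_norm dot).
Local Notation mu := (@lebesgue_measure R).
Variable G : R -> H -> H.
Hypotheses (sgG : C0_semigroup G) (bdG : uniformly_bounded G).
Implicit Types (x y : H) (s t h : R).

Lemma semigroup_bound :
  exists2 M : R, 0 < M & forall t x, 0 <= t -> normR (G t x) <= M * normR x.
Proof.
have [M hM] := bdG; exists (`|M| + 1); first by rewrite ltr_wpDl.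
move=> t x t0; apply: le_trans (hM _ x t0) _; apply: ler_wpM2r.
  exact: normR_ge0.
by rewrite (le_trans (ler_norm _))// lerDl.
Qed.

Lemma semigroupD t x y : 0 <= t -> G t (x + y) = G t x + G t y.
Proof.
case: sgG => /(_ t) h _ _ _ /h[lG _].
by have := lG 1 x y; rewrite !scale1r.
Qed.

Lemma semigroup0x t : 0 <= t -> G t 0 = 0.
Proof. by move=> t0; apply: (addIr (G t 0)); rewrite -semigroupD// !add0r. Qed.

Lemma semigroupZ t c x : 0 <= t -> G t (c *: x) = c *: G t x.
Proof.
move=> t0; case: sgG => /(_ t) h _ _ _; have [lG _] := h t0.
by have := lG c x 0; rewrite !addr0 semigroup0x// addr0.
Qed.

Lemma semigroupB t x y : 0 <= t -> G t (x - y) = G t x - G t y.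
Proof. by move=> t0; rewrite -scaleN1r semigroupD// semigroupZ// scaleN1r. Qed.

Lemma semigroup_sum t (I : Type) (r : seq I) (f : I -> H) : 0 <= t ->
  G t (\sum_(i <- r) f i) = \sum_(i <- r) G t (f i).
Proof.
move=> t0; elim: r => [|i r IH]; first by rewrite !big_nil semigroup0x.
by rewrite !big_cons semigroupD// IH.
Qed.

Lemma semigroup_id x : G 0 x = x.
Proof. by case: sgG. Qed.

Lemma semigroup_comp s t x : 0 <= s -> 0 <= t -> G (s + t) x = G s (G t x).
Proof. by case: sgG => _ _ h _; exact: h. Qed.

Lemma semigroup_continuous x t e : 0 <= t -> 0 < e ->
  exists2 d : R, 0 < d & forall s, 0 <= s -> `|s - t| < d ->
    normR (G s x - G t x) < e.
Proof.
move=> t0 e0; have [M M0 hM] := semigroup_bound.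
case: (sgG) => _ _ _ /(_ x)/cvg_normRP/(_ _ (divr_gt0 e0 M0)).
move=> /near0_rightP[d d0 hd]; exists d => // s s0.
have [st|ts|->] := ltgtP s t; last by rewrite !subrr normR0.
(* Left continuity: S(t) x - S(s) x = S(s) (S(t - s) x - x) for s < t. *)
- rewrite ltr0_norm ?subr_lt0// opprB => h.
  have -> : G t x = G s (G (t - s) x).
    by rewrite -semigroup_comp ?subrKC// subr_ge0 ltW.
  rewrite -semigroupB//.
  apply: le_lt_trans (hM _ _ s0) _; rewrite -ltr_pdivlMl// mulrC.
  by apply: hd; rewrite ?subr_gt0.
- rewrite gtr0_norm ?subr_gt0// => h.
  have -> : G s x = G t (G (s - t) x).
    by rewrite -semigroup_comp ?subrKC// subr_ge0 ltW.
  rewrite -semigroupB//.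
  apply: le_lt_trans (hM _ _ t0) _; rewrite -ltr_pdivlMl// mulrC normRBC.
  by apply: hd; rewrite ?subr_gt0.
Qed.

Lemma semigroup_within_continuous x t :
  {within `[0, t], continuous (fun s => G s x)}.
Proof.
apply/within_continuousP => s; rewrite /= in_itv /= => /andP[s0 _] e e0.
have [d d0 hd] := semigroup_continuous x s0 e0.
by exists d => // r; rewrite /= in_itv /= => /andP[r0 _]; exact: hd.
Qed.

Lemma semigroup_reversed_continuous x t :
  {within `[0, t], continuous (fun s => G (t - s) x)}.
Proof.
apply/within_continuousP => s; rewrite /= in_itv /= => /andP[_ st] e e0.
have ts : 0 <= t - s by rewrite subr_ge0.
have [d d0 hd] := semigroup_continuous x ts e0.
exists d => // r; rewrite /= in_itv /= => /andP[_ rt] rs.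
by apply: hd; rewrite ?subr_ge0// opprB addrC subrKA distrC.
Qed.

Section Derivative.
Variables (x y : H).
Hypothesis xy : (h^-1)%:C *: (G h x - x) @[h --> (0 : R)^'+] --> y.

(** An orbit that starts in the domain is differentiable from both sides: for a
    negative increment h the quotient is S(t + h) applied to the quotient at 0
    for - h, and S(t + h) y tends to S(t) y by strong continuity. *)
Lemma semigroup_derivative t : 0 < t ->
  (h^-1)%:C *: (G (t + h) x - G t x) @[h --> (0 : R)^'] --> G t y.
Proof.
move=> t0; have [M M0 hM] := semigroup_bound.
apply/cvg_normRP => e e0; apply/near0_dnbhsP.
have e2 : 0 < e / 2 by rewrite divr_gt0.
have /cvg_normRP/(_ _ (divr_gt0 e2 M0))/near0_rightP[d d0 hd] := xy.
have [d' d'0 hd'] := semigroup_continuous y (ltW t0) e2.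
exists (Num.min t (Num.min d d')); first by rewrite !lt_min t0 d0.
move=> h h0; rewrite !lt_min => /and3P[ht hdd hd'd].
have B s k : 0 <= s -> 0 < k < d ->
    normR (G s y - G s ((k^-1)%:C *: (G k x - x))) < e / 2.
  move=> s0 /andP[k0 kd]; rewrite -semigroupB//.
  by apply: le_lt_trans (hM _ _ s0) _; rewrite -ltr_pdivlMl// mulrC hd.
have [hneg|hpos|/eqP] := ltgtP h 0; last by rewrite (negPf h0).
- rewrite ltr0_norm// in ht hdd hd'd.
  have th : 0 <= t + h by lra.
  have -> : (h^-1)%:C *: (G (t + h) x - G t x) =
      G (t + h) (((- h)^-1)%:C *: (G (- h) x - x)).
    rewrite semigroupZ// semigroupB// -semigroup_comp// ?oppr_ge0 ?ltW//.
    by rewrite addrK invrN rmorphN scaleNr -scalerN opprB.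
  rewrite [ltRHS]splitr; apply: le_lt_trans (normRB_add (G (t + h) y) _ _) _.
  apply: ltrD; last by apply: B => //; rewrite oppr_gt0 hneg.
  by rewrite normRBC hd'//; rewrite addrC addKr ltr0_norm.
- rewrite gtr0_norm// in ht hdd hd'd.
  have -> : (h^-1)%:C *: (G (t + h) x - G t x) = G t ((h^-1)%:C *: (G h x - x)).
    by rewrite semigroupZ ?ltW// semigroupB ?ltW// -semigroup_comp// ltW.
  apply: lt_trans (B _ _ (ltW t0) _) _; first by rewrite hpos.
  by rewrite ltr_pdivrMr// ltr_pMr// ltr1n.
Qed.

(** The orbit of x is an antiderivative of the orbit of y = B x, where B is the
    generator; only the right derivative at 0 enters, not B itself. This lemma
    and the next are used for rescaled semigroups, whose generators are B minus
    a scalar. *)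
Lemma semigroup_integral t : 0 <= t ->
  has_bochner `[0, t] (fun s => G s y) (G t x - x).
Proof.
move=> t0; rewrite -{2}(semigroup_id x).
apply: (bochner_FTC dotH t0 _ _ (F := fun s => G s x)).
- exact: semigroup_within_continuous.
- exact: semigroup_within_continuous.
- by move=> s /andP[s0 _]; exact: semigroup_derivative.
Qed.

(** Running the orbit backwards, - S(t - s) x is an antiderivative of
    S(t - s) y in s. *)
Lemma semigroup_convolution_integral t : 0 <= t ->
  has_bochner `[0, t] (fun s => G (t - s) y) (G t x - x).
Proof.
move=> t0; have -> : G t x - x = - G (t - t) x - - G (t - 0) x.
  by rewrite subrr semigroup_id subr0 opprK addrC.
apply: (bochner_FTC dotH t0 _ _ (F := fun s => - G (t - s) x)).
- exact: semigroup_reversed_continuous.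
- by move=> s; apply: cvgN; exact: semigroup_reversed_continuous.
- move=> s /andP[s0 st]; apply/cvg_normRP => e e0; apply/near0_dnbhsP.
  have ts : 0 < t - s by rewrite subr_gt0.
  have /cvg_normRP/(_ _ e0)/near0_dnbhsP[d d0 hd] := semigroup_derivative ts.
  exists d => // h h0 hlt; have := hd (- h); rewrite oppr_eq0 normrN.
  move=> /(_ h0 hlt); congr (normR (_ - _) < e).
  by rewrite invrN rmorphN scaleNr -scalerN !opprD !opprK addrA.
Qed.

End Derivative.

End SemigroupTheory.

(** * Fourier modes *)

Lemma is_derive_cvg (R : realType) (f : R -> R) (a df : R) : is_derive a 1 f df ->
  h^-1 * (f (a + h) - f a) @[h --> (0 : R)^'] --> df.
Proof.
case=> dfa <-; move: dfa; rewrite /derivable /derive => dfa.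
apply: cvg_trans dfa; apply: near_eq_cvg; apply: nearW => h /=.
by rewrite [h *: 1]mulr1 [h + a]addrC.
Qed.

Lemma ler_normC_ReIm (R : realType) (a b : R) :
  complex.Re `|(a +i* b)%C| <= `|a| + `|b|.
Proof.
rewrite normc_def /= -[leRHS]ger0_norm ?addr_ge0// -sqrtr_sqr ler_wsqrtr//.
rewrite sqrrD -[_ ^+ 2 in leRHS]/(`|a| ^+ 2) !real_normK ?num_real// lerD2r lerDl.
by rewrite mulrn_wge0// mulr_ge0.
Qed.

Section FourierModes.
Context (R : realType) (T : R).
Local Notation mode := (fourier_mode T).

Lemma mode0 n : mode n 0 = 1.
Proof. by rewrite /fourier_mode mulr0 cos0 sin0. Qed.

Lemma modeD n s t : mode n (s + t) = mode n s * mode n t.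
Proof.
by rewrite /fourier_mode mulrDr cosD sinD; apply/eqP; rewrite eq_complex /=
  [in X in _ && X]addrC !eqxx.
Qed.

Lemma omegaD m n : omega T (m + n) = omega T m + omega T n.
Proof. by rewrite /omega intrD mulrDr mulrDl. Qed.

Lemma omegaN n : omega T (- n) = - omega T n.
Proof. by rewrite /omega mulrNz mulrN mulNr. Qed.

Lemma mode_addn m n t : mode (m + n) t = mode m t * mode n t.
Proof.
by rewrite /fourier_mode omegaD mulrDl cosD sinD; apply/eqP; rewrite eq_complex /=
  [in X in _ && X]addrC !eqxx.
Qed.

Lemma mode0n t : mode 0 t = 1.
Proof. by rewrite /fourier_mode /omega mulr0 !mul0r cos0 sin0. Qed.

Lemma modeNM n t : mode (- n) t * mode n t = 1.
Proof. by rewrite -mode_addn addNr mode0n. Qed.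

Lemma mode_conj n t : Num.conj (mode n t) = mode (- n) t.
Proof. by rewrite /fourier_mode omegaN mulNr cosN sinN. Qed.

Lemma normC_mode n t : complex.Re `|mode n t| = 1.
Proof. by rewrite normc_def /= cos2Dsin2 sqrtr1. Qed.

Lemma normR_mode (H : normedModType R[i]) n t (x : H) :
  normR (mode n t *: x) = normR x.
Proof. by rewrite normRZ normC_mode mul1r. Qed.

Lemma mode_continuous0 n e : 0 < e ->
  exists2 d : R, 0 < d & forall h : R, `|h| < d -> complex.Re `|mode n h - 1| < e.
Proof.
move=> e0; have e2 : 0 < e / 2 by rewrite divr_gt0.
have lin : omega T n * h @[h --> (0 : R)] --> 0.
  by rewrite -[X in _ --> X](mulr0 (omega T n)); apply: cvgM; [exact: cvg_cst|exact: cvg_id].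
have /cvgrPdist_lt/(_ _ e2)/nbhs_ballP[d d0 hd] : cos (omega T n * h) @[h --> (0 : R)] --> (1 : R).
  by rewrite -cos0; exact: (cvg_comp _ _ lin (@continuous_cos R 0)).
have /cvgrPdist_lt/(_ _ e2)/nbhs_ballP[d' d'0 hd'] : sin (omega T n * h) @[h --> (0 : R)] --> (0 : R).
  by rewrite -[X in _ --> X]sin0; exact: (cvg_comp _ _ lin (@continuous_sin R 0)).
exists (Num.min d d'); first by rewrite lt_min; apply/andP.
move=> h; rewrite lt_min => /andP[hd1 hd2].
have -> : mode n h - 1 = ((cos (omega T n * h) - 1) +i* sin (omega T n * h))%C.
  by rewrite /fourier_mode; apply/eqP; rewrite eq_complex /= subr0 !eqxx.
apply: le_lt_trans (ler_normC_ReIm _ _) _; rewrite [ltRHS]splitr; apply: ltrD.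
  by rewrite distrC; apply: hd; rewrite /ball /= sub0r normrN.
by have := hd' h; rewrite sub0r normrN; apply; rewrite /ball /= sub0r normrN.
Qed.

(** The derivative of exp (i omega_n t) at 0, from those of cosine and sine. *)
Lemma mode_derivative0 n e : 0 < e ->
  exists2 d : R, 0 < d & forall h : R, h != 0 -> `|h| < d ->
    complex.Re `|(h^-1)%:C * (mode n h - 1) - i_omega T n| < e.
Proof.
move=> e0; have e2 : 0 < e / 2 by rewrite divr_gt0.
have Dlin : is_derive (0 : R) 1 (fun h => omega T n * h) (omega T n).
  by apply: is_derive_eq; exact: mulr1.
have /is_derive_cvg/cvgrPdist_lt/(_ _ e2)/near0_dnbhsP[d d0 hd] :
    is_derive (0 : R) 1 (cos \o (fun h => omega T n * h)) 0.
  apply: is_derive_eq.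
  by rewrite mulr0 sin0 oppr0 mul0r.
have /is_derive_cvg/cvgrPdist_lt/(_ _ e2)/near0_dnbhsP[d' d'0 hd'] :
    is_derive (0 : R) 1 (sin \o (fun h => omega T n * h)) (omega T n).
  apply: is_derive_eq.
  by rewrite mulr0 cos0 mul1r.
exists (Num.min d d'); first by rewrite lt_min d0.
move=> h h0; rewrite lt_min => /andP[/(hd _ h0) h1 /(hd' _ h0) h2].
rewrite /= !add0r !mulr0 cos0 normrN in h1; rewrite /= !add0r !mulr0 sin0 subr0 in h2.
have -> : (h^-1)%:C * (mode n h - 1) - i_omega T n =
    (h^-1 * (cos (omega T n * h) - 1) +i* (h^-1 * sin (omega T n * h) - omega T n))%C.
  rewrite /fourier_mode /i_omega; apply/eqP; rewrite eq_complex /=.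
  by rewrite !mul0r !subr0 addr0 !eqxx.
apply: le_lt_trans (ler_normC_ReIm _ _) _; rewrite [ltRHS]splitr; apply: ltrD => //.
by rewrite distrC.
Qed.

Hypothesis T0 : 0 < T.

Lemma mode_period n : mode n T = 1.
Proof.
have P (m : nat) : mode (Posz m) T = 1.
  rewrite /fourier_mode /omega divfK ?gt_eqF//.
  have -> : 2 * pi * (Posz m)%:~R = 0 + (pi *+ 2) *+ m :> R.
    by rewrite add0r -pmulrn mulr_natr mulr_natl.
  by rewrite (periodicn (@cosD2pi R)) (periodicn (@sinD2pi R)) cos0 sin0.
case: n => m; first exact: P.
by rewrite NegzE -mode_conj P rmorph1.
Qed.

Lemma mode_periodic n t : mode n (t + T) = mode n t.
Proof. by rewrite modeD mode_period mulr1. Qed.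

Lemma i_omega_neq0 n : n != 0 -> i_omega T n != 0.
Proof.
move=> n0; rewrite /i_omega eq_complex /= negb_and; apply/orP; right.
by rewrite /omega !mulf_eq0 invr_eq0 intr_eq0 pnatr_eq0 (gt_eqF T0) (gt_eqF (pi_gt0 R)) (negPf n0).
Qed.

End FourierModes.

Section ModeGroup.
Context (R : realType) (H : completeNormedModType R[i]) (T : R).
Local Notation mode := (fourier_mode T).
Implicit Types (x : H).

Lemma mode_cvg0 n x : mode n h *: x @[h --> (0 : R)] --> x.
Proof.
apply/cvg_normRP => e e0.
have x1 : 0 < normR x + 1 by rewrite ltr_wpDl// normR_ge0.
have [d d0 hd] := mode_continuous0 T n (divr_gt0 e0 x1).
apply/nbhs_ballP; exists d => // h; rewrite /ball /= sub0r normrN => /hd.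
have -> : x - mode n h *: x = - ((mode n h - 1) *: x).
  by rewrite scalerBl scale1r opprB.
rewrite normRN normRZ ltr_pdivlMr// => /(le_lt_trans _); apply.
apply: ler_wpM2l; last by rewrite lerDl.
have : 0 <= `|mode n h - 1| by [].
by rewrite lecE => /andP[].
Qed.

Lemma mode_generator n x :
  (h^-1)%:C *: (mode n h *: x - x) @[h --> (0 : R)^'] --> i_omega T n *: x.
Proof.
apply/cvg_normRP => e e0; apply/near0_dnbhsP.
have x1 : 0 < normR x + 1 by rewrite ltr_wpDl// normR_ge0.
have [d d0 hd] := mode_derivative0 T n (divr_gt0 e0 x1).
exists d => // h h0 /(hd _ h0).
have -> : (h^-1)%:C *: (mode n h *: x - x) = ((h^-1)%:C * (mode n h - 1)) *: x.
  by rewrite -scalerA scalerBl scale1r.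
rewrite normRBC -scalerBl normRZ ltr_pdivlMr// => /(le_lt_trans _); apply.
apply: ler_wpM2l; last by rewrite lerDl.
set z := _ - _; have : 0 <= `|z| by [].
by rewrite lecE => /andP[].
Qed.

(** The modes themselves form a bounded semigroup, so that their integral over
    a period comes from semigroup_integral. *)
Lemma mode_C0_semigroup n : C0_semigroup (fun t x => mode n t *: x : H).
Proof.
split.
- move=> t _; split; last by move=> x; exact: scaler_continuous.
  by move=> a x y; rewrite scalerDr !scalerA mulrC.
- by move=> x; rewrite mode0 scale1r.
- by move=> s t x _ _; rewrite modeD scalerA.
- by move=> x; apply: cvg_at_right_filter; exact: mode_cvg0.
Qed.

Lemma mode_uniformly_bounded n : uniformly_bounded (fun t x => mode n t *: x : H).
Proof. by exists 1 => t x _; rewrite normR_mode mul1r. Qed.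

(** Multiplication by the n-th mode shifts the generator by i omega_n. *)
Lemma mode_rescaled_C0_semigroup n (S : R -> H -> H) : C0_semigroup S ->
  uniformly_bounded S -> C0_semigroup (fun t x => mode n t *: S t x).
Proof.
move=> sgS bdS; have [lS idS compS cS] := sgS; split.
- move=> t t0; have [linS contS] := lS t t0; split.
    by move=> a x y; rewrite linS scalerDr !scalerA mulrC.
  by move=> x; apply: cvgZl_tmp; exact: contS.
- by move=> x; rewrite mode0 scale1r idS.
- move=> s t x s0 t0; rewrite modeD compS// (semigroupZ sgS)//.
  by rewrite !scalerA.
- move=> x; apply/cvg_normRP => e e0; apply/near0_rightP.
  have e2 : 0 < e / 2 by rewrite divr_gt0.
  have /cvg_normRP/(_ _ e2)/near0_rightP[d d0 hd] := cS x.
  have /cvg_normRP/(_ _ e2)/near0_rightP[d' d'0 hd'] :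
    mode n h *: x @[h --> (0 : R)^'+] --> x.
    by apply: cvg_at_right_filter; exact: mode_cvg0.
  exists (Num.min d d'); first by rewrite lt_min d0.
  move=> h h0; rewrite lt_min => /andP[/(hd _ h0) h1 /(hd' _ h0) h2].
  apply: le_lt_trans (normRB_add (mode n h *: x) _ _) _.
  by rewrite [ltRHS]splitr ltrD// -scalerBr normR_mode.
Qed.

Lemma mode_rescaled_bounded n (S : R -> H -> H) :
  uniformly_bounded S -> uniformly_bounded (fun t x => mode n t *: S t x).
Proof. by move=> [M hM]; exists M => t x t0; rewrite normR_mode hM. Qed.

End ModeGroup.

(** * Generator and resolvent *)

Section GeneratorTheory.
Context (R : realType) (H : completeNormedModType R[i]).
Context (dot : {dot H for (@Num.conj R[i])}) (dotH : hilbert_norm dot).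
Context (S : R -> H -> H) (A : operator H).
Hypotheses (semigroupS : C0_semigroup S) (generatesA : generates A S).
Hypothesis boundedS : uniformly_bounded S.
Implicit Types (x y : H).

Local Notation diff_quotient x := (fun h : R => (h^-1)%:C *: (S h x - x)).

Lemma generator_cvg x : dom A x -> diff_quotient x h @[h --> (0 : R)^'+] --> A x.
Proof. by case: generatesA => _; exact. Qed.

Lemma generatorP x y : diff_quotient x h @[h --> (0 : R)^'+] --> y ->
  dom A x /\ A x = y.
Proof.
move=> xy; have dx : dom A x by apply/(generatesA.1 x); exists y.
split=> //; have := generator_cvg dx => xA.
exact: (cvg_unique (@norm_hausdorff _ _) xA xy).
Qed.

Lemma generator_linear c x y : dom A x -> dom A y ->
  dom A (c *: x + y) /\ A (c *: x + y) = c *: A x + A y.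
Proof.
move=> /generator_cvg xA /generator_cvg yA; apply: generatorP.
have : c *: diff_quotient x h + diff_quotient y h @[h --> (0 : R)^'+]
    --> c *: A x + A y by apply: cvgD => //; exact: cvgZl_tmp.
apply: cvg_trans; apply: near_eq_cvg.
apply/near0_rightP; exists 1 => // h h0 _ /=.
rewrite (semigroupD semigroupS) ?(semigroupZ semigroupS) ?ltW//.
have -> : c *: S h x + S h y - (c *: x + y) = c *: (S h x - x) + (S h y - y).
  by rewrite opprD addrACA scalerBr.
by rewrite [(h^-1)%:C *: (c *: _ + _)]scalerDr !scalerA mulrC.
Qed.

Lemma generator0 : dom A 0 /\ A 0 = 0.
Proof.
apply: generatorP; apply/cvg_normRP => e e0.
apply/near0_rightP; exists 1 => // h h0 _ /=.
by rewrite (semigroup0x semigroupS) ?ltW// subrr scaler0 subrr normR0.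
Qed.

Lemma generatorB x y : dom A x -> dom A y ->
  dom A (x - y) /\ A (x - y) = A x - A y.
Proof.
move=> dx dy; have := generator_linear (-1) dy dx.
by rewrite !scaleN1r [- y + x]addrC [- A y + A x]addrC.
Qed.

Lemma generator_sum (I : eqType) (r : seq I) (c : I -> R[i]) (x : I -> H) :
  (forall i, i \in r -> dom A (x i)) ->
  dom A (\sum_(i <- r) c i *: x i) /\
  A (\sum_(i <- r) c i *: x i) = \sum_(i <- r) c i *: A (x i).
Proof.
elim: r => [|i r IH] h; first by rewrite !big_nil; exact: generator0.
have [|dr Ar] := IH; first by move=> j jr; apply: h; rewrite inE jr orbT.
rewrite !big_cons -Ar; apply: generator_linear => //.
by apply: h; rewrite mem_head.
Qed.

Lemma semigroup_generator (t : R) x : 0 <= t -> dom A x ->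
  dom A (S t x) /\ A (S t x) = S t (A x).
Proof.
move=> t0 /generator_cvg xA; apply: generatorP.
have [M M0 hM] := semigroup_bound boundedS.
apply/cvg_normRP => e e0; apply/near0_rightP.
have /cvg_normRP/(_ _ (divr_gt0 e0 M0))/near0_rightP[d d0 hd] := xA.
exists d => // h h0 /(hd _ h0) hlt.
have -> : S h (S t x) = S t (S h x).
  by rewrite -!(semigroup_comp semigroupS) ?(ltW h0)// addrC.
rewrite -(semigroupB semigroupS)//.
rewrite -(semigroupZ semigroupS)// -(semigroupB semigroupS)//.
by apply: le_lt_trans (hM _ _ t0) _; rewrite -ltr_pdivlMl// mulrC.
Qed.

Section Resolvent.
Variable l : R[i].
Hypothesis rhol : resolvent_set A l.

Lemma resolvent_eqP y : resolvent_eq A l y (resolvent A l y).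
Proof. by have [x [xy _]] := rhol.1 y; apply: xgetI xy. Qed.

Lemma resolvent_unique x y : resolvent_eq A l y x -> resolvent A l y = x.
Proof.
move=> xy; have [z [_ zu]] := rhol.1 y.
by rewrite -(zu _ xy) -(zu _ (resolvent_eqP y)).
Qed.

Lemma resolventB x y :
  resolvent A l (x - y) = resolvent A l x - resolvent A l y.
Proof.
apply: resolvent_unique.
have [dx xE] := resolvent_eqP x; have [dy yE] := resolvent_eqP y.
have [dxy AE] := generatorB dx dy; split=> //.
by rewrite AE scalerBr -[in RHS]xE -[in RHS]yE !opprD addrACA.
Qed.

(** The resolvent commutes with the semigroup because the generator does: S(t)
    maps a solution of the resolvent equation for x to one for S(t) x. *)
Lemma resolvent_semigroup (t : R) x : 0 <= t ->
  resolvent A l (S t x) = S t (resolvent A l x).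
Proof.
move=> t0; apply: resolvent_unique; have [dx xE] := resolvent_eqP x.
have [dS AS] := semigroup_generator t0 dx; split=> //.
by rewrite AS -(semigroupZ semigroupS)// -(semigroupB semigroupS)// xE.
Qed.

Lemma resolvent_bound : exists2 M : R, 0 < M &
  forall y, normR (resolvent A l y) <= M * normR y.
Proof.
have [_ [M hM]] := rhol; exists (`|M| + 1); first by rewrite ltr_wpDl.
move=> y; apply: le_trans (hM y) _; apply: ler_wpM2r; first exact: normR_ge0.
by rewrite (le_trans (ler_norm _))// lerDl.
Qed.

End Resolvent.

Section Modes.
Variable T : R.
Local Notation mode := (fourier_mode T).

(** The product rule at t = 0 for the orbit multiplied by a mode. *)
Lemma rescaled_generator n x : dom A x ->
  (h^-1)%:C *: (mode (- n) h *: S h x - x) @[h --> (0 : R)^'+]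
    --> A x - i_omega T n *: x.
Proof.
move=> /generator_cvg xA.
have -> : - (i_omega T n *: x) = i_omega T (- n) *: x.
  rewrite -scaleNr /i_omega omegaN; congr (_ *: _).
  by apply/eqP; rewrite eq_complex /= oppr0 !eqxx.
have mx : (h^-1)%:C *: (mode (- n) h *: x - x) @[h --> (0 : R)^'+] -->
    i_omega T (- n) *: x by apply: cvg_dnbhs_at_right; exact: mode_generator.
have mA : mode (- n) h *: diff_quotient x h @[h --> (0 : R)^'+] --> A x.
  apply/cvg_normRP => e e0; apply/near0_rightP.
  have e2 : 0 < e / 2 by rewrite divr_gt0.
  have /cvg_normRP/(_ _ e2)/near0_rightP[d d0 hd] := xA.
  have /cvg_normRP/(_ _ e2)/near0_rightP[d' d'0 hd'] :
    mode (- n) h *: A x @[h --> (0 : R)^'+] --> A x.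
    by apply: cvg_at_right_filter; exact: mode_cvg0.
  exists (Num.min d d'); first by rewrite lt_min d0.
  move=> h h0; rewrite lt_min => /andP[/(hd _ h0) h1 /(hd' _ h0) h2].
  apply: le_lt_trans (normRB_add (mode (- n) h *: A x) _ _) _.
  by rewrite [ltRHS]splitr ltrD// -scalerBr normR_mode.
have : mode (- n) h *: diff_quotient x h + (h^-1)%:C *: (mode (- n) h *: x - x)
    @[h --> (0 : R)^'+] --> A x + i_omega T (- n) *: x by exact: cvgD.
apply: cvg_trans; apply: near_eq_cvg; apply: nearW => h /=.
by rewrite scalerA mulrC -scalerA -scalerDr scalerBr addrA subrK.
Qed.

(** The periodic response to a single mode. Factoring exp (i omega_n t) out of
    the convolution leaves the convolution of the rescaled semigroup
    exp (- i omega_n t) S(t), whose generator is A - i omega_n, with a constant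
    in the range of that generator. *)
Lemma mode_mild_integral n x (t : R) : dom A x -> 0 <= t ->
  has_bochner `[0, t] (fun s => S (t - s) (mode n s *: (i_omega T n *: x - A x)))
    (mode n t *: x - S t x).
Proof.
move=> dx t0.
have := semigroup_convolution_integral dotH
  (mode_rescaled_C0_semigroup T (- n) semigroupS boundedS)
  (mode_rescaled_bounded T (- n) boundedS) (@rescaled_generator n _ dx) t0.
move=> /(has_bochnerZ dotH (measurable_itv _) (lebesgue_segment_lty _ _) (- mode n t)).
have -> : - mode n t *: (mode (- n) t *: S t x - x) = mode n t *: x - S t x.
  rewrite scalerBr !scaleNr scalerA [mode n t * _]mulrC modeNM scale1r opprK.
  exact: addrC.
move=> h; apply: has_bochner_ae h; apply: aeW => s /=; rewrite in_itv /= => /andP[s0 st].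
rewrite (semigroupZ semigroupS) ?subr_ge0// scalerA.
have -> : - mode n t * mode (- n) (t - s) = - mode n s.
  have -> : mode n t = mode n s * mode n (t - s) by rewrite -modeD subrKC.
  by rewrite mulNr -mulrA [mode n (t - s) * _]mulrC modeNM mulr1.
rewrite scaleNr -scalerN; congr (_ *: _).
by rewrite -(scaleN1r (S _ _)) -(semigroupZ semigroupS) ?subr_ge0// scaleN1r opprB.
Qed.

Hypothesis T0 : 0 < T.
Hypothesis rhoA : forall n : int, resolvent_set A (i_omega T n).
Local Notation res n := (resolvent A (i_omega T n)).

(** The n-th Fourier coefficient of an orbit, up to the factor T. With
    x = R(i omega_n) d, the integrand is minus the derivative of
    exp (- i omega_n t) S(t) x, and the mode equals 1 at T. *)
Lemma resolvent_orbit_integral n d :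
  has_bochner `[0, T] (fun t => mode (- n) t *: S t d) (res n (d - S T d)).
Proof.
have [dx xE] := resolvent_eqP (rhoA n) d.
have := semigroup_integral dotH
  (mode_rescaled_C0_semigroup T (- n) semigroupS boundedS)
  (mode_rescaled_bounded T (- n) boundedS) (@rescaled_generator n _ dx) (ltW T0).
move=> /(has_bochnerZ dotH (measurable_itv _) (lebesgue_segment_lty _ _) (- 1)).
rewrite mode_period// scale1r scaleN1r opprB resolventB//.
rewrite resolvent_semigroup ?(ltW T0)//.
move=> h; apply: has_bochner_ae h; apply: aeW => s /=; rewrite in_itv /= => /andP[s0 _].
rewrite scalerA mulN1r scaleNr -scalerN; congr (_ *: _).
by rewrite -(scaleN1r (S s _)) -(semigroupZ semigroupS)// scaleN1r opprB xE.
Qed.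

End Modes.

End GeneratorTheory.

(** * Trigonometric polynomials *)

Section TrigonometricPolynomials.
Context (R : realType) (H : completeNormedModType R[i]).
Variable T : R.
Local Notation mode := (fourier_mode T).
Local Notation trig := (trig_poly T [set: H]).
Implicit Types (F P : R -> H) (x : H).

(** Lists of pairs with repeated frequencies are easier to add and multiply than
    duplicate-free lists; equal frequencies are merged in the converse. *)
Lemma trig_polyP F : trig F <->
  exists L : seq (int * H), forall t, F t = \sum_(p <- L) mode p.1 t *: p.2.
Proof.
split=> [[s [c [us _ Fs]]]|[L FL]].
  by exists [seq (n, c n) | n <- s] => t; rewrite Fs big_map.
exists (undup (map fst L)), (fun n => \sum_(p <- L | p.1 == n) p.2); split => //.
  exact: undup_uniq.
move=> t; rewrite FL.
under [RHS]eq_bigr do rewrite scaler_sumr big_mkcond.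
rewrite [RHS]exchange_big /= big_seq [RHS]big_seq; apply: eq_bigr => p pL.
have pu : p.1 \in undup (map fst L) by rewrite mem_undup map_f.
rewrite (bigD1_seq p.1 pu (undup_uniq _)) /= eqxx big1 ?addr0// => n.
by rewrite eq_sym => /negPf ->.
Qed.

Lemma trig_poly_mode n x : trig (fun t => mode n t *: x).
Proof. by apply/trig_polyP; exists [:: (n, x)] => t; rewrite big_seq1. Qed.

Lemma trig_polyD F P : trig F -> trig P -> trig (fun t => F t + P t).
Proof.
move=> /trig_polyP[L FL] /trig_polyP[L' PL]; apply/trig_polyP.
by exists (L ++ L') => t; rewrite big_cat /= FL PL.
Qed.

Lemma trig_polyZ c F : trig F -> trig (fun t => c *: F t).
Proof.
move=> /trig_polyP[L FL]; apply/trig_polyP.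
exists [seq (p.1, c *: p.2) | p <- L] => t; rewrite FL big_map scaler_sumr.
by apply: eq_bigr => p _; rewrite !scalerA mulrC.
Qed.

Lemma trig_polyM n F : trig F -> trig (fun t => mode n t *: F t).
Proof.
move=> /trig_polyP[L FL]; apply/trig_polyP.
exists [seq (n + p.1, p.2) | p <- L] => t; rewrite FL big_map scaler_sumr.
by apply: eq_bigr => p _; rewrite mode_addn scalerA.
Qed.

Lemma trig_polyB F P : trig F -> trig P -> trig (fun t => F t - P t).
Proof.
move=> tF /(trig_polyZ (-1)) tP; have := trig_polyD tF tP.
by congr trig_poly; apply/funext => t; rewrite scaleN1r.
Qed.

Lemma trig_poly0 : trig (fun=> 0).
Proof. by apply/trig_polyP; exists [::] => t; rewrite big_nil. Qed.

Lemma trig_poly_sum (I : Type) (r : seq I) (F : I -> R -> H) :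
  (forall i, trig (F i)) -> trig (fun t => \sum_(i <- r) F i t).
Proof.
move=> tF; elim: r => [|i r IH].
  rewrite (_ : (fun _ => _) = fun=> 0); first exact: trig_poly0.
  by apply/funext => t; rewrite big_nil.
rewrite (_ : (fun _ => _) = fun t => F i t + \sum_(i <- r) F i t).
  exact: trig_polyD.
by apply/funext => t; rewrite big_cons.
Qed.

Lemma mode_continuous n x : continuous (fun t => mode n t *: x : H).
Proof.
move=> t; apply/cvg_normRP => e e0.
have /cvg_normRP/(_ _ e0)/nbhs_ballP[d /= d0 hd] := @mode_cvg0 R H T n x.
apply/nbhs_ballP; exists d => // s; rewrite /ball /= => ts.
have -> : mode n t *: x - mode n s *: x =
    mode n t *: (x - mode n (s - t) *: x).
  by rewrite scalerBr scalerA -modeD subrKC.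
by rewrite normR_mode; apply: hd; rewrite /ball /= sub0r opprB.
Qed.

Lemma trig_poly_continuous E F : trig_poly T E F -> continuous F.
Proof.
move=> [s [c [_ _ Fs]]]; rewrite (_ : F = fun t => \sum_(n <- s) mode n t *: c n).
  move=> t; elim: s {Fs} => [|n s IH].
    by rewrite (_ : (fun _ => _) = cst 0); [exact: cvg_cst|apply/funext => r; rewrite big_nil].
  rewrite (_ : (fun _ => _) = fun r => mode n r *: c n + \sum_(m <- s) mode m r *: c m).
    by apply: cvgD => //; exact: mode_continuous.
  by apply/funext => r; rewrite big_cons.
exact/funext.
Qed.

Lemma trig_poly_within A F : trig F -> {within A, continuous F}.
Proof. by move=> /trig_poly_continuous cF; exact: continuous_subspaceT. Qed.

Lemma trig_poly_bounded F : trig F -> exists2 M, 0 <= M & forall t, normR (F t) <= M.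
Proof.
move=> /trig_polyP[L FL]; exists (\sum_(p <- L) normR p.2).
  by apply: sumr_ge0 => p _; exact: normR_ge0.
move=> t; rewrite FL; apply: le_trans (normR_sum _ _ _) _.
by apply: ler_sum => p _; rewrite normR_mode.
Qed.

Hypothesis T0 : 0 < T.

Lemma trig_poly_periodic F : trig F -> periodic F T.
Proof.
move=> /trig_polyP[L FL] t; rewrite !FL; apply: eq_bigr => p _.
by rewrite mode_periodic.
Qed.

Context (dot : {dot H for (@Num.conj R[i])}) (dotH : hilbert_norm dot).
Local Notation mu := (@lebesgue_measure R).
Local Notation rdot := (rdot dot).

(** For k nonzero the integral vanishes by periodicity: it is the increment of
    the mode over a period, divided by i omega_k. *)
Lemma mode_integral k x : has_bochner `[0, T] (fun t => mode k t *: x)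
  (if k == 0 then T%:C *: x else 0).
Proof.
have [->|k0] := eqVneq k 0.
  have -> : T%:C *: x = T%:C *: x - 0%:C *: x by rewrite scale0r subr0.
  apply: (bochner_FTC dotH (ltW T0) _ _ (F := fun t => t%:C *: x)).
  - by apply: trig_poly_within; exact: trig_poly_mode.
  - apply: continuous_subspaceT => t; apply/cvg_normRP => e e0.
    have x1 : 0 < normR x + 1 by rewrite ltr_wpDl// normR_ge0.
    apply/nbhs_ballP; exists (e / (normR x + 1)); first by rewrite /= divr_gt0.
    move=> s; rewrite /ball /= ltr_pdivlMr// => /(le_lt_trans _); apply.
    by rewrite -scalerBl -rmorphB normRZr ler_wpM2l// lerDl.
  - move=> t _; apply/cvg_normRP => e e0; apply/near0_dnbhsP; exists 1 => // h h0 _.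
    rewrite -scalerBl -rmorphB [t + h]addrC addrK scalerA -rmorphM mulVf// rmorph1 scale1r.
    by rewrite mode0n scale1r subrr normR0.
have gx : (h^-1)%:C *: (mode k h *: x - x) @[h --> (0 : R)^'+] --> i_omega T k *: x.
  by apply: cvg_dnbhs_at_right; exact: mode_generator.
have := semigroup_integral dotH (@mode_C0_semigroup R H T k)
  (@mode_uniformly_bounded R H T k) gx (ltW T0).
move=> /(has_bochnerZ dotH (measurable_itv _) (lebesgue_segment_lty _ _) (i_omega T k)^-1).
rewrite mode_period// scale1r subrr scaler0 => h.
apply: has_bochner_ae h; apply: aeW => t _ /=.
by rewrite !scalerA mulrCA mulVf ?mulr1// i_omega_neq0.
Qed.

Lemma trig_poly_coef (s : seq int) (c : int -> H) n : uniq s ->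
  has_bochner `[0, T] (fun t => mode (- n) t *: \sum_(m <- s) mode m t *: c m)
    (T%:C *: (if n \in s then c n else 0)).
Proof.
move=> us.
have h : has_bochner `[0, T] (fun t => \sum_(m <- s) mode (m - n) t *: c m)
    (\sum_(m <- s) (if m - n == 0 then T%:C *: c m else 0)).
  apply: (has_bochner_sum dotH (measurable_itv _) (lebesgue_segment_lty _ _)).
  by move=> m _; exact: mode_integral.
have -> : T%:C *: (if n \in s then c n else 0) =
    \sum_(m <- s) (if m - n == 0 then T%:C *: c m else 0).
  have [ns|ns] := ifPn.
    rewrite (bigD1_seq n ns us) /= subrr eqxx big1 ?addr0// => m mn.
    by rewrite subr_eq0 (negPf mn).
  rewrite scaler0 big_seq big1// => m ms.
  by rewrite subr_eq0; case: eqP => // mn; rewrite -mn ms in ns.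
apply: has_bochner_ae h; apply: aeW => t _; rewrite scaler_sumr.
by apply: eq_bigr => m _; rewrite mode_addn scalerA mulrC.
Qed.

(** The square of the norm is the sum over n of the real inner product of
    exp (- i omega_n t) P(t) with c n, whose integral is known from the
    coefficients of P; products of two modes never have to be expanded. *)
Lemma trig_poly_parseval (s : seq int) (c : int -> H) : uniq s ->
  (\int[mu]_(t in `[0%R, T]) (normR (\sum_(n <- s) mode n t *: c n) ^+ 2)%:E =
   (T * \sum_(n <- s) normR (c n) ^+ 2)%:E)%E.
Proof.
move=> us; set P := fun t => \sum_(n <- s) mode n t *: c n.
have tP : trig P by exists s, c.
have key n : mu.-integrable `[0, T] (fun t => (rdot (mode (- n) t *: P t) (c n))%:E) /\
    (\int[mu]_(t in `[0%R, T]) rdot (mode (- n) t *: P t) (c n))%R =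
    rdot (T%:C *: (if n \in s then c n else 0)) (c n).
  apply: (rdot_bochner_continuous dotH); last exact: trig_poly_coef.
  by apply: trig_poly_within; exact: trig_polyM.
transitivity (\int[mu]_(t in `[0%R, T])
    (\sum_(n <- s) (rdot (mode (- n) t *: P t) (c n))%:E))%E.
  apply: eq_integral => t _; rewrite sumEFin -(rdotxx dotH) rdot_sumr.
  by congr EFin; apply: eq_bigr => n _; rewrite rdotZl -mode_conj conjCK.
rewrite integral_sum//; last by move=> n; case: (key n).
rewrite mulr_sumr -sumEFin big_seq [RHS]big_seq; apply: eq_bigr => n ns.
have [int E] := key n; rewrite ns rdotZrl (rdotxx dotH) in E.
by rewrite -E fineK//; exact: integrable_fin_num.
Qed.

End TrigonometricPolynomials.

(** * Polynomials that approximate a step, and dominated convergence *)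

Lemma bernoulli_sub (R : realType) (z : R) m : 0 <= z <= 1 ->
  1 - m%:R * z <= (1 - z) ^+ m.
Proof.
move=> /andP[z0 z1]; elim: m => [|m IH]; first by rewrite expr0 mul0r subr0.
have h : (1 - m%:R * z) * (1 - z) <= (1 - z) ^+ m.+1.
  by rewrite exprSr ler_wpM2r// subr_ge0.
apply: le_trans h; rewrite -natr1; have : 0 <= (m%:R : R) by [].
by move=> m0; have : 0 <= m%:R * z * z; [rewrite !mulr_ge0|nra].
Qed.

Lemma bernoulli_inv (R : realType) (z : R) m : 0 <= z <= 1 ->
  (1 - z) ^+ m * (1 + m%:R * z) <= 1.
Proof.
move=> /andP[z0 z1]; elim: m => [|m IH]; first by rewrite expr0 mul0r addr0 mul1r.
apply: le_trans IH; rewrite exprSr -mulrA; apply: ler_wpM2l.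
  by rewrite exprn_ge0// subr_ge0.
rewrite -natr1; have m0 : 0 <= (m%:R : R) by [].
have : 0 <= m%:R * z * z by rewrite !mulr_ge0.
nra.
Qed.

(** The classical polynomials that tend boundedly to 1 on [0, 1/2[ and to 0 on
    ]1/2, 1], by the two Bernoulli inequalities above. *)
Definition step_poly (R : realType) n (y : R) := (1 - y ^+ n) ^+ (2 ^ n).

Lemma step_poly_bound (R : realType) n (y : R) : 0 <= y <= 1 ->
  0 <= step_poly n y <= 1.
Proof.
move=> /andP[y0 y1]; have yn : 0 <= y ^+ n <= 1 by rewrite exprn_ge0// exprn_ile1.
by rewrite /step_poly exprn_ge0 ?exprn_ile1//; lra.
Qed.

Lemma step_poly_cvg1 (R : realType) (y : R) : 0 <= y < 2^-1 ->
  step_poly n y @[n --> \oo] --> (1 : R).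
Proof.
move=> /andP[y0 y1]; apply/cvgrPdist_lt => e e0.
have : (2 * y) ^+ n @[n --> \oo] --> (0 : R).
  by apply: cvg_expr; rewrite ger0_norm ?mulr_ge0//; lra.
move=> /cvgrPdist_lt/(_ _ e0); apply: filterS => n.
rewrite sub0r normrN => /(le_lt_trans (ler_norm _)); apply: le_lt_trans.
have yn : 0 <= y ^+ n <= 1 by rewrite exprn_ge0// exprn_ile1//; lra.
have := bernoulli_sub (2 ^ n) yn; rewrite natrX -exprMn => h.
have /andP[s0 s1] : 0 <= step_poly n y <= 1 by apply: step_poly_bound; lra.
by rewrite ger0_norm ?subr_ge0// lerBlDl -lerBlDr.
Qed.

Lemma step_poly_cvg0 (R : realType) (y : R) : 2^-1 < y <= 1 ->
  step_poly n y @[n --> \oo] --> (0 : R).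
Proof.
move=> /andP[y0 y1]; apply/cvgrPdist_lt => e e0.
have y20 : 0 < 2 * y by lra.
have : (2 * y)^-1 ^+ n @[n --> \oo] --> (0 : R).
  apply: cvg_expr; rewrite ger0_norm ?invr_ge0 ?ltW// invf_lt1//; lra.
move=> /cvgrPdist_lt/(_ _ e0); apply: filterS => n.
rewrite !sub0r !normrN => /(le_lt_trans (ler_norm _)); apply: le_lt_trans.
have yn : 0 <= y ^+ n <= 1 by rewrite exprn_ge0 ?exprn_ile1//; lra.
have := bernoulli_inv (2 ^ n) yn; rewrite natrX -exprMn -/(step_poly n y) => h.
have /andP[s0 s1] : 0 <= step_poly n y <= 1 by apply: step_poly_bound; lra.
have z0 : 0 < (2 * y) ^+ n by rewrite exprn_gt0.
rewrite ger0_norm// exprVn -[leRHS]mul1r ler_pdivlMr//; nra.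
Qed.

Lemma step_poly_continuous (R : realType) n : continuous (@step_poly R n).
Proof.
move=> y; apply: (@cvg_comp _ _ _ (fun y => 1 - y ^+ n) (fun z => z ^+ (2 ^ n))).
  by apply: cvgB; [exact: cvg_cst|exact: exprn_continuous].
exact: exprn_continuous.
Qed.

Section PowerFunctions.
Context (R : realType).
Implicit Types (a b p : R).

Lemma powR_le p a b : 0 <= p -> 0 <= a -> a <= b -> a `^ p <= b `^ p.
Proof.
move=> p0 a0 ab; apply: ge0_ler_powR => //; rewrite nnegrE//.
exact: le_trans ab.
Qed.

(** A quasi-triangle inequality is enough for density, and it is also valid for
    p < 1. *)
Lemma powRD_le p a b : 0 <= p -> 0 <= a -> 0 <= b ->
  (a + b) `^ p <= 2 `^ p * (a `^ p + b `^ p).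
Proof.
move=> p0 a0 b0; have [ab|/ltW ba] := leP a b.
  apply: (@le_trans _ _ ((2 * b) `^ p)).
    by apply: powR_le => //; [rewrite addr_ge0|lra].
  by rewrite powRM// ler_wpM2l ?powR_ge0// lerDr powR_ge0.
apply: (@le_trans _ _ ((2 * a) `^ p)).
  by apply: powR_le => //; [rewrite addr_ge0|lra].
by rewrite powRM// ler_wpM2l ?powR_ge0// lerDl powR_ge0.
Qed.

Lemma cvg_powR0 p (u : nat -> R) : 0 < p -> (forall n, 0 <= u n) ->
  u n @[n --> \oo] --> (0 : R) -> u n `^ p @[n --> \oo] --> (0 : R).
Proof.
move=> p0 u0 /cvgrPdist_lt uc; apply/cvgrPdist_lt => e e0.
have /uc : 0 < e `^ p^-1 by rewrite powR_gt0.
apply: filterS => n; rewrite !sub0r !normrN ger0_norm// ger0_norm ?powR_ge0// => h.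
have -> : e = (e `^ p^-1) `^ p by rewrite -powRrM mulVf ?gt_eqF// powRr1// ltW.
by apply: gt0_ltr_powR => //; rewrite nnegrE// powR_ge0.
Qed.

Lemma measurable_powR_comp (D : set R) (g : R -> R) p :
  measurable_fun D g -> measurable_fun D (fun t => g t `^ p).
Proof.
by move=> mg; apply: (@measurableT_comp _ _ _ _ _ _ (fun z : R => z `^ p)).
Qed.

End PowerFunctions.

(** Dominated convergence, in the form in which it provides one good
    approximation. *)
Lemma dominated_upper_bounded (R : realType) (D : set R) (phi : nat -> R -> R)
    (G : R -> R) e :
  measurable D -> (forall n, measurable_fun D (phi n)) ->
  (forall n t, 0 <= phi n t) ->
  {ae lebesgue_measure, forall t, D t -> phi n t @[n --> \oo] --> (0 : R)} ->
  lebesgue_measure.-integrable D (fun t => (G t)%:E) ->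
  {ae lebesgue_measure, forall t n, D t -> phi n t <= G t} ->
  0 < e -> exists n, upper_bounded D (phi n) e.
Proof.
move=> mD mphi phi0 cphi intG phiG e0.
have [] := @dominated_convergence _ _ R lebesgue_measure D mD
  (fun n t => (phi n t)%:E) (cst 0%E) (fun t => (G t)%:E).
- by move=> n; apply/measurable_EFinP; exact: mphi.
- exact: measurable_cst.
- apply: (ae_mono cphi) => t /[apply] h; exact: cvg_toE.
- exact: intG.
- apply: (ae_mono phiG) => t h n Dt.
  by rewrite /= ger0_norm// lee_fin; exact: h.
move=> _ _; rewrite integral0 => /fine_cvgP[fin /cvgrPdist_lt/(_ _ e0)].
move=> /(filterI fin)[N _ /(_ N (leqnn N))[/= finN hN]].
exists N; apply: (@upper_bounded_integral _ _ _ (phi N)) => //.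
  by apply: aeW.
rewrite sub0r normrN in hN.
by rewrite -(fineK finN) lee_fin ltW// (le_lt_trans (ler_norm _) hN).
Qed.

(** * Density of trigonometric polynomials: from rays to simple functions *)

Section Density.
Context (R : realType) (H : completeNormedModType R[i]).
Variable T : R.
Hypothesis T0 : 0 < T.
Local Notation mode := (fourier_mode T).
Local Notation trig := (trig_poly T [set: H]).
Local Notation mu := (@lebesgue_measure R).
Local Notation D := [set` `[0%R, T]].
Implicit Types (F P : R -> H) (x : H).

(** Scalar trigonometric polynomials, characterised by what they do: this class
    is closed under sums and products, so any polynomial of a cosine belongs to
    it. *)
Definition trig_multiplier (q : R -> R[i]) := forall F, trig F ->
  trig (fun t => q t *: F t).

Lemma trig_multiplier_cst c : trig_multiplier (cst c).
Proof. by move=> F; exact: trig_polyZ. Qed.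

Lemma trig_multiplier_mode n : trig_multiplier (mode n).
Proof. by move=> F; exact: trig_polyM. Qed.

Lemma trig_multiplierD q r : trig_multiplier q -> trig_multiplier r ->
  trig_multiplier (fun t => q t + r t).
Proof.
move=> mq mr F tF; have := trig_polyD (mq _ tF) (mr _ tF).
by congr trig_poly; apply/funext => t; rewrite scalerDl.
Qed.

Lemma trig_multiplierM q r : trig_multiplier q -> trig_multiplier r ->
  trig_multiplier (fun t => q t * r t).
Proof.
move=> mq mr F tF; have := mq _ (mr _ tF).
by congr trig_poly; apply/funext => t; rewrite scalerA.
Qed.

Lemma trig_multiplierX q m : trig_multiplier q ->
  trig_multiplier (fun t => q t ^+ m).
Proof.
move=> mq; elim: m => [|m IH]; first exact: trig_multiplier_cst.
by under eq_fun do rewrite exprS; exact: trig_multiplierM.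
Qed.

Lemma trig_multiplier_cos c :
  trig_multiplier (fun t => (cos (omega T 1 * (t - c)))%:C).
Proof.
have E t : (cos (omega T 1 * (t - c)))%:C =
    (2^-1)%:C * (mode 1 (- c) * mode 1 t + mode (- 1) (- c) * mode (- 1) t).
  rewrite -!modeD addrC /fourier_mode omegaN mulNr cosN sinN.
  by apply/eqP; rewrite eq_complex /=; apply/andP; split; apply/eqP; lra.
under eq_fun do rewrite E.
apply: trig_multiplierM; first exact: trig_multiplier_cst.
by apply: trig_multiplierD; (apply: trig_multiplierM;
  [exact: trig_multiplier_cst|exact: trig_multiplier_mode]).
Qed.

Lemma trig_multiplier_step_poly n (y : R -> R) :
  trig_multiplier (fun t => (y t)%:C) ->
  trig_multiplier (fun t => (step_poly n (y t))%:C).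
Proof.
move=> my; have -> : (fun t => (step_poly n (y t))%:C) =
    (fun t => (1 + (-1) * (y t)%:C ^+ n) ^+ (2 ^ n)).
  by apply/funext => t; rewrite /step_poly rmorphXn rmorphB rmorph1 rmorphXn mulN1r.
apply: trig_multiplierX; apply: trig_multiplierD.
  exact: trig_multiplier_cst.
by apply: trig_multiplierM; [exact: trig_multiplier_cst|exact: trig_multiplierX].
Qed.

Variable p : R.
Hypothesis p0 : 0 < p.

(** Membership in the closure of the trigonometric polynomials for the p-th
    power of the L^p distance on a period. *)
Definition trig_approximable F := forall e, 0 < e ->
  exists2 P, trig P & upper_bounded D (fun t => normR (F t - P t) `^ p) e.

Let mD : measurable D. Proof. exact: measurable_itv. Qed.
Let Dfin : (mu D < +oo)%E. Proof. exact: lebesgue_segment_lty. Qed.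
Let pge0 : 0 <= p. Proof. exact: ltW. Qed.
Let two0 : 0 < 2 `^ p :> R. Proof. by rewrite powR_gt0. Qed.

Lemma upper_bounded_normR_powRD F P (c d : R) :
  upper_bounded D (fun t => normR (F t) `^ p) c ->
  upper_bounded D (fun t => normR (P t) `^ p) d ->
  upper_bounded D (fun t => normR (F t + P t) `^ p) (2 `^ p * (c + d)).
Proof.
move=> Fc Pd.
apply: upper_boundedS (upper_boundedZ mD (ltW two0) (upper_boundedD mD Fc Pd)) => t _.
apply: le_trans (powRD_le _ _ _); rewrite ?normR_ge0//.
by apply: powR_le; rewrite ?normR_ge0// normRD.
Qed.

Lemma trig_approximable_trig P : trig P -> trig_approximable P.
Proof.
move=> tP e e0; exists P => //.
have := upper_bounded_cst mD Dfin (lexx (0 : R)); rewrite mul0r.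
apply: upper_bounded_le; last exact: ltW.
by apply: aeW => t _ /=; rewrite subrr normR0 powR0// gt_eqF.
Qed.

Lemma trig_approximable_closed F : (forall e, 0 < e -> exists2 P,
    trig_approximable P & upper_bounded D (fun t => normR (F t - P t) `^ p) e) ->
  trig_approximable F.
Proof.
move=> h e e0; have e2 : 0 < e / 2 `^ p / 2 by rewrite !divr_gt0.
have [P aP FP] := h _ e2; have [Q tQ PQ] := aP _ e2; exists Q => //.
have := upper_bounded_normR_powRD FP PQ.
rewrite -splitr mulrC divfK ?gt_eqF//.
by apply: upper_boundedS => t _; rewrite addrA subrK.
Qed.

Lemma trig_approximableD F P : trig_approximable F -> trig_approximable P ->
  trig_approximable (fun t => F t + P t).
Proof.
move=> aF aP e e0; have e2 : 0 < e / 2 `^ p / 2 by rewrite !divr_gt0.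
have [F' tF' FF'] := aF _ e2; have [P' tP' PP'] := aP _ e2.
exists (fun t => F' t + P' t); first exact: trig_polyD.
have := upper_bounded_normR_powRD FF' PP'.
rewrite -splitr mulrC divfK ?gt_eqF//.
by apply: upper_boundedS => t _; rewrite opprD addrACA.
Qed.

Lemma trig_approximableN F : trig_approximable F ->
  trig_approximable (fun t => - F t).
Proof.
move=> aF e /aF[P tP FP]; exists (fun t => - P t).
  by have := trig_polyZ (-1) tP; congr trig_poly; apply/funext => t; rewrite scaleN1r.
by apply: upper_boundedS FP => t _; rewrite -opprD normRN.
Qed.

Lemma trig_approximable_sum (I : Type) (r : seq I) (F : I -> R -> H) :
  (forall i, trig_approximable (F i)) ->
  trig_approximable (fun t => \sum_(i <- r) F i t).
Proof.
move=> aF; elim: r => [|i r IH].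
  rewrite (_ : (fun _ => _) = fun=> 0).
    by apply: trig_approximable_trig; exact: trig_poly0.
  by apply/funext => t; rewrite big_nil.
rewrite (_ : (fun _ => _) = fun t => F i t + \sum_(i <- r) F i t).
  exact: trig_approximableD.
by apply/funext => t; rewrite big_cons.
Qed.

Lemma trig_approximable_cst x : trig_approximable (cst x).
Proof.
apply: trig_approximable_trig; have := trig_poly_mode T 0 x.
by congr trig_poly; apply/funext => t; rewrite mode0n scale1r.
Qed.

Lemma trig_approximable_eq F P : {ae mu, forall t, D t -> F t = P t} ->
  trig_approximable F -> trig_approximable P.
Proof.
move=> FP aF e /aF[Q tQ FQ]; exists Q => //; apply: upper_bounded_le (lexx e) FQ.
by apply: (ae_mono FP) => t /[apply] ->; exact: lexx.
Qed.

(** On a period, the cosine centred at a / 2 exceeds its value at distance a / 2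
    exactly on ]0, a[. The indicator of ]0, a[ is thus a step function of a
    cosine. *)
Lemma cos_window (a t : R) : 0 < a <= T -> 0 <= t <= T ->
  (0 < t < a -> cos (omega T 1 * (a / 2)) < cos (omega T 1 * (t - a / 2))) /\
  (a < t < T -> cos (omega T 1 * (t - a / 2)) < cos (omega T 1 * (a / 2))).
Proof.
move=> /andP[a0 aT] /andP[t0 tT]; set w := omega T 1.
have wT : w * T = 2 * pi by rewrite /w /omega mulr1 divfK// gt_eqF.
have w0 : 0 < w by rewrite /w /omega mulr1 divr_gt0// mulr_gt0// pi_gt0.
have wmono r s : r < s -> w * r < w * s by rewrite ltr_pM2l.
have wmonoe r s : r <= s -> w * r <= w * s by rewrite ler_pM2l.
have wpi : w * (a / 2) <= pi.
  have h : a / 2 <= T / 2 by lra.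
  by have := wmonoe _ _ h; rewrite [w * (T / 2)]mulrA wT; lra.
have wa0 : 0 <= w * (a / 2) by rewrite mulr_ge0 ?ltW// divr_gt0.
have win : w * (a / 2) \in `[0, pi] by rewrite in_itv /= wa0.
split=> /andP[h1 h2].
  have -> : cos (w * (t - a / 2)) = cos `|w * (t - a / 2)|.
    by have [_|_] := ger0P (w * (t - a / 2)); rewrite ?cosN.
  have abs : `|w * (t - a / 2)| < w * (a / 2).
    rewrite ltr_norml; apply/andP; split.
      by rewrite -mulrN; apply: wmono; lra.
    by apply: wmono; lra.
  by rewrite ltr_cos// in_itv /= normr_ge0 (le_trans (ltW abs)).
(* To the right of the window the argument can exceed pi; reflecting it at pi
   brings it back to the interval where the cosine decreases. *)
have lo : w * (a / 2) < w * (t - a / 2) by apply: wmono; lra.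
have hi : w * (t - a / 2) < 2 * pi - w * (a / 2).
  by rewrite -wT -mulrBr; apply: wmono; lra.
have [sm|bg] := leP (w * (t - a / 2)) pi.
  by rewrite ltr_cos// in_itv /= sm andbT; lra.
have -> : cos (w * (t - a / 2)) = cos (2 * pi - w * (t - a / 2)).
  have -> : 2 * pi - w * (t - a / 2) = - (w * (t - a / 2)) + pi *+ 2.
    by rewrite addrC mulr_natl.
  by rewrite cosD2pi cosN.
rewrite ltr_cos//; last by rewrite in_itv /=; apply/andP; split; lra.
lra.
Qed.

Lemma ae_neq (a : R) : {ae mu, forall t, t <> a}.
Proof.
exists [set a]; split => //; first exact: lebesgue_measure_set1.
by move=> t /= /contrapT.
Qed.

(** On [0, T] the ray is the interval [0, a[, up to a point, when 0 < a <= T.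
    Its indicator is the bounded limit of step_poly n y, where y is an affine
    function of the cosine of cos_window, with values in [0, 1] and equal to 1/2
    at the ends of the interval. *)
Lemma trig_approximable_ray (a : R) x :
  trig_approximable (fun t => if t \in [set` `]-oo, a[] then x else 0).
Proof.
have inE' t : (t \in [set` `]-oo, a[]) = (t < a).
  by apply/idP/idP; rewrite inE /= in_itv.
have [a0|a0] := leP a 0.
  apply: trig_approximable_eq (trig_approximable_cst 0); apply: aeW => t.
  rewrite /= in_itv /= inE' => /andP[t0 _].
  by rewrite ltNge (le_trans a0 t0).
have [aT|aT] := ltP T a.
  apply: trig_approximable_eq (trig_approximable_cst x); apply: aeW => t.
  by rewrite /= in_itv /= inE' => /andP[_ tT]; rewrite (le_lt_trans tT aT).
have haT : 0 < a <= T by rewrite a0.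
(* The factor 1/4 keeps y in [0, 1]: the two cosines differ by at most 2. *)
pose y t : R := 2^-1 - (cos (omega T 1 * (t - a / 2)) - cos (omega T 1 * (a / 2))) / 4.
have y01 t : 0 <= y t <= 1.
  have := cos_geN1 (omega T 1 * (t - a / 2)); have := cos_le1 (omega T 1 * (t - a / 2)).
  have := cos_geN1 (omega T 1 * (a / 2)); have := cos_le1 (omega T 1 * (a / 2)).
  by rewrite /y; move=> *; apply/andP; split; lra.
have my : trig_multiplier (fun t => (y t)%:C).
  have -> : (fun t => (y t)%:C) = (fun t =>
     (2^-1 + cos (omega T 1 * (a / 2)) / 4)%:C +
     (- 4^-1)%:C * (cos (omega T 1 * (t - a / 2)))%:C).
    apply/funext => t; rewrite -rmorphM -rmorphD; congr (_%:C); rewrite /y; lra.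
  apply: trig_multiplierD; first exact: trig_multiplier_cst.
  by apply: trig_multiplierM; [exact: trig_multiplier_cst|exact: trig_multiplier_cos].
have ycont : continuous y.
  move=> t; apply: cvgB; first exact: cvg_cst.
  apply: cvgM; last exact: cvg_cst.
  apply: cvgB; last exact: cvg_cst.
  apply: (@cvg_comp _ _ _ (fun t => omega T 1 * (t - a / 2)) cos); last exact: continuous_cos.
  by apply: cvgM; [exact: cvg_cst|apply: cvgB; [exact: cvg_id|exact: cvg_cst]].
pose phi (n : nat) (t : R) : R := (`|(t < a)%R%:R - step_poly n (y t)| * normR x) `^ p.
move=> e e0; have [n hn] : exists n, upper_bounded D (phi n) e.
  apply: (@dominated_upper_bounded _ _ phi (cst (normR x `^ p))) => //.
  - move=> n; suff mb : measurable_fun D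
        (fun t => `|(t < a)%R%:R - step_poly n (y t)| * normR x).
      exact: measurable_powR_comp.
    apply: measurable_funM => //; apply: measurableT_comp => //.
    apply: measurable_funB.
      rewrite (_ : (fun t => _) = \1_[set` `]-oo, a[]).
        by apply: measurable_indic; exact: measurable_itv.
      by apply/funext => t; rewrite indicE inE'.
    apply: measurable_funS (@continuous_measurable_fun _ _ _) => //.
    move=> t; apply: (@cvg_comp _ _ _ y (step_poly n)); first exact: ycont.
    exact: step_poly_continuous.
  - by move=> m t; exact: powR_ge0.
  - apply: (ae_mono2 (ae_neq 0) (ae_mono2 (ae_neq a) (ae_neq T) (fun t h1 h2 => conj h1 h2))).
    move=> t /eqP t0 [/eqP ta /eqP tT]; rewrite /= in_itv /= => /andP[tge0 tleT].
    apply: cvg_powR0 => //; first by move=> m; rewrite mulr_ge0// normR_ge0.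
    rewrite -[X in _ --> X](mul0r (normR x)); apply: cvgM; last exact: cvg_cst.
    rewrite -[X in _ --> X](@normr0 R R); apply: cvg_norm.
    have [w1 w2] : (0 < t < a -> cos (omega T 1 * (a / 2)) < cos (omega T 1 * (t - a / 2))) /\
      (a < t < T -> cos (omega T 1 * (t - a / 2)) < cos (omega T 1 * (a / 2))).
      by apply: cos_window => //; rewrite tge0.
    have /andP[yt0 yt1] := y01 t.
    have [lta|gta|/eqP] := ltgtP t a; last by rewrite (negPf ta).
    + rewrite -[X in _ --> X](subrr (1 : R)); apply: cvgB; first exact: cvg_cst.
      apply: step_poly_cvg1; rewrite yt0 /=.
      have : 0 < t < a by rewrite lta lt_neqAle eq_sym t0 tge0.
      by move=> /w1; rewrite /y; lra.
    + rewrite -[X in _ --> X](subrr (0 : R)); apply: cvgB; first exact: cvg_cst.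
      apply: step_poly_cvg0; rewrite yt1 andbT.
      have : a < t < T by rewrite gta lt_neqAle tT tleT.
      by move=> /w2; rewrite /y; lra.
  - apply: (@bounded_integrable _ _ _ _ _ _ (normR x `^ p)) => //.
    by move=> t _; rewrite /= ger0_norm// powR_ge0.
  - apply: aeW => t m _ /=; apply: powR_le => //.
      by rewrite mulr_ge0 ?normR_ge0.
    rewrite -[leRHS]mul1r ler_wpM2r ?normR_ge0//.
    have /andP[s0 s1] := step_poly_bound m (y01 t).
    by rewrite ler_norml; case: (t < a) => /=; apply/andP; split; lra.
exists (fun t => (step_poly n (y t))%:C *: x).
  have := trig_multiplier_step_poly n my (trig_poly_mode T 0 x).
  by congr trig_poly; apply/funext => t; rewrite mode0n scale1r.
apply: upper_boundedS hn => t _; rewrite /phi -normRZr inE' rmorphB scalerBl.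
by case: (t < a); rewrite ?scale1r ?rmorph0 ?scale0r; exact: lexx.
Qed.

End Density.

Section LpDensity.
Context (R : realType) (H : completeNormedModType R[i]).
Context (dot : {dot H for (@Num.conj R[i])}) (dotH : hilbert_norm dot).
Variable T : R.
Hypothesis T0 : 0 < T.
Local Notation mode := (fourier_mode T).
Local Notation trig := (trig_poly T [set: H]).
Local Notation mu := (@lebesgue_measure R).
Local Notation D := [set` `[0%R, T]].
Implicit Types (F P : R -> H) (x : H).
Variable p : R.
Hypothesis p0 : 0 < p.

Let mD : measurable D. Proof. exact: measurable_itv. Qed.
Let Dfin : (mu D < +oo)%E. Proof. exact: lebesgue_segment_lty. Qed.
Let pge0 : 0 <= p. Proof. exact: ltW. Qed.

(** The partial sums of the indicators of disjoint sets converge to the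
    indicator of their union and are dominated by the constant |x|^p. *)
Lemma trig_approximable_bigcup (B : nat -> set R) x :
  (forall n, measurable (B n)) -> trivIset setT B ->
  (forall n, trig_approximable T p (fun t => if t \in B n then x else 0)) ->
  trig_approximable T p (fun t => if t \in \bigcup_n B n then x else 0).
Proof.
move=> mB tB aB; apply: trig_approximable_closed => // e e0.
pose f n t := (if t \in \bigcup_n B n then x else 0) -
  \sum_(k < n) (if t \in B k then x else 0).
have sf n : simple_function (f n).
  apply: simple_functionB.
    apply: simple_function_patch; last exact: simple_function_cst.
    exact: bigcup_measurable.
  by apply: simple_function_sum => k _; apply: simple_function_patch;
    [exact: mB|exact: simple_function_cst].
have sumB n k t : B k t -> \sum_(j < n) (if t \in B j then x else 0) =
    if (k < n)%N then x else 0.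
  move=> Bkt; have h j : (t \in B j) = (j == k).
    apply/idP/eqP => [|->]; last by rewrite inE.
    by rewrite inE => Bjt; apply: (tB j k) => //; exists t.
  case: ltnP => kn.
    rewrite (bigD1 (Ordinal kn)) //= h eqxx big1 ?addr0// => j jk.
    by rewrite h -(inj_eq val_inj) in jk *; rewrite /= in jk; rewrite (negPf jk).
  rewrite big1// => j _; rewrite h; case: eqP => // jk.
  by have := ltn_ord j; rewrite jk ltnNge kn.
have sumN n t : ~ (\bigcup_k B k) t -> \sum_(j < n) (if t \in B j then x else 0) = 0.
  move=> h; rewrite big1// => j _; case: ifPn => //; rewrite inE => Bj.
  by exfalso; apply: h; exists j.
have [n hn] : exists n, upper_bounded D (fun t => normR (f n t) `^ p) e.
  apply: (@dominated_upper_bounded _ _ (fun n t => normR (f n t) `^ p) (cst (normR x `^ p))) => //.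
  - by move=> n; exact: (simple_measurable_comp (fun z => normR z `^ p)).
  - by move=> n t; exact: powR_ge0.
  - apply: aeW => t _; apply: cvg_powR0 => //; first by move=> n; exact: normR_ge0.
    rewrite -(@normR0 R H); apply: cvg_normR; apply/cvg_normRP => d d0.
    rewrite /f; have [|h] := pselect ((\bigcup_n B n) t).
      move=> [k _ Bkt]; exists k.+1 => // n /= kn; rewrite (sumB _ k)// kn.
      have -> : (t \in \bigcup_n B n) by rewrite inE; exists k.
      by rewrite !subrr normR0.
    by exists 0%N => // n _; rewrite /= sumN// memNset// !subrr normR0.
  - apply: (@bounded_integrable _ _ _ _ _ _ (normR x `^ p)) => //.
    by move=> t _; rewrite /= ger0_norm// powR_ge0.
  - apply: aeW => t n _ /=; apply: powR_le; rewrite ?normR_ge0//.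
    rewrite /f; have [|h] := pselect ((\bigcup_n B n) t).
      move=> [k _ Bkt]; rewrite (sumB _ k)//.
      have -> : (t \in \bigcup_n B n) by rewrite inE; exists k.
      by case: ifP => _; rewrite ?subrr ?subr0 ?normR0 ?normR_ge0.
    by rewrite sumN// memNset// subrr normR0 normR_ge0.
exists (fun t => \sum_(k < n) (if t \in B k then x else 0)) => //.
by apply: trig_approximable_sum => // k; exact: aB.
Qed.

(** The sets whose indicators can be approximated form a Dynkin system that
    contains the rays, and the rays are stable under intersection and generate
    the Borel sets. *)
Lemma trig_approximable_indic (B : set R) x : measurable B ->
  trig_approximable T p (fun t => if t \in B then x else 0).
Proof.
have rayE : @measurable _ (R : measurableType _) = <<s @RGenInftyO.G R >>.
  exact: RGenInftyO.measurableE.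
move=> mB.
apply: (@dynkin_induction _ (R : measurableType _) (@RGenInftyO.G R)
  (fun B => trig_approximable T p (fun t => if t \in B then x else 0))) => //.
- move=> _ _ [a ->] [b ->]; exists (Num.min a b).
  by apply/seteqP; split => t /=; rewrite !in_itv /= lt_min; [case=> -> ->|move=> /andP[]].
- have := trig_approximable_cst T p0 x; congr trig_approximable.
  by apply/funext => t; rewrite in_setT.
- by move=> _ [a ->]; exact: trig_approximable_ray.
- move=> B' _ aB'.
  have := trig_approximableD p0 (trig_approximable_cst T p0 x)
    (trig_approximableN aB').
  congr trig_approximable; apply/funext => t; rewrite in_setC.
  by case: (t \in B') => /=; rewrite ?subrr ?subr0.
- by move=> B' mB' tB' aB'; exact: trig_approximable_bigcup.
- by rewrite -rayE.
Qed.

Lemma trig_approximable_simple (s : R -> H) : simple_function s -> trig_approximable T p s.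
Proof.
move=> [fins ms].
have -> : s = fun t => \sum_(x <- fset_set (range s)) (if t \in s @^-1` [set x] then x else 0).
  apply/funext => t.
  have st : s t \in fset_set (range s) by rewrite in_fset_set// inE; exists t.
  rewrite (bigD1_seq (s t) st (fset_uniq _)) /= mem_set// big1 ?addr0// => x.
  case: ifPn => //; rewrite inE => /= h; rewrite h eqxx//.
apply: trig_approximable_sum => // x.
exact: trig_approximable_indic.
Qed.

Lemma Lp_norm_finite F : (Lp_norm T p F < +oo)%E ->
  (\int[mu]_(t in D) (normR (F t) `^ p)%:E < +oo)%E.
Proof.
rewrite /Lp_norm; case E : (\int[mu]_(t in D) (normR (F t) `^ p)%:E)%E => [r| |]//.
  by move=> _; rewrite ltry.
by rewrite poweRyr// invr_eq0 gt_eqF.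
Qed.

(** Strong measurability gives simple functions that converge almost everywhere.
    Cutting them off where their norm exceeds that of F by more than 1 keeps
    them simple and makes their distance to F at most 2 |F| + 1, so that
    dominated convergence applies. *)
Lemma Lp_per_trig_approximable F : Lp_per T p F -> trig_approximable T p F.
Proof.
move=> [_ [s [ss sF]] /Lp_norm_finite Ffin].
have simp n : simple_function (s n) by exact: simple_function_fimfun.
have [||g mg Fg] := @ae_cvg_measurable R D (fun n t => normR (s n t))
    (fun t => normR (F t)) mD.
- by move=> n; exact: (simple_measurable_comp (@normR R H)).
- by apply: (ae_mono sF) => t /[apply] h; exact: cvg_normR.
have mgp : measurable_fun D (fun t => `|g t| `^ p).
  by apply: measurable_powR_comp; exact: measurableT_comp.
have intg : mu.-integrable D (fun t => (`|g t| `^ p)%:E).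
  apply/integrableP; split; first by apply/measurable_EFinP; exact: mgp.
  apply: le_lt_trans Ffin; apply: ae_ge0_le_integral_raw.
  - by move=> t _.
  - by move=> t _; rewrite lee_fin powR_ge0.
  - apply: (ae_mono Fg) => t h Dt; rewrite /= ger0_norm ?powR_ge0//.
    by rewrite -h// ger0_norm ?normR_ge0.
(* As s n t tends to F t, the slack 1 puts almost every t in B n eventually. *)
pose B n := D `&` [set t | normR (s n t) - g t <= 1].
have mB n : measurable (B n).
  have m : measurable_fun D (fun t => normR (s n t) - g t).
    apply: measurable_funB => //; exact: (simple_measurable_comp (@normR R H)).
  rewrite (_ : B n = D `&` (fun t => normR (s n t) - g t) @^-1` [set` `]-oo, 1%R]]).
    by apply: m => //; exact: measurable_itv.
  by apply/seteqP; split => t [Dt h]; split => //; move: h; rewrite /= in_itv.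
pose s' n t := if t \in B n then s n t else 0.
have ss' n : simple_function (s' n) by apply: simple_function_patch.
have hex n : exists h : R -> R, measurable_fun D h /\
    {ae mu, forall t, D t -> normR (F t - s' n t) = h t}.
  have [||h mh Fh] := @ae_cvg_measurable R D (fun m t => normR (s m t - s' n t))
    (fun t => normR (F t - s' n t)) mD.
  - by move=> m; apply: (simple_measurable_comp (@normR R H)); exact: simple_functionB.
  - apply: (ae_mono sF) => t /[apply] h; apply: cvg_normR; apply: cvgB => //.
    exact: cvg_cst.
  by exists h.
have {hex}[h hh] := choice hex.
have Fh : {ae mu, forall t n, D t -> normR (F t - s' n t) = h n t}.
  by apply: ae_foralln => n; case: (hh n).
pose G t : R := 2 `^ p * (2 `^ p * `|g t| `^ p + 1).
have one_int : mu.-integrable D (fun t => (1 : R)%:E).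
  by apply: (@bounded_integrable _ _ _ _ _ _ 1) => // t _; rewrite normr1.
have intG : mu.-integrable D (fun t => (G t)%:E).
  apply: (@eq_integrable _ _ _ mu D mD
    (fun t => (2 `^ p)%:E * ((2 `^ p)%:E * (`|g t| `^ p)%:E + 1%:E))%E).
    by move=> t _; rewrite /G EFinM EFinD EFinM.
  by apply: integrableZl => //; apply: integrableD => //; apply: integrableZl.
apply: trig_approximable_closed => // e e0.
have [n hn] : exists n, upper_bounded D (fun t => `|h n t| `^ p) e.
  apply: (@dominated_upper_bounded _ _ (fun n t => `|h n t| `^ p) G) => //.
  - move=> n; apply: measurable_powR_comp.
    by apply: measurableT_comp => //; case: (hh n).
  - apply: (ae_mono2 (ae_mono2 Fg Fh (fun t a b => conj a b)) sF).
    move=> t [Fgt Fht] sFt Dt; apply: cvg_powR0 => //.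
    have E n : `|h n t| = normR (F t - s' n t) by rewrite -Fht// ger0_norm ?normR_ge0.
    apply/cvgrPdist_lt => d d0.
    have /cvg_normRP/(_ _ d0) sd := sFt Dt.
    have /cvg_normRP/(_ _ ltr01) s1 := sFt Dt.
    apply: filterS2 sd s1 => m h1 h2; rewrite sub0r normrN ger0_norm// E.
    have -> : s' m t = s m t; last exact: h1.
    rewrite /s' mem_set//; split => //=; rewrite -Fgt//.
    apply: le_trans (ler_norm _) _; apply: le_trans (ler_dist_normR _ _) _.
    by rewrite normRBC ltW.
  - apply: (ae_mono2 Fg Fh) => t Fgt Fht n Dt.
    have -> : `|h n t| = normR (F t - s' n t) by rewrite -Fht// ger0_norm ?normR_ge0.
    have gE : `|g t| = normR (F t) by rewrite -Fgt// ger0_norm ?normR_ge0.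
    apply: (@le_trans _ _ ((2 * `|g t| + 1) `^ p)).
      apply: powR_le => //; first exact: normR_ge0.
      rewrite /s'; case: ifPn => [|_].
        rewrite inE => -[_ /= Bt].
        have : normR (s n t) - normR (F t) <= 1 by rewrite Fgt.
        by rewrite gE => *; apply: le_trans (normRD _ _) _; rewrite normRN; lra.
      by rewrite subr0 gE; have := normR_ge0 (F t); lra.
    apply: le_trans (powRD_le pge0 _ _) _ => //.
    by rewrite powRM// powR1.
exists (s' n); first exact: trig_approximable_simple.
apply: upper_bounded_le (lexx e) hn; apply: (ae_mono Fh) => t Fht Dt.
rewrite -Fht// (ger0_norm (normR_ge0 _)); exact: lexx.
Qed.

End LpDensity.

(** * Fourier coefficients of square integrable functions *)

Section LpConsequences.
Context (R : realType) (H : completeNormedModType R[i]).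
Context (dot : {dot H for (@Num.conj R[i])}) (dotH : hilbert_norm dot).
Variable T : R.
Hypothesis T0 : 0 < T.
Local Notation mode := (fourier_mode T).
Local Notation trig := (trig_poly T [set: H]).
Local Notation mu := (@lebesgue_measure R).
Local Notation D := [set` `[0%R, T]].
Implicit Types (F P : R -> H) (x : H).

Let mD : measurable D. Proof. exact: measurable_itv. Qed.
Let Dfin : (mu D < +oo)%E. Proof. exact: lebesgue_segment_lty. Qed.

Lemma fine_lebesgue_period : fine (mu D) = T.
Proof. by rewrite lebesgue_measure_itv /= lte_fin T0 -EFinB /= subr0. Qed.

Lemma upper_bounded_sub (D1 D2 : set R) (f : R -> R) c : measurable D1 ->
  measurable D2 -> D1 `<=` D2 -> upper_bounded D2 f c -> upper_bounded D1 f c.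
Proof.
move=> m1 m2 D12 [g [mg g0 fg gc]]; exists g; split => //.
- exact: measurable_funS mg.
- by apply: (ae_mono fg) => t h /D12; exact: h.
- by apply: le_trans gc; apply: ge0_subset_integral.
Qed.

Lemma Lp_norm_le p F c : 0 < p ->
  upper_bounded D (fun t => normR (F t) `^ p) c ->
  (Lp_norm T p F <= (c `^ p^-1)%:E)%E.
Proof.
move=> p0 Fc; have h : (\int[mu]_(t in D) (normR (F t) `^ p)%:E <= c%:E)%E.
  by apply: integral_le_upper_bound Fc => t _; exact: powR_ge0.
have i0 : (0 <= \int[mu]_(t in D) (normR (F t) `^ p)%:E)%E.
  by apply: integral_ge0 => t _; rewrite lee_fin powR_ge0.
rewrite /Lp_norm -poweR_EFin; apply: gt0_ler_poweR => //.
- by rewrite invr_ge0 ltW.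
- by rewrite in_itv /= i0 leey.
- by rewrite in_itv /= leey andbT (le_trans i0).
Qed.

Lemma trig_poly_Lp_per p P : 0 < p -> trig P -> Lp_per T p P.
Proof.
move=> p0 tP; split; first exact: trig_poly_periodic tP.
  have cP : {within `[0, T], continuous P} by apply: trig_poly_within; exact: tP.
  have := continuous_bochner_integrable (ltW T0) cP.
  move=> /(bochner_integrable_exists dotH mD Dfin)[v /is_bochner_of_has].
  by move=> /(_ mD)[s [sP _ _]]; exists s.
have [M M0 hM] := trig_poly_bounded tP.
apply: le_lt_trans (ltry ((M `^ p * fine (mu D)) `^ p^-1)).
apply: Lp_norm_le => //.
apply: upper_boundedS (upper_bounded_cst mD Dfin (powR_ge0 M p)) => t _.
by apply: powR_le; [exact: ltW|exact: normR_ge0|exact: hM].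
Qed.

Lemma trig_poly_dense p F : 0 < p -> Lp_per T p F -> forall e, 0 < e ->
  exists2 P, trig P & (Lp_norm T p (fun t => (F t - P t)%R) < e%:E)%E.
Proof.
move=> p0 FLp e e0; have e2 : 0 < (e / 2) `^ p by rewrite powR_gt0 ?divr_gt0.
have [P tP FP] := Lp_per_trig_approximable T0 p0 FLp e2; exists P => //.
apply: le_lt_trans (Lp_norm_le p0 FP) _.
rewrite -powRrM mulfV ?gt_eqF// powRr1 ?divr_ge0 ?ltW// lte_fin.
by rewrite ltr_pdivrMr// ltr_pMr// ltr1n.
Qed.

Definition square_approximable F := trig_approximable T 2 F.

Lemma square_approximableP F : square_approximable F <-> forall e, 0 < e ->
  exists2 P, trig P & upper_bounded D (fun t => normR (F t - P t) ^+ 2) e.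
Proof.
have E x : normR x `^ 2 = normR x ^+ 2 by rewrite powR_mulrn// normR_ge0.
split=> h e /h[P tP FP]; exists P => //; apply: upper_boundedS FP => t _;
  by rewrite E; exact: lexx.
Qed.

(** The period has finite measure, so that an L^2 bound gives an L^1 bound. The
    pointwise inequality f <= k + f^2 / k replaces Hoelder's inequality, and k
    is chosen after the error. *)
Lemma upper_bounded_L1_L2 (f : R -> R) c k : 0 < k ->
  upper_bounded D (fun t => f t ^+ 2) c ->
  upper_bounded D f (c / k + k * T).
Proof.
move=> k0 fc; have k1 : 0 <= k^-1 by rewrite invr_ge0 ltW.
have := upper_boundedD mD (upper_boundedZ mD k1 fc) (upper_bounded_cst mD Dfin (ltW k0)).
rewrite fine_lebesgue_period mulrC; apply: upper_boundedS => t _ /=.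
have [fk|/ltW kf] := leP (f t) k.
  by apply: le_trans fk _; rewrite lerDr mulr_ge0// sqr_ge0.
apply: le_trans (_ : k^-1 * f t ^+ 2 <= _); last by rewrite lerDl ltW.
rewrite expr2 mulrA ler_peMl ?(le_trans (ltW k0))//.
by rewrite mulrC ler_pdivlMr// mul1r.
Qed.

Lemma square_approximable_both F e : square_approximable F -> 0 < e ->
  exists P, [/\ trig P, upper_bounded D (fun t => normR (F t - P t) ^+ 2) e &
    upper_bounded D (fun t => normR (F t - P t)) e].
Proof.
move=> /square_approximableP aF e0.
have k0 : 0 < e / 2 / T by rewrite !divr_gt0.
(* With k = e / (2 T) the L^1 bound c / k + k T is e for c = (e / 2) k. *)
have d0 : 0 < Num.min e (e / 2 * (e / 2 / T)) by rewrite lt_min e0 !mulr_gt0// ?divr_gt0// invr_gt0.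
have [P tP FP] := aF _ d0; exists P; split => //.
  apply: upper_bounded_le FP; first by apply: aeW => t _; exact: lexx.
  by rewrite ge_min lexx.
apply: upper_bounded_le (upper_bounded_L1_L2 k0 FP).
  by apply: aeW => t _; exact: lexx.
rewrite [X in _ + X]divfK ?gt_eqF// [leRHS]splitr lerD2r ler_pdivrMr//.
by rewrite ge_min lexx orbT.
Qed.

Lemma square_approximableB F P : square_approximable F -> square_approximable P ->
  square_approximable (fun t => F t - P t).
Proof. by move=> aF aP; apply: trig_approximableD => //; exact: trig_approximableN. Qed.

(** Lipschitz images of F, with a constant independent of s, are limits in mean
    of the images of trigonometric polynomials. It is applied to multiplication
    by a mode and to the integrand of the variation-of-constants formula, so
    that neither requires the measurability of a composite function. *)
Lemma square_approximable_integrable (Phi : R -> R -> H -> H) F t C :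
  0 <= t <= T -> 0 <= C ->
  (forall P, trig P -> {within `[0, t], continuous (fun s => Phi t s (P s))}) ->
  (forall s x y, 0 <= s <= t -> normR (Phi t s x - Phi t s y) <= C * normR (x - y)) ->
  square_approximable F -> bochner_integrable [set` `[0, t]] (fun s => Phi t s (F s)).
Proof.
move=> /andP[t0 tT] C0 cPhi Phile aF.
apply: bochner_integrable_closed; first exact: measurable_itv.
move=> e e0; have C1 : 0 < C + 1 by rewrite ltr_wpDl.
have [P [tP _ FP]] := square_approximable_both aF (divr_gt0 e0 C1).
exists (fun s => Phi t s (P s)).
  by apply: continuous_bochner_integrable => //; exact: cPhi.
have sub : [set` `[0, t]] `<=` D.
  by move=> s /=; rewrite !in_itv /= => /andP[-> st]; exact: le_trans tT.
have := upper_bounded_sub (measurable_itv `[0, t]) mD sub FP.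
move=> /(upper_boundedZ (measurable_itv `[0, t]) C0).
apply: upper_bounded_le.
  by apply: aeW => s /=; rewrite in_itv /= => st; exact: Phile.
by rewrite mulrA ler_pdivrMr// mulrC ler_wpM2l ?lerDl// ltW.
Qed.

Lemma fourier_integrable F n : square_approximable F ->
  has_bochner D (fun t => mode (- n) t *: F t) (T%:C *: fourier_coef T F n).
Proof.
move=> aF.
have : bochner_integrable D (fun t => mode (- n) t *: F t).
  apply: (@square_approximable_integrable (fun _ t x => mode (- n) t *: x) _ T 1) => //.
  - by rewrite lexx ltW.
  - by move=> P tP; apply: trig_poly_within; exact: trig_polyM.
  - by move=> s x y _; rewrite -scalerBr normR_mode mul1r.
move=> /(bochner_integrableP dotH mD Dfin).
by rewrite /fourier_coef scalerA -rmorphM mulfV ?gt_eqF// rmorph1 scale1r.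
Qed.

Lemma fourier_coefE F n v : has_bochner D (fun t => mode (- n) t *: F t) v ->
  fourier_coef T F n = (T^-1)%:C *: v.
Proof. by rewrite /fourier_coef => /(bochner_integralE dotH mD Dfin) ->. Qed.

Lemma fourier_coef_bound F n c : square_approximable F ->
  upper_bounded D (fun t => normR (F t)) c -> normR (fourier_coef T F n) <= T^-1 * c.
Proof.
move=> aF Fc; have := normR_bochner dotH mD Dfin (fourier_integrable n aF).
move=> /(_ c); rewrite normRZr gtr0_norm// => h.
rewrite -(ler_pM2l T0) mulrA mulfV ?gt_eqF// mul1r; apply: h.
by apply: upper_boundedS Fc => t _; rewrite normR_mode.
Qed.

Lemma fourier_coefB F P n : square_approximable F -> square_approximable P ->
  fourier_coef T (fun t => F t - P t) n = fourier_coef T F n - fourier_coef T P n.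
Proof.
move=> aF aP.
have := has_bochnerB dotH mD Dfin (fourier_integrable n aF) (fourier_integrable n aP).
rewrite -scalerBr => h; rewrite (@fourier_coefE _ _ (T%:C *: (fourier_coef T F n - fourier_coef T P n))).
  by rewrite scalerA -rmorphM mulVf ?gt_eqF// rmorph1 scale1r.
by apply: has_bochner_ae h; apply: aeW => t _; rewrite scalerBr.
Qed.

Lemma fourier_coef_trig (s : seq int) (c : int -> H) n : uniq s ->
  fourier_coef T (fun t => \sum_(m <- s) mode m t *: c m) n = if n \in s then c n else 0.
Proof.
move=> us; rewrite (fourier_coefE (trig_poly_coef T0 dotH c n us)).
by rewrite scalerA -rmorphM mulVf ?gt_eqF// rmorph1 scale1r.
Qed.

Lemma square_approximable_trig P : trig P -> square_approximable P.
Proof. by move=> tP; exact: trig_approximable_trig. Qed.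

Lemma trig_poly_normR_measurable P : trig P ->
  measurable_fun D (fun t => normR (P t) ^+ 2).
Proof.
move=> tP; apply: measurable_funX.
apply: subspace_continuous_measurable_fun => // t.
apply: cvg_normR; apply: trig_poly_within; exact: tP.
Qed.

Lemma trig_poly_square_bounded (s : seq int) (c : int -> H) : uniq s ->
  upper_bounded D (fun t => normR (\sum_(m <- s) mode m t *: c m) ^+ 2)
    (T * \sum_(n <- s) normR (c n) ^+ 2).
Proof.
move=> us; have tP : trig (fun t => \sum_(m <- s) mode m t *: c m) by exists s, c.
apply: (upper_bounded_integral mD (trig_poly_normR_measurable tP)).
- by move=> t _; exact: sqr_ge0.
- by apply: aeW.
- by rewrite (trig_poly_parseval T0 dotH).
Qed.

(** The weight d trades the two squares: a perturbation that is small in L^2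
    changes squared norms by a factor close to 1. *)
Lemma sqrD_le_eps (a b d : R) : 0 < d ->
  (a + b) ^+ 2 <= (1 + d) * a ^+ 2 + (1 + d^-1) * b ^+ 2.
Proof.
move=> d0; have di : 0 < d^-1 by rewrite invr_gt0.
have : 0 <= d^-1 * (d * a - b) ^+ 2 by rewrite mulr_ge0 ?sqr_ge0// ltW.
have E : d^-1 * (d * a - b) ^+ 2 = d * a ^+ 2 - 2 * a * b + d^-1 * b ^+ 2.
  by field; rewrite gt_eqF.
by rewrite E; lra.
Qed.

Lemma upper_bounded_sqr_perturb F P (c e d : R) : 0 < d ->
  upper_bounded D (fun t => normR (F t) ^+ 2) c ->
  upper_bounded D (fun t => normR (F t - P t) ^+ 2) e ->
  upper_bounded D (fun t => normR (P t) ^+ 2) ((1 + d) * c + (1 + d^-1) * e).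
Proof.
move=> d0 Fc FP.
have d1 : 0 <= 1 + d by rewrite addr_ge0// ltW.
have d2 : 0 <= 1 + d^-1 by rewrite addr_ge0// invr_ge0 ltW.
have := upper_boundedD mD (upper_boundedZ mD d1 Fc) (upper_boundedZ mD d2 FP).
apply: upper_boundedS => t _; apply: le_trans (sqrD_le_eps _ _ d0).
rewrite ler_pXn2r ?nnegrE ?addr_ge0 ?normR_ge0//.
by rewrite normRBC -{1}(subrK (F t) (P t)) addrC normRD.
Qed.

Lemma upper_bounded_ge0 (f : R -> R) c : upper_bounded D f c -> 0 <= c.
Proof. by move=> [g [_ g0 _]]; rewrite -lee_fin; apply: le_trans; apply: integral_ge0. Qed.

(** For trigonometric polynomials this is the finite Parseval identity. In
    general, approximate F by P_k: coefficients depend continuously on the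
    function, and the squared norm of P_k is at most (1 + d) c plus an error
    that tends to 0 with k. *)
Lemma bessel F c (s : seq int) : uniq s -> square_approximable F ->
  upper_bounded D (fun t => normR (F t) ^+ 2) c ->
  T * \sum_(n <- s) normR (fourier_coef T F n) ^+ 2 <= c.
Proof.
move=> us aF Fc; have c0 := upper_bounded_ge0 Fc.
have hex k : exists P, [/\ trig P, upper_bounded D (fun t => normR (F t - P t) ^+ 2) (2^-1 ^+ k) &
    upper_bounded D (fun t => normR (F t - P t)) (2^-1 ^+ k)].
  by apply: square_approximable_both => //; rewrite exprn_gt0.
have [P hP] := choice hex.
have coefP n : normR (fourier_coef T (P k) n) ^+ 2 @[k --> \oo] -->
    normR (fourier_coef T F n) ^+ 2.
  suff h : normR (fourier_coef T (P k) n) @[k --> \oo] --> normR (fourier_coef T F n).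
    by rewrite !expr2; under eq_fun do rewrite expr2; exact: cvgM.
  apply: cvg_normR.
  apply: (@cvg_normR_le _ _ _ _ _ _ _ (fun k => T^-1 * 2^-1 ^+ k)).
    apply: nearW => k; have [tP _ FP] := hP k.
    have aP := square_approximable_trig tP.
    rewrite -fourier_coefB//; apply: fourier_coef_bound => //.
    exact: square_approximableB.
  rewrite -[X in _ --> X](mulr0 T^-1); apply: cvgM; first exact: cvg_cst.
  exact: cvg_half_pow.
have sumP : T * \sum_(n <- s) normR (fourier_coef T (P k) n) ^+ 2 @[k --> \oo] -->
    T * \sum_(n <- s) normR (fourier_coef T F n) ^+ 2.
  apply: cvgM; first exact: cvg_cst.
  elim: s {us} => [|n s IH].
    by under eq_fun do rewrite big_nil; rewrite big_nil; exact: cvg_cst.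
  by under eq_fun do rewrite big_cons; rewrite big_cons; apply: cvgD.
have bnd k d : 0 < d -> T * \sum_(n <- s) normR (fourier_coef T (P k) n) ^+ 2 <=
    (1 + d) * c + (1 + d^-1) * 2^-1 ^+ k.
  move=> d0; have [[s' [c' [us' _ PE]]] FP _] := hP k.
  have -> : P k = fun t => \sum_(n <- s') mode n t *: c' n by exact/funext.
  apply: le_trans (_ : T * \sum_(n <- s') normR (c' n) ^+ 2 <= _).
    rewrite ler_pM2l//.
    under eq_bigr do rewrite fourier_coef_trig//.
    rewrite (bigID (fun n => n \in s')) /= [X in _ + X]big1 ?addr0; last first.
      by move=> n /negPf ->; rewrite normR0 expr0n.
    rewrite (eq_bigr (fun n => normR (c' n) ^+ 2)); last by move=> n ->.
    rewrite -big_filter (perm_big [seq n <- s' | n \in s]); last first.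
      apply: uniq_perm; rewrite ?filter_uniq// => n.
      by rewrite !mem_filter andbC.
    rewrite big_filter [leRHS](bigID (fun n => n \in s)) /= lerDl.
    by apply: sumr_ge0 => n _; exact: sqr_ge0.
  have /integral_le_upper_bound : upper_bounded D
      (fun t => normR (\sum_(n <- s') mode n t *: c' n) ^+ 2)
      ((1 + d) * c + (1 + d^-1) * 2^-1 ^+ k).
    apply: (upper_bounded_sqr_perturb d0 Fc).
    by apply: upper_boundedS FP => t _; rewrite PE; exact: lexx.
  rewrite (trig_poly_parseval T0 dotH)// lee_fin; apply.
  by move=> t _; exact: sqr_ge0.
apply/ler_addgt0Pr => e e0.
have d0 : 0 < e / (c + 1) by rewrite divr_gt0// ltr_wpDl.
have dc : e / (c + 1) * c <= e.
  by rewrite mulrAC ler_pdivrMr ?ltr_wpDl// ler_wpM2l ?lerDl// ltW.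
set d := e / _ in d0 dc.
apply: le_trans (_ : (1 + d) * c <= _); last by rewrite mulrDl mul1r lerD2l.
have lim : T * \sum_(n <- s) normR (fourier_coef T (P k) n) ^+ 2 -
    (1 + d^-1) * 2^-1 ^+ k @[k --> \oo] -->
    T * \sum_(n <- s) normR (fourier_coef T F n) ^+ 2 - (1 + d^-1) * 0.
  apply: cvgB => //; apply: cvgM; first exact: cvg_cst.
  exact: cvg_half_pow.
rewrite -[leLHS]subr0 -[X in _ - X](mulr0 (1 + d^-1)).
by apply: (cvg_le_cst lim); apply: nearW => k; rewrite lerBlDr; exact: bnd.
Qed.

(** Upper bounds 2^-n for every n make the series with constant term |F|^2 bounded
    almost everywhere, so that this term is 0. *)
Lemma square_zero F : (forall e, 0 < e -> upper_bounded D (fun t => normR (F t) ^+ 2) e) ->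
  {ae mu, forall t, D t -> F t = 0}.
Proof.
move=> h.
have := @upper_bounded_series R D (fun _ t => normR (F t) ^+ 2) mD (fun _ t => sqr_ge0 _).
move=> /(_ (fun n => h _ _))/ae_mono; apply.
  by move=> n; rewrite exprn_gt0.
move=> t /[apply] -[M hM]; apply: normR_eq0; apply/eqP; rewrite -sqrf_eq0; apply/eqP.
have := bounded_series_cvg0 (fun=> sqr_ge0 (normR (F t))) hM.
by move=> /(cvg_lim (@Rhausdorff R)) <-; rewrite lim_cst.
Qed.

(** If the coefficients of F vanish, those of a trigonometric polynomial P near
    F are those of P - F, so the norm of P is at most the distance from P to F
    by Bessel's inequality. Hence F itself is as small as this distance. *)
Lemma fourier_uniqueness F : square_approximable F ->
  (forall n, fourier_coef T F n = 0) -> {ae mu, forall t, D t -> F t = 0}.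
Proof.
move=> aF F0; apply: square_zero => e e0.
have e4 : 0 < e / 4 by rewrite divr_gt0.
have [P [tP FP _]] := square_approximable_both aF e4.
have aP := square_approximable_trig tP.
have := tP => -[s [c [us _ PE]]].
have PsE : P = fun t => \sum_(n <- s) mode n t *: c n by exact/funext.
have Pc : T * \sum_(n <- s) normR (c n) ^+ 2 <= e / 4.
  have Pn n : n \in s -> c n = fourier_coef T (fun t => P t - F t) n.
    by move=> ns; rewrite fourier_coefB// F0 subr0 PsE fourier_coef_trig// ns.
  have -> : \sum_(n <- s) normR (c n) ^+ 2 =
      \sum_(n <- s) normR (fourier_coef T (fun t => P t - F t) n) ^+ 2.
    by rewrite big_seq [RHS]big_seq; apply: eq_bigr => n /Pn ->.
  apply: bessel => //; first exact: square_approximableB.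
  by apply: upper_boundedS FP => t _; rewrite normRBC.
have PB : upper_bounded D (fun t => normR (P t) ^+ 2) (e / 4).
  apply: upper_bounded_le Pc (trig_poly_square_bounded c us).
  by apply: aeW => t _; rewrite PE.
have FP' : upper_bounded D (fun t => normR (P t - F t) ^+ 2) (e / 4).
  by apply: upper_boundedS FP => t _; rewrite normRBC.
apply: upper_bounded_le (upper_bounded_sqr_perturb ltr01 PB FP').
  by apply: aeW => t _; exact: lexx.
by rewrite invr1; lra.
Qed.

End LpConsequences.

(** * Periodic functions and null sets *)

Section Periodic.
Context (R : realType).
Local Notation mu := (@lebesgue_measure R).

Lemma lebesgue_measure_shift (a : R) (A : set R) : measurable A ->
  mu ((fun t => t + a) @^-1` A) = mu A.
Proof.
move=> mA.
rewrite -[LHS]/(pushforward mu ((fun t => t + a) : _ -> measurableTypeR R) A).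
apply/esym/lebesgue_measure_unique => //=.
  by apply: measurable_funD => //.
move=> _ _ [[x y]] _ <-; rewrite /pushforward.
have -> : (fun t : R => t + a) @^-1` [set` `]x, y]] = [set` `]x - a, y - a]].
  by apply/seteqP; split => t /=; rewrite !in_itv /= ltrBlDr lerBrDr.
rewrite !lebesgue_measure_itv /= !lte_fin ltrD2r.
by case: ifP => // _; rewrite -!EFinB; congr EFin; ring.
Qed.

(** The exceptional set is covered by the translates by multiples of T of the
    exceptional set in [0, T]. *)
Lemma ae_periodic (V : zmodType) (T : R) (F : R -> V) : 0 < T -> periodic F T ->
  {ae mu, forall t, [set` `[0, T]] t -> F t = 0} -> {ae mu, forall t, F t = 0}.
Proof.
move=> T0 FT [N [mN N0 FN]].
have sh a : mu ((fun t => t + a) @^-1` N) = 0 by rewrite lebesgue_measure_shift.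
have msh a : measurable ((fun t : R => t + a) @^-1` N).
  have m : measurable_fun setT (fun t : R => t + a) by exact: measurable_funD.
  by rewrite -[X in measurable X]setTI; exact: m.
suff h : mu.-negligible (\bigcup_k ((fun t => t + T *+ k) @^-1` N `|`
                                   (fun t => t - T *+ k) @^-1` N)).
  apply: negligibleS h => t /= Ft.
  (* t and some s in [0, T] differ by k periods, in one of the two directions. *)
  have [k [s [ks s0T]]] : exists k s, (t = s + T *+ k \/ s = t + T *+ k) /\ 0 <= s <= T.
    have fl : (Num.floor (t / T))%:~R * T <= t < ((Num.floor (t / T))%:~R + 1) * T.
      by rewrite -ler_pdivlMr// -ltr_pdivrMr// Num.Theory.floor_le -intrD1 Num.Theory.floorD1_gt.
    move: fl; case: (Num.floor (t / T)) => k; rewrite ?NegzE ?mulrNz -pmulrn => /andP[f1 f2].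
      exists k, (t - T *+ k); split; first by left; rewrite subrK.
      by rewrite -(mulr_natl T k); apply/andP; split; lra.
    exists k.+1, (t + T *+ k.+1); split; first by right.
    by rewrite -(mulr_natl T k.+1); apply/andP; split; lra.
  exists k => //; case: ks => E; [right|left].
    have Es : t - T *+ k = s by rewrite E addrK.
    apply: FN => /= h; apply: Ft; rewrite E (periodicn FT).
    by rewrite Es in_itv /= in h; exact: h.
  apply: FN => /= h; apply: Ft; rewrite -(periodicn FT k).
  by apply: h; rewrite /= in_itv /= -E.
apply: negligible_bigcup => k.
by apply: negligibleU; (apply/negligibleP; [exact: msh|exact: sh]).
Qed.

End Periodic.

(** * The theorems of Riesz-Fischer and Plancherel *)

Section SummableFamilies.
Context (R : realType).
Implicit Types (a : int -> R) (s : seq int).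

Lemma esum_le a (c : R) : (forall n, 0 <= a n) ->
  (forall s, uniq s -> \sum_(n <- s) a n <= c) ->
  (\esum_(n in [set: int]) (a n)%:E <= c%:E)%E.
Proof.
move=> a0 ac; apply: ge_ereal_sup => _ [A [finA _] <-].
rewrite fsbig_finite//= sumEFin lee_fin; apply: ac; exact: fset_uniq.
Qed.

Lemma esum_ge_seq a s : (forall n, 0 <= a n) -> uniq s ->
  ((\sum_(n <- s) a n)%:E <= \esum_(n in [set: int]) (a n)%:E)%E.
Proof.
move=> a0 us; apply: ereal_sup_ubound; exists [set` s].
  by split; [exact: finite_seq|].
by rewrite -fsbig_seq// sumEFin.
Qed.

Lemma esum_approx a (e : R) : (forall n, 0 <= a n) -> 0 < e ->
  (\esum_(n in [set: int]) (a n)%:E < +oo)%E ->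
  exists2 s, uniq s & fine (\esum_(n in [set: int]) (a n)%:E) < \sum_(n <- s) a n + e.
Proof.
move=> a0 e0 fin.
have fine_num : (\esum_(n in [set: int]) (a n)%:E)%E \is a fin_num.
  by rewrite ge0_fin_numE// esum_ge0// => n _; rewrite lee_fin.
have := @ub_ereal_sup_adherent R
  [set (\sum_(x \in A) (a x)%:E)%E | A in fsets [set: int]] e e0 fine_num.
move=> [_ [A [finA _] <-]]; rewrite fsbig_finite//= sumEFin => h.
exists (fset_set A); first exact: fset_uniq.
have {}h : (\esum_(n in [set: int]) (a n)%:E - e%:E < (\sum_(n <- fset_set A) a n)%:E)%E.
  exact: h.
by rewrite -(fineK fine_num) -EFinB lte_fin ltrBlDr in h.
Qed.

End SummableFamilies.

Lemma limn_einf_ge (R : realType) (u : nat -> \bar R) c :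
  (forall n, c <= u n)%E -> (c <= limn_einf u)%E.
Proof.
move=> cu; rewrite limn_einf_lim; apply: lime_ge; first exact: is_cvg_einfs.
by apply: nearW => n; apply: le_ereal_inf_tmp => _ [m /= _ <-].
Qed.

Lemma limn_einf_le (R : realType) (u : nat -> \bar R) c :
  (forall n, u n <= c)%E -> (limn_einf u <= c)%E.
Proof.
move=> uc; rewrite limn_einf_lim; apply: lime_le; first exact: is_cvg_einfs.
apply: nearW => n; apply: le_trans (uc n).
by apply: ereal_inf_lbound; exists n => /=.
Qed.

(** Fatou's lemma for a limit that need not be measurable: the lower limit is the
    measurable majorant. *)
Lemma fatou_upper_bounded (R : realType) (D : set R) (phi : nat -> R -> R)
    (psi : R -> R) (c : R) : measurable D ->
  (forall m, measurable_fun D (phi m)) -> (forall m t, 0 <= phi m t) ->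
  {ae lebesgue_measure, forall t, D t -> phi m t @[m --> \oo] --> psi t} ->
  (\forall m \near \oo, (\int[lebesgue_measure]_(t in D) (phi m t)%:E <= c%:E)%E) ->
  upper_bounded D psi c.
Proof.
move=> mD mphi phi0 cphi [N _ phic].
pose f m t : \bar R := (phi (m + N)%N t)%:E.
exists (fun t => limn_einf (f ^~ t)); split.
- rewrite /limn_einf; apply: measurableT_comp => //.
  apply: measurable_fun_limn_esup => m; apply: measurableT_comp => //.
  by apply/measurable_EFinP; exact: mphi.
- by move=> t; apply: limn_einf_ge => m; rewrite lee_fin.
- apply: (ae_mono cphi) => t /[apply] h.
  have h' : f m t @[m --> \oo] --> (psi t)%:E.
    by apply: cvg_toE; rewrite (cvg_shiftn N (phi ^~ t)).
  by have [-> _] := cvg_limn_einf_sup h'; exact: lexx.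
- apply: (@le_trans _ _ (limn_einf
    (fun m => (\int[lebesgue_measure]_(t in D) f m t)%E))).
    apply: fatou => //.
      by move=> m; apply/measurable_EFinP; exact: mphi.
    by move=> m t _; rewrite lee_fin.
  by apply: limn_einf_le => m; apply: phic; exact: leq_addl.
Qed.

Section RieszFischer.
Context (R : realType) (H : completeNormedModType R[i]).
Context (dot : {dot H for (@Num.conj R[i])}) (dotH : hilbert_norm dot).
Variable T : R.
Hypothesis T0 : 0 < T.
Local Notation mode := (fourier_mode T).
Local Notation trig := (trig_poly T [set: H]).
Local Notation mu := (@lebesgue_measure R).
Local Notation D := [set` `[0%R, T]].
Implicit Types (F P : R -> H).

Let mD : measurable D. Proof. exact: measurable_itv. Qed.
Let Dfin : (mu D < +oo)%E. Proof. exact: lebesgue_segment_lty. Qed.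

Lemma normRB_sqr_add (z x y : H) :
  normR (x - y) ^+ 2 <= 2 * normR (x - z) ^+ 2 + 2 * normR (z - y) ^+ 2.
Proof.
have := sqrD_le_eps (normR (x - z)) (normR (z - y)) (@ltr01 R).
rewrite invr1 -[1 + 1]/(2 : R); apply: le_trans.
by rewrite ler_pXn2r ?nnegrE ?addr_ge0 ?normR_ge0// normRB_add.
Qed.

Lemma square_Lp_norm F :
  (Lp_norm T 2 F ^+ 2 = \int[mu]_(t in D) (normR (F t) ^+ 2)%:E)%E.
Proof.
have E t : normR (F t) `^ 2 = normR (F t) ^+ 2 by rewrite powR_mulrn// normR_ge0.
rewrite /Lp_norm; under eq_integral do rewrite E.
set I := (\int[mu]_(t in D) _)%E.
have I0 : (0 <= I)%E by apply: integral_ge0 => t _; rewrite lee_fin sqr_ge0.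
by rewrite poweR12_sqrt// sqr_sqrte.
Qed.

(** Square approximable functions are Bochner integrable, hence limits almost
    everywhere of simple functions, which is strong measurability. *)
Lemma square_approximable_Lp F : periodic F T -> square_approximable T F ->
  Lp_per T 2 F.
Proof.
move=> FT aF; split => //.
  have : bochner_integrable D F.
    apply: (square_approximable_integrable T0 (Phi := fun _ _ x => x) (C := 1)) => //.
    - by rewrite lexx ltW.
    - by move=> P tP; apply: trig_poly_within; exact: tP.
    - by move=> s x y _; rewrite mul1r.
  move=> /(bochner_integrable_exists dotH mD Dfin)[v /is_bochner_of_has].
  by move=> /(_ mD)[s [sP _ _]]; exists s.
have [P [tP FP _]] := square_approximable_both T0 aF ltr01.
have [s [c [us _ PE]]] := tP.
have PF : upper_bounded D (fun t => normR (P t - F t) ^+ 2) 1.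
  by apply: upper_boundedS FP => t _; rewrite normRBC.
have PB : upper_bounded D (fun t => normR (P t) ^+ 2) (T * \sum_(n <- s) normR (c n) ^+ 2).
  apply: upper_boundedS (trig_poly_square_bounded dotH T0 c us) => t _.
  by rewrite PE.
have FB := upper_bounded_sqr_perturb ltr01 PB PF.
apply: le_lt_trans (ltry _).
apply: Lp_norm_le; first by [].
by apply: upper_boundedS FB => t _; rewrite powR_mulrn ?normR_ge0.
Qed.

Lemma Lp_square_approximable F : Lp_per T 2 F -> square_approximable T F.
Proof. exact: Lp_per_trig_approximable. Qed.

Lemma Lp_square_finite F : Lp_per T 2 F ->
  (\int[mu]_(t in D) (normR (F t) ^+ 2)%:E < +oo)%E.
Proof.
move=> [_ _ Ffin]; rewrite -square_Lp_norm expe2.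
by apply: lte_mul_pinfty => //; rewrite ?poweR_ge0// ge0_fin_numE ?poweR_ge0.
Qed.

Lemma Lp_square_upper_bounded F : Lp_per T 2 F ->
  upper_bounded D (fun t => normR (F t) ^+ 2)
    (fine (\int[mu]_(t in D) (normR (F t) ^+ 2)%:E)).
Proof.
move=> FL; have [_ [s [ss sF]] _] := FL.
have [||g mg Fg] := @ae_cvg_measurable R D (fun n t => normR (s n t) ^+ 2)
    (fun t => normR (F t) ^+ 2) mD.
- move=> n; apply: (simple_measurable_comp (fun x : H => normR x ^+ 2)).
  exact: simple_function_fimfun.
- apply: (ae_mono sF) => t /[apply] h.
  have h' : normR (s n t) @[n --> \oo] --> normR (F t) by exact: cvg_normR.
  by rewrite expr2; under eq_fun do rewrite expr2; exact: cvgM.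
apply: (upper_bounded_integral mD mg) => //; first by move=> t _; exact: sqr_ge0.
have I0 : (0 <= \int[mu]_(t in D) (normR (F t) ^+ 2)%:E)%E.
  by apply: integral_ge0 => t _; rewrite lee_fin sqr_ge0.
by rewrite fineK// ge0_fin_numE// Lp_square_finite.
Qed.

Let small_dist (y p q v : R) : q <= v -> p <= v -> v <= y / 8 -> 0 < y ->
  y <= 2 * q + 2 * p -> False.
Proof. lra. Qed.

Section Synthesis.
Variable x : int -> H.
Local Notation a := (fun n => normR (x n) ^+ 2).
Hypothesis xfin : (\esum_(n in [set: int]) (a n)%:E < +oo)%E.
Local Notation total := (fine (\esum_(n in [set: int]) (a n)%:E)).
Local Notation psum s := (fun t => \sum_(n <- s) mode n t *: x n).

Let a0 n : 0 <= a n. Proof. exact: sqr_ge0. Qed.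

Let sum_le s : uniq s -> \sum_(n <- s) a n <= total.
Proof.
move=> us; rewrite -lee_fin fineK; first exact: (esum_ge_seq a0 us).
by rewrite ge0_fin_numE// esum_ge0// => n _; rewrite lee_fin.
Qed.

Let sum_split (V : nmodType) (f : int -> V) (s1 s2 : seq int) : uniq s1 ->
  uniq s2 -> {subset s1 <= s2} ->
  \sum_(n <- s2) f n =
    \sum_(n <- s1) f n + \sum_(n <- [seq n <- s2 | n \notin s1]) f n.
Proof.
move=> u1 u2 s12.
rewrite (bigID (fun n => n \in s1)) /= -big_filter -[X in _ + X]big_filter.
congr (_ + _); apply: perm_big; apply: uniq_perm; rewrite ?filter_uniq// => n.
by rewrite mem_filter; case: (boolP (n \in s1)) => // /s12 ->.
Qed.

Let psum_diff (s1 s2 : seq int) (e : R) : uniq s1 -> uniq s2 ->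
  {subset s1 <= s2} -> total < \sum_(n <- s1) a n + e ->
  upper_bounded D (fun t => normR (psum s2 t - psum s1 t) ^+ 2) (T * e).
Proof.
move=> u1 u2 s12 tot.
pose s3 := [seq n <- s2 | n \notin s1].
have u3 : uniq s3 by rewrite filter_uniq.
apply: upper_bounded_le (trig_poly_square_bounded dotH T0 x u3).
  apply: aeW => t _; rewrite (sum_split _ u1 u2 s12) addrC addKr.
  exact: lexx.
rewrite ler_pM2l//; have := sum_le u2; rewrite (sum_split _ u1 u2 s12); lra.
Qed.

(** Finite sets J_k of frequencies that carry all but 8^-(k+1) / T of the sum of
    squares give partial sums P_k with P_(k+1) - P_k of order 8^-(k/2) in L^2.
    The series of 4^(k+1) |P_(k+1) - P_k|^2 is therefore finite almost
    everywhere, so that P_k converges almost everywhere; Fatou's lemma shows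
    that the limit is also a limit in L^2, and Bessel's inequality for U - P_k
    identifies its coefficients. Taking the limit pointwise makes U periodic at
    every point. *)
Lemma riesz_fischer : exists2 U, Lp_per T 2 U &
  forall n, fourier_coef T U n = x n.
Proof.
pose eta k : R := 8^-1 ^+ k.+1 / T.
have eta0 k : 0 < eta k by rewrite divr_gt0// exprn_gt0// invr_gt0.
have Teta k : T * eta k = 8^-1 ^+ k.+1 by rewrite mulrC divfK// gt_eqF.
have eta_small e : 0 < e -> exists k, T * eta k <= e.
  move=> e0; have := @cvg_half_powS R => /cvgrPdist_lt/(_ _ e0)[N _ hN].
  exists N; rewrite Teta; apply: le_trans (_ : 2^-1 ^+ N.+1 <= _).
    by apply: lerXn2r; rewrite ?nnegrE ?invr_ge0// lef_pV2 ?posrE// ler_nat.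
  by have := hN N (leqnn N); rewrite sub0r normrN => /ltW; exact/le_trans/ler_norm.
have hex k : exists s : seq int, uniq s /\ total < \sum_(n <- s) a n + eta k.
  by have [s us h] := esum_approx a0 (eta0 k) xfin; exists s.
have [s hs] := choice hex.
pose J k := undup (flatten [seq s j | j <- iota 0 k.+1]).
have uJ k : uniq (J k) by exact: undup_uniq.
have subJ k j : (k <= j)%N -> {subset J k <= J j}.
  move=> kj n; rewrite !mem_undup => /flattenP[_ /mapP[i ik ->] ni].
  apply/flattenP; exists (s i) => //; apply: map_f.
  move: ik; rewrite !mem_iota => /andP[-> /leq_trans]; apply.
  by rewrite !add0n ltnS.
have totJ k : total < \sum_(n <- J k) a n + eta k.
  have [us h] := hs k; apply: lt_le_trans h _; rewrite lerD2r.
  have sJ : {subset s k <= J k}.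
    move=> n ns; rewrite mem_undup; apply/flattenP; exists (s k) => //.
    by apply: map_f; rewrite mem_iota add0n leqnn.
  by rewrite (sum_split _ us (uJ k) sJ) lerDl sumr_ge0.
pose P k t := psum (J k) t.
have tP k : trig (P k) by exists (J k), x.
have Pdiff k j : (k <= j)%N ->
    upper_bounded D (fun t => normR (P j t - P k t) ^+ 2) (T * eta k).
  by move=> kj; exact: psum_diff (uJ k) (uJ j) (subJ k j kj) (totJ k).
(* The weights 4^(k+1) leave the summable bounds 2^-(k+1) while making the
   increments of P_k decay geometrically wherever the series is finite. *)
have fast : {ae mu, forall t, D t -> exists M, forall n,
    \sum_(k < n) 4 ^+ k.+1 * normR (P k.+1 t - P k t) ^+ 2 <= M}.
  apply: (@upper_bounded_series R D
    (fun k t => 4 ^+ k.+1 * normR (P k.+1 t - P k t) ^+ 2) mD) => [n t|n].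
    by rewrite mulr_ge0 ?sqr_ge0// exprn_ge0.
  have := upper_boundedZ mD (exprn_ge0 n.+1 (ler0n R 4)) (Pdiff n n.+1 (leqnSn n)).
  rewrite Teta -exprMn; have -> : 4 * 8^-1 = 2^-1 :> R by field.
  by [].
have Pcvg : {ae mu, forall t, D t -> exists l : H, P k t @[k --> \oo] --> l}.
  apply: (ae_mono fast) => t /[apply] -[M hM]; apply: normR_cauchy_cvg.
  have M0 : 0 <= M by have := hM 0%N; rewrite big_ord0.
  have step k : normR (P k.+1 t - P k t) <= (M + 1) * 2^-1 ^+ k.+1.
    have Mk : 0 <= (M + 1) * 2^-1 ^+ k.+1 by rewrite mulr_ge0 ?addr_ge0// exprn_ge0.
    have E : 4 ^+ k.+1 * ((M + 1) * 2^-1 ^+ k.+1) ^+ 2 = (M + 1) ^+ 2.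
      rewrite exprMn exprAC mulrCA -exprMn.
      by have -> : 4 * 2^-1 ^+ 2 = 1 :> R by [field]; rewrite expr1n mulr1.
    rewrite -(@ler_pXn2r _ 2) ?nnegrE ?normR_ge0//.
    rewrite -(@ler_pM2l _ (4 ^+ k.+1)) ?exprn_gt0// E.
    apply: le_trans (_ : M <= _); last by rewrite expr2; nra.
    apply: le_trans (hM k.+1); rewrite big_ord_recr /= lerDr.
    by apply: sumr_ge0 => i _; rewrite mulr_ge0 ?sqr_ge0// exprn_ge0.
  have dist N m : normR (P (N + m)%N t - P N t) <=
      (M + 1) * (2^-1 ^+ N - 2^-1 ^+ (N + m)).
    elim: m => [|m IH]; first by rewrite addn0 !subrr normR0 mulr0.
    rewrite addnS; apply: le_trans (normRB_add (P (N + m)%N t) _ _) _.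
    apply: le_trans (lerD (step _) IH) _; rewrite -mulrDr.
    rewrite ler_wpM2l ?addr_ge0// exprS.
    by set q := 2^-1 ^+ (N + m); lra.
  move=> e e0; have M1 : 0 < M + 1 by rewrite ltr_wpDl.
  have := @cvg_half_pow R => /cvgrPdist_lt/(_ _ (divr_gt0 e0 M1))[N _ hN].
  exists N => n Nn; have := dist N (n - N)%N; rewrite subnKC// => /le_trans; apply.
  apply: le_trans (_ : (M + 1) * 2^-1 ^+ N <= _).
    by rewrite ler_wpM2l ?addr_ge0// gerBl exprn_ge0.
  have := hN N (leqnn N); rewrite sub0r normrN ger0_norm ?exprn_ge0// => /ltW.
  by rewrite ler_pdivlMr// mulrC.
pose U t : H := xget 0 [set l | P k t @[k --> \oo] --> l].
have Ucvg : {ae mu, forall t, D t -> P k t @[k --> \oo] --> U t}.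
  by apply: (ae_mono Pcvg) => t /[apply] /(xgetPex 0).
have UT : periodic U T.
  move=> t; rewrite /U; suff -> : P^~ (t + T) = P^~ t by [].
  by apply/funext => k; exact: (trig_poly_periodic T0 (tP k)).
have Uclose k : upper_bounded D (fun t => normR (U t - P k t) ^+ 2) (T * eta k).
  apply: (@fatou_upper_bounded _ _ (fun m t => normR (P m t - P k t) ^+ 2)) => //.
  - move=> m; apply: (trig_poly_normR_measurable (P := fun t => P m t - P k t)).
    exact: trig_polyB.
  - by move=> m t; exact: sqr_ge0.
  - apply: (ae_mono Ucvg) => t /[apply] h.
    have h' : normR (P m t - P k t) @[m --> \oo] --> normR (U t - P k t).
      by apply: cvg_normR; apply: cvgB => //; exact: cvg_cst.
    by rewrite expr2; under eq_fun do rewrite expr2; exact: cvgM.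
  - exists k => // m /= km; apply: integral_le_upper_bound (Pdiff k m km).
    by move=> t _; exact: sqr_ge0.
have aU : square_approximable T U.
  apply/square_approximableP => e /eta_small[k ek]; exists (P k) => //.
  by apply: upper_bounded_le ek (Uclose k); apply: aeW => t _; exact: lexx.
exists U; first exact: square_approximable_Lp.
move=> n; apply/eqP; rewrite -subr_eq0; apply/eqP/normR_eq0/eqP.
rewrite -sqrf_eq0 eq_le sqr_ge0 andbT leNgt; apply/negP => y0.
have [k] := eta_small (T * (normR (fourier_coef T U n - x n) ^+ 2 / 8))
  (mulr_gt0 T0 (divr_gt0 y0 (ltr0n R 8))).
rewrite ler_pM2l// => hk.
have aP := square_approximable_trig (tP k).
have h1 : normR (fourier_coef T U n - fourier_coef T (P k) n) ^+ 2 <= eta k.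
  rewrite -(ler_pM2l T0) -(fourier_coefB dotH T0)//.
  have := bessel dotH T0 (s := [:: n]) isT (square_approximableB aU aP) (Uclose k).
  by rewrite big_seq1.
(* A frequency outside of J k belongs to the neglected part of the sum. *)
have h2 : normR (fourier_coef T (P k) n - x n) ^+ 2 <= eta k.
  rewrite (fourier_coef_trig dotH T0)//; case: ifP => nJ.
    by rewrite subrr normR0 expr0n ltW.
  rewrite sub0r normRN.
  have /sum_le : uniq (n :: J k) by rewrite /= nJ uJ.
  by rewrite big_cons; have := totJ k; lra.
have := normRB_sqr_add (fourier_coef T (P k) n) (fourier_coef T U n) (x n).
exact: small_dist h1 h2 hk y0.
Qed.

End Synthesis.

Lemma bessel_esum (U : R -> H) : Lp_per T 2 U ->
  (\esum_(n in [set: int]) (normR (fourier_coef T U n) ^+ 2)%:E <=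
   (fine (\int[mu]_(t in D) (normR (U t) ^+ 2)%:E) / T)%:E)%E.
Proof.
move=> UL; apply: esum_le => [n|s us]; first exact: sqr_ge0.
rewrite ler_pdivlMr// mulrC; apply: (bessel dotH T0 us).
  exact: Lp_square_approximable.
exact: Lp_square_upper_bounded.
Qed.

Let weighted_le (d a c e q : R) : 0 < d -> a <= e -> T * c <= q ->
  T * ((1 + d) * a + (1 + d^-1) * c) <= (1 + d) * (T * e) + (1 + d^-1) * q.
Proof.
move=> d0 ae cq; rewrite mulrDr !(mulrCA T); apply: lerD.
  by rewrite ler_pM2l ?addr_gt0// ler_pM2l.
by rewrite ler_pM2l// addr_gt0// invr_gt0.
Qed.

Let slack_le (d a b : R) : 0 < d -> d <= 1 -> 0 <= a ->
  b <= (1 + d) * ((1 + d) * a + (1 + d^-1) * d ^+ 2) + (1 + d^-1) * d ^+ 2 ->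
  b <= a + d * (3 * a + 6).
Proof.
move=> d0 d1 a0 /le_trans; apply.
have -> : (1 + d^-1) * d ^+ 2 = d + d ^+ 2 by field; rewrite gt_eqF.
have d2 : d ^+ 2 <= d by rewrite expr2 ger_pMl.
have d3 : d * d ^+ 2 <= d by rewrite ger_pMr// (le_trans d2).
have da : d ^+ 2 * a <= d * a by rewrite ler_wpM2r.
have -> : (1 + d) * ((1 + d) * a + (d + d ^+ 2)) + (d + d ^+ 2) =
  a + 2 * (d * a) + d ^+ 2 * a + 2 * d + 3 * d ^+ 2 + d * d ^+ 2 by ring.
rewrite mulrDr (mulrCA d); lra.
Qed.

(** One inequality is Bessel's. For the other, let P be a trigonometric
    polynomial at distance d of U in L^2: by Bessel's inequality for P - U, the
    coefficients of P are close in l^2 to those of U, so that the finite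
    Parseval identity bounds the norm of P, hence that of U, by the sum of
    squares up to a factor 1 + O(d). *)
Lemma plancherel (U : R -> H) : Lp_per T 2 U ->
  (Lp_norm T 2 U ^+ 2 =
     T%:E * \esum_(n in [set: int]) (normR (fourier_coef T U n) ^+ 2)%:E)%E.
Proof.
move=> UL; rewrite square_Lp_norm.
have aU := Lp_square_approximable UL.
have I0 : (0 <= \int[mu]_(t in D) (normR (U t) ^+ 2)%:E)%E.
  by apply: integral_ge0 => t _; rewrite lee_fin sqr_ge0.
pose a n := normR (fourier_coef T U n) ^+ 2.
have a0 n : 0 <= a n by exact: sqr_ge0.
have E0 : (0 <= \esum_(n in [set: int]) (a n)%:E)%E.
  by apply: esum_ge0 => n _; rewrite lee_fin.
have Ifin : (\int[mu]_(t in D) (normR (U t) ^+ 2)%:E)%E \is a fin_num.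
  by rewrite ge0_fin_numE//; apply: Lp_square_finite.
have Ec := bessel_esum UL; rewrite -(fineK Ifin).
move: Ec; set I := fine _ => Ec.
have Efin : (\esum_(n in [set: int]) (a n)%:E)%E \is a fin_num.
  by rewrite ge0_fin_numE// (le_lt_trans Ec)// ltry.
have E_ge s : uniq s -> \sum_(n <- s) a n <= fine (\esum_(n in [set: int]) (a n)%:E).
  by move=> us; rewrite -lee_fin fineK//; exact: esum_ge_seq.
move: Ec E_ge; rewrite -(fineK Efin); set E := fine _ => Ec Ege.
have E0' : 0 <= E by exact: fine_ge0.
rewrite -EFinM; congr EFin; apply/eqP; rewrite eq_le.
rewrite lee_fin ler_pdivlMr// mulrC in Ec; rewrite Ec andbT.
have key d : 0 < d -> d <= 1 -> I <= T * E + d * (3 * (T * E) + 6).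
  move=> d0 d1.
  have [P [tP UP _]] := square_approximable_both T0 aU (exprn_gt0 2 d0).
  have aP := square_approximable_trig tP.
  have := tP => -[s [c [us _ PE]]].
  have PsE : P = fun t => \sum_(n <- s) mode n t *: c n by exact/funext.
  have PU : upper_bounded D (fun t => normR (P t - U t) ^+ 2) (d ^+ 2).
    by apply: upper_boundedS UP => t _; rewrite normRBC.
  have cs : T * \sum_(n <- s) normR (fourier_coef T (fun t => P t - U t) n) ^+ 2 <= d ^+ 2.
    by apply: (bessel dotH T0 us) => //; exact: square_approximableB.
  have cn : T * \sum_(n <- s) normR (c n) ^+ 2 <= (1 + d) * (T * E) + (1 + d^-1) * d ^+ 2.
    apply: le_trans (_ : T * ((1 + d) * \sum_(n <- s) a n + (1 + d^-1) *
      \sum_(n <- s) normR (fourier_coef T (fun t => P t - U t) n) ^+ 2) <= _).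
      rewrite ler_pM2l// !mulr_sumr -big_split /= big_seq [leRHS]big_seq.
      apply: ler_sum => n ns; apply: le_trans (sqrD_le_eps _ _ d0).
      rewrite ler_pXn2r ?nnegrE ?addr_ge0 ?normR_ge0//.
      rewrite (fourier_coefB dotH T0)// {1}PsE (fourier_coef_trig dotH T0)// ns.
      by apply: le_trans (normRD _ _); rewrite addrC subrK.
    exact: weighted_le (Ege _ us) cs.
  have PB : upper_bounded D (fun t => normR (P t) ^+ 2)
      ((1 + d) * (T * E) + (1 + d^-1) * d ^+ 2).
    rewrite PsE; apply: upper_bounded_le cn (trig_poly_square_bounded dotH T0 c us).
    by apply: aeW => t _; exact: lexx.
  have /integral_le_upper_bound := upper_bounded_sqr_perturb d0 PB PU.
  rewrite -(fineK Ifin) lee_fin -/I => /(_ (fun t _ => sqr_ge0 _)).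
  by apply: slack_le; rewrite ?mulr_ge0// ltW.
apply/ler_addgt0Pr => e e0.
have X0 : 0 < 3 * (T * E) + 6.
  by rewrite ltr_wpDl// mulr_ge0// mulr_ge0// ltW.
have d0 : 0 < Num.min 1 (e / (3 * (T * E) + 6)) by rewrite lt_min ltr01 divr_gt0.
apply: le_trans (key _ d0 _) _; first by rewrite ge_min lexx.
by rewrite lerD2l -ler_pdivlMr// ge_min lexx orbT.
Qed.

End RieszFischer.

(** * Periodic solutions of the evolution equation *)

Section PeriodicSolutions.
Context (R : realType) (H : completeNormedModType R[i]).
Context (dot : {dot H for (@Num.conj R[i])}) (dotH : hilbert_norm dot).
Context (S : R -> H -> H) (A : operator H).
Hypotheses (semigroupS : C0_semigroup S) (generatesA : generates A S).
Hypotheses (boundedS : uniformly_bounded S) (stableS : strongly_stable S).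
Variable T : R.
Hypothesis T0 : 0 < T.
Hypothesis rhoA : forall n : int, resolvent_set A (i_omega T n).
Local Notation mode := (fourier_mode T).
Local Notation trig := (trig_poly T [set: H]).
Local Notation res n := (resolvent A (i_omega T n)).
Local Notation mu := (@lebesgue_measure R).
Local Notation D := [set` `[0%R, T]].
Implicit Types (F P u v : R -> H) (c : int -> H) (r : seq int).

Let mD : measurable D. Proof. exact: measurable_itv. Qed.
Let Dfin : (mu D < +oo)%E. Proof. exact: lebesgue_segment_lty. Qed.

(** The difference of two periodic mild solutions is an orbit S(t) d of the
    semigroup that is periodic; strong stability forces it to vanish, already
    for large times and hence for all. *)
Lemma periodic_mild_solution_unique F u v : periodic_mild_solution T S F u ->
  periodic_mild_solution T S F v -> u = v.
Proof.
move=> [uT [u0 uE]] [vT [v0 vE]]; apply/funext => t.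
apply/eqP; rewrite -subr_eq0; apply/eqP/normR_eq0/eqP.
rewrite eq_le normR_ge0 andbT leNgt; apply/negP => e0.
have /cvg_normRP/(_ _ e0)[m [_ hm]] : S r (u0 - v0) @[r --> +oo] --> (0 : H).
  exact: stableS.
(* Enough periods to make t + k T both nonnegative and larger than m. *)
pose k := Num.bound ((`|m| + `|t|) / T).
have tk : m < t + T *+ k /\ 0 <= t + T *+ k.
  have : (`|m| + `|t|) / T < k%:R by apply: archi_boundP; rewrite divr_ge0 ?addr_ge0// ltW.
  rewrite ltr_pdivrMr// mulr_natl => h.
  have := ler_norm m; have := ler_norm (- t); have := normr_ge0 m; rewrite normrN.
  by move: h; set q := T *+ k; split; lra.
have := hm _ tk.1; rewrite sub0r normRN.
rewrite (semigroupB semigroupS); last exact: tk.2.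
have -> : S (t + T *+ k) u0 - S (t + T *+ k) v0 = u t - v t.
  rewrite -(periodicn uT k t) -(periodicn vT k t) uE ?vE ?tk.2//.
  by rewrite opprD addrACA subrr addr0.
by rewrite ltxx.
Qed.

Section TrigonometricForcing.
Variables (r : seq int) (c : int -> H).
Local Notation F := (fun t => \sum_(n <- r) mode n t *: c n).
Local Notation u := (fun t => \sum_(n <- r) mode n t *: res n (c n)).

(** The forcing e_n c has the periodic response e_n R(i omega_n) c, and the
    convolution is the difference between this response and the orbit of its
    initial value; finite sums follow by linearity. *)
Lemma trig_forcing_convolution (t : R) : 0 <= t ->
  has_bochner `[0, t] (fun s => S (t - s) (F s)) (u t - S t (u 0)).
Proof.
move=> t0; rewrite (semigroup_sum semigroupS)// -sumrB.
have h : has_bochner `[0, t]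
    (fun s => \sum_(n <- r) S (t - s) (mode n s *: c n))
    (\sum_(n <- r) (mode n t *: res n (c n) - S t (res n (c n)))).
  apply: (has_bochner_sum dotH (measurable_itv _) (lebesgue_segment_lty _ _)) => n _.
  have [dx xE] := resolvent_eqP (rhoA n) (c n).
  by have := mode_mild_integral dotH semigroupS generatesA boundedS T n dx t0; rewrite xE.
under eq_bigr do rewrite mode0 scale1r.
apply: has_bochner_ae h; apply: aeW => s /=; rewrite in_itv /= => /andP[_ st].
by rewrite (semigroup_sum semigroupS)// subr_ge0.
Qed.

Lemma trig_forcing_solution : periodic_mild_solution T S F u.
Proof.
split; first by move=> t; apply: eq_bigr => n _; rewrite mode_periodic.
exists (u 0) => t t0.
rewrite (bochner_integralE dotH (measurable_itv _) (lebesgue_segment_lty _ _)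
  (trig_forcing_convolution t0)).
by rewrite addrC subrK.
Qed.

Lemma trig_forcing_classical : classical_solution A F u.
Proof.
exists (fun t => \sum_(n <- r) mode n t *: (i_omega T n *: res n (c n))); split.
  apply: (@trig_poly_continuous _ _ T setT); apply: trig_poly_sum => n.
  exact: trig_poly_mode.
move=> t.
have dres n : n \in r -> dom A (res n (c n)).
  by move=> _; have [] := resolvent_eqP (rhoA n) (c n).
have [dom_u Au] := generator_sum semigroupS generatesA (mode ^~ t) dres.
split => //.
  have -> : (fun h : R => (h^-1)%:C *: (u (t + h) - u t)) = (fun h : R =>
      \sum_(n <- r) mode n t *: ((h^-1)%:C *: (mode n h *: res n (c n) - res n (c n)))).
    apply/funext => h; rewrite -sumrB scaler_sumr; apply: eq_bigr => n _.
    by rewrite modeD -scalerA -scalerBr scalerA mulrC -scalerA.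
  elim: r => [|n r' IH].
    by under eq_fun do rewrite big_nil; rewrite big_nil; exact: cvg_cst.
  under eq_fun do rewrite big_cons; rewrite big_cons; apply: cvgD => //.
  by apply: cvgZl_tmp; exact: mode_generator.
rewrite Au -big_split /=; apply: eq_bigr => n _; rewrite -scalerDr; congr (_ *: _).
by have [_ {3}<-] := resolvent_eqP (rhoA n) (c n); rewrite addrC subrK.
Qed.

End TrigonometricForcing.

(** Uniform boundedness of the operators S(t - s) makes the product of a strongly
    continuous family and a continuous path continuous. *)
Lemma semigroup_path_continuous P (t : R) : continuous P ->
  {within `[0, t], continuous (fun s => S (t - s) (P s))}.
Proof.
move=> cP; have [M M0 hM] := semigroup_bound boundedS.
apply/within_continuousP => s st e e0; have e2 : 0 < e / 2 by rewrite divr_gt0.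
have /within_continuousP/(_ _ st _ e2)[d d0 hd] :
    {within `[0, t], continuous (fun q => S (t - q) (P s))}.
  exact: semigroup_reversed_continuous.
have /cvg_normRP/(_ _ (divr_gt0 e2 M0))/nbhs_ballP[d' /= d'0 hd'] : P r @[r --> s] --> P s.
  exact: cP.
exists (Num.min d d'); first by rewrite lt_min d0.
move=> q qt; rewrite lt_min => /andP[/(hd _ qt) h1 qs].
apply: le_lt_trans (normRB_add (S (t - q) (P s)) _ _) _.
rewrite [ltRHS]splitr; apply: ltrD => //.
have tq : 0 <= t - q by move: qt; rewrite /= in_itv /= subr_ge0 => /andP[].
rewrite -(semigroupB semigroupS)//; apply: le_lt_trans (hM _ _ tq) _.
by rewrite -ltr_pdivlMl// mulrC normRBC; apply: hd'; rewrite /ball /= distrC.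
Qed.

Lemma continuous_square_approximable (f : R -> H) : {within `[0, T], continuous f} ->
  square_approximable T f.
Proof.
move=> cf; apply: trig_approximable_closed => // e e0.
have eT : 0 < e / T by rewrite divr_gt0.
have d0 : 0 < Num.sqrt (e / T) by rewrite sqrtr_gt0.
have [s ss hs] := step_approximation (ltW T0) cf d0.
exists s; first exact: trig_approximable_simple.
have := @upper_bounded_uniform _ 0 T (fun t => normR (f t - s t) `^ 2) (e / T).
rewrite fine_lebesgue_period// divfK ?gt_eqF//; apply; first exact: ltW.
move=> t /hs; rewrite powR_mulrn ?normR_ge0// -(@ler_pXn2r _ 2) ?nnegrE ?normR_ge0//.
by rewrite sqr_sqrtr// ltW.
Qed.

Section SquareForcing.
Variables (F u : R -> H).
Hypothesis aF : square_approximable T F.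
Hypothesis uF : periodic_mild_solution T S F u.

Lemma convolution_integrable (t : R) : 0 <= t <= T ->
  bochner_integrable `[0, t] (fun s => S (t - s) (F s)).
Proof.
move=> tT; have [M M0 hM] := semigroup_bound boundedS.
apply: (square_approximable_integrable T0 (Phi := fun t s x => S (t - s) x) tT (ltW M0)) => //.
  by move=> P /trig_poly_continuous; exact: semigroup_path_continuous.
move=> s x y /andP[_ st]; have ts : 0 <= t - s by rewrite subr_ge0.
by rewrite -(semigroupB semigroupS)// hM.
Qed.

(** The integral over the null set [0, 0] vanishes. *)
Lemma mild_solution_initial (u0 : H) :
  u 0 = S 0 u0 + bochner_integral `[0, 0] (fun s => S (0 - s) (F s)) -> u 0 = u0.
Proof.
have m0 : measurable [set` `[0 : R, 0]] by exact: measurable_itv.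
have fin0 := lebesgue_segment_lty (0 : R) 0.
have int0 : bochner_integrable [set` `[0 : R, 0]] (fun s => S (0 - s) (F s)).
  by apply: convolution_integrable; rewrite lexx ltW.
have := normR_bochner dotH m0 fin0 (bochner_integrableP dotH m0 fin0 int0).
move=> /(_ 0) h; rewrite (semigroup_id semigroupS) => ->.
suff -> : bochner_integral [set` `[0 : R, 0]] (fun s => S (0 - s) (F s)) = 0.
  by rewrite addr0.
apply/normR_eq0/eqP; rewrite eq_le normR_ge0 andbT; apply: h.
have := @upper_bounded_uniform _ 0 0 (fun s => normR (S (0 - s) (F s)))
  (normR (S (0 - 0) (F 0))) (normR_ge0 _).
rewrite lebesgue_measure_itv /= ltxx /= mulr0; apply=> s.
by rewrite -eq_le => /eqP <-.
Qed.

(** With P near F in mean and w the periodic response to P, the difference u - w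
    is the orbit of d = u(0) - w(0) plus the convolution of the semigroup with
    F - P, and the latter is uniformly small on the period. *)
Lemma orbit_perturbation : exists2 M : R, 0 < M &
  forall e, 0 < e -> exists P w, exists d : H,
  [/\ trig P, upper_bounded D (fun t => normR (F t - P t)) e,
      trig w & [/\ forall n, fourier_coef T w n = res n (fourier_coef T P n),
      u 0 = w 0 + d & forall t, 0 <= t <= T ->
        normR (u t - (w t + S t d)) <= M * e]].
Proof.
have [M M0 hM] := semigroup_bound boundedS; exists M => // e e0.
have [P [tP _ FP]] := square_approximable_both T0 aF e0.
have := tP => -[r [c [ur _ PE]]].
have PsE : P = fun t => \sum_(n <- r) mode n t *: c n by exact/funext.
pose w t := \sum_(n <- r) mode n t *: res n (c n).
have [_ [u0 uE]] := uF.
have close (t : R) : 0 <= t <= T -> normR (u t - (w t + S t (u0 - w 0))) <= M * e.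
  move=> tT; have /andP[t0 tT'] := tT.
  have mt : measurable [set` `[0, t]] by exact: measurable_itv.
  have tfin := lebesgue_segment_lty 0 t.
  have nb := normR_bochner dotH mt tfin (has_bochnerB dotH mt tfin
    (bochner_integrableP dotH mt tfin (convolution_integrable tT))
    (trig_forcing_convolution r c t0)).
  rewrite (uE _ t0) (semigroupB semigroupS)//.
  have -> (a b x y : H) : a + b - (x + (a - y)) = b - (x - y).
    by rewrite [x + _]addrCA opprD addrACA subrr add0r.
  apply: nb; have sub : [set` `[0, t]] `<=` D.
    by move=> s /=; rewrite !in_itv /= => /andP[-> st]; exact: le_trans tT'.
  have := upper_boundedZ mt (ltW M0) (upper_bounded_sub mt mD sub FP).
  apply: upper_boundedS => s /=; rewrite in_itv /= => /andP[_ st].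
  have ts : 0 <= t - s by rewrite subr_ge0.
  by rewrite -(semigroupB semigroupS)// PE; exact: hM.
exists P, w, (u0 - w 0); split => //; first by exists r, (fun n => res n (c n)).
split => //.
  move=> n; rewrite PsE !(fourier_coef_trig dotH T0)//; case: ifP => // _.
  by apply/esym/resolvent_unique => //; have [d0 A0] := generator0 semigroupS generatesA;
     split=> //; rewrite A0 scaler0 subrr.
by rewrite addrC subrK; apply: mild_solution_initial; exact: uE.
Qed.

(** On the period u is a uniform limit of continuous functions. *)
Lemma mild_solution_square_approximable : square_approximable T u.
Proof.
have [M M0 h] := orbit_perturbation.
apply: trig_approximable_closed => // e e0.
have d0 : 0 < Num.sqrt (e / T) / M by rewrite divr_gt0// sqrtr_gt0 divr_gt0.
have [P [w [d [_ _ tw [_ _ hd]]]]] := h _ d0.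
exists (fun t => w t + S t d).
  apply: trig_approximableD => //; first exact: square_approximable_trig.
  by apply: continuous_square_approximable; exact: semigroup_within_continuous.
have := @upper_bounded_uniform _ 0 T (fun t => normR (u t - (w t + S t d)) `^ 2) (e / T).
rewrite fine_lebesgue_period// divfK ?gt_eqF//; apply; first by rewrite ltW// divr_gt0.
move=> t /hd; rewrite mulrC divfK ?gt_eqF// => hu.
have eT : 0 <= e / T by rewrite ltW// divr_gt0.
by rewrite powR_mulrn ?normR_ge0// -[leRHS]sqr_sqrtr// ler_pXn2r ?nnegrE ?normR_ge0// sqrtr_ge0.
Qed.

(** In the notation of orbit_perturbation, the coefficients of w + S d are
    R(i omega_n) P_n + R(i omega_n) (d - S(T) d) / T. Since u and w are
    periodic, d - S(T) d equals the small remainder at time T, so that only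
    R(i omega_n) F_n survives in the limit. The initial value d itself need not
    be small. *)
Lemma mild_solution_coef n : fourier_coef T u n = res n (fourier_coef T F n).
Proof.
have [M M0 h] := orbit_perturbation.
have [N N0 hN] := resolvent_bound (rhoA n).
have au := mild_solution_square_approximable.
have T1 : 0 <= T^-1 by rewrite invr_ge0 ltW.
apply/eqP; rewrite -subr_eq0; apply/eqP/normR_eq0/eqP; rewrite eq_le normR_ge0 andbT.
apply: (@normR_le_eps _ _ _ 0 (M + T^-1 * (N * M) + N * T^-1)).
  by rewrite !addr_ge0 ?mulr_ge0 ?invr_ge0 ?ltW.
move=> e e0; have [P [w [d [tP FP tw [wP u0E hd]]]]] := h _ e0.
have aP := square_approximable_trig tP; have aw := square_approximable_trig tw.
have aS : square_approximable T (S ^~ d).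
  by apply: continuous_square_approximable; exact: semigroup_within_continuous.
have awS : square_approximable T (fun t => w t + S t d) by exact: trig_approximableD.
have coefS : fourier_coef T (fun t => w t + S t d) n =
    res n (fourier_coef T P n) + (T^-1)%:C *: res n (d - S T d).
  have Sd : fourier_coef T (S ^~ d) n = (T^-1)%:C *: res n (d - S T d).
    apply: (fourier_coefE dotH); exact: resolvent_orbit_integral.
  have wE : fourier_coef T w n =
      fourier_coef T (fun t => w t + S t d) n - fourier_coef T (S ^~ d) n.
    rewrite -(fourier_coefB dotH T0 n awS aS); congr fourier_coef.
    by apply/funext => t; rewrite addrK.
  by rewrite -wP -Sd wE subrK.
have jump : normR (d - S T d) <= M * e.
  have wT : w T = w 0 by have := trig_poly_periodic T0 tw 0; rewrite add0r.
  have uT : u T = u 0 by have := uF.1 0; rewrite add0r.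
  have := hd T; rewrite lexx ltW// => /(_ isT); rewrite uT u0E wT.
  by rewrite opprD addrACA subrr add0r.
have c1 : normR (fourier_coef T u n - fourier_coef T (fun t => w t + S t d) n) <= M * e.
  rewrite -(fourier_coefB dotH T0)//.
  have Me : 0 <= M * e by rewrite mulr_ge0 ?ltW.
  have := fourier_coef_bound dotH T0 n (square_approximableB au awS)
    (upper_bounded_uniform Me hd).
  by rewrite fine_lebesgue_period// mulrCA mulVf ?gt_eqF// mulr1.
have c2 : normR (res n (fourier_coef T P n) - res n (fourier_coef T F n)) <= N * (T^-1 * e).
  rewrite -(resolventB semigroupS generatesA)//; apply: le_trans (hN _) _.
  rewrite ler_pM2l// -(fourier_coefB dotH T0)//.
  apply: (fourier_coef_bound dotH T0 n); first exact: square_approximableB.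
  by apply: upper_boundedS FP => t _; rewrite normRBC.
have c3 : normR ((T^-1)%:C *: res n (d - S T d)) <= T^-1 * (N * (M * e)).
  rewrite normRZr ger0_norm//; apply: ler_wpM2l => //.
  by apply: le_trans (hN _) _; rewrite ler_pM2l.
apply: le_trans (normRB_add (fourier_coef T (fun t => w t + S t d) n) _ _) _.
rewrite add0r !mulrDl -addrA; apply: lerD => //.
rewrite coefS addrAC addrC; apply: le_trans (normRD _ _) _; apply: lerD.
  by apply: le_trans c3 _; rewrite !mulrA.
by apply: le_trans c2 _; rewrite !mulrA.
Qed.

End SquareForcing.

(** The sampled response of F is the sequence of Fourier coefficients of the
    square integrable function u, which is square summable. *)
Lemma periodic_mild_response F u : Lp_per T 2 F ->
  periodic_mild_solution T S F u -> response_space T A F.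
Proof.
move=> FL uF; have aF := Lp_square_approximable T0 FL; split=> //.
have uL : Lp_per T 2 u.
  by apply: (square_approximable_Lp dotH T0) uF.1 _; exact: mild_solution_square_approximable uF.
have <- : (\esum_(n in [set: int]) (normR (fourier_coef T u n) ^+ 2)%:E = response_norm2 T A F)%E.
  by apply: eq_esum => n _; rewrite (mild_solution_coef aF uF).
exact: le_lt_trans (bessel_esum dotH T0 uL) (ltry _).
Qed.

(** The Fourier equation at frequency n says that the coefficient is
    R(i omega_n) F_n, so that existence is the theorem of Riesz-Fischer,
    uniqueness that of Fourier coefficients, and the norm identity that of
    Plancherel. *)
Lemma response_fourier_solution F : response_space T A F ->
  exists U, [/\ Lp_per T 2 U /\ fourier_solution T A F U,
    (forall V, Lp_per T 2 V /\ fourier_solution T A F V ->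
       {ae mu, forall t, V t = U t}) &
    (Lp_norm T 2 U ^+ 2 = T%:E * response_norm2 T A F)%E].
Proof.
move=> [_ Ffin].
have [U UL UE] := riesz_fischer dotH T0 Ffin.
exists U; split.
- by split=> // n; rewrite UE; exact: resolvent_eqP.
- move=> V [VL VE].
  have aU := Lp_square_approximable T0 UL; have aV := Lp_square_approximable T0 VL.
  have VU0 : {ae mu, forall t, D t -> V t - U t = 0}.
    apply: (fourier_uniqueness dotH T0 (F := fun t => V t - U t)).
      exact: square_approximableB.
    move=> n; rewrite (fourier_coefB dotH T0)// UE.
    by rewrite (resolvent_unique (rhoA n) (VE n)) subrr.
  have VUT : periodic (fun t => V t - U t) T.
    by move=> t; case: VL UL => -> _ _ [-> _ _].
  apply: (ae_mono (ae_periodic T0 VUT VU0)) => t /eqP.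
  by rewrite subr_eq0 => /eqP.
- rewrite (plancherel dotH T0 UL); congr (_ * _)%E.
  by apply: eq_esum => n _; rewrite UE.
Qed.

End PeriodicSolutions.

Theorem proposition3p7 (R : realType) (H : completeNormedModType R[i])
    (dot : {dot H for (@Num.conj R[i])}) (dotH : hilbert_norm dot)
    (S : R -> H -> H) (A : operator H)
    (semigroupS : C0_semigroup S) (generatesA : generates A S)
    (boundedS : uniformly_bounded S) (stableS : strongly_stable S)
    (T : R) (T_gt0 : 0 < T)
    (rhoA : forall n : int, resolvent_set A (i_omega T n)) :
  (* (i) *)
  [/\ forall F, trig_poly T [set: H] F ->
        exists u, [/\ unique (periodic_mild_solution T S F) u,
                      classical_solution A F u & trig_poly T (dom A) u],
      forall p : R, 1 <= p ->
        trig_poly T [set: H] `<=` Lp_per T p /\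
        forall F : R -> H, Lp_per T p F -> forall e : R, 0 < e ->
          exists2 P, trig_poly T [set: H] P &
            (Lp_norm T p (fun t => (F t - P t)%R) < e%:E)%E &
      periodically_well_posed T S (trig_poly T [set: H])] /\
  (* (ii) *)
  (forall F, Lp_per T 2 F ->
     (exists u, periodic_mild_solution T S F u) -> response_space T A F) /\
  (forall F, response_space T A F ->
     exists U, [/\ Lp_per T 2 U /\ fourier_solution T A F U,
       (forall V, Lp_per T 2 V /\ fourier_solution T A F V ->
          {ae lebesgue_measure, forall t, V t = U t}) &
       (Lp_norm T 2 U ^+ 2 = T%:E * response_norm2 T A F)%E]).
Proof.
have uniq_sol F u : periodic_mild_solution T S F u ->
    unique (periodic_mild_solution T S F) u.
  by move=> uF; split=> // v; exact: periodic_mild_solution_unique uF.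
split; last split.
- split.
  + move=> _ [s [c [us _ /funext ->]]].
    exists (fun t => \sum_(n <- s) fourier_mode T n t *:
      resolvent A (i_omega T n) (c n)); split.
    * by apply: uniq_sol; exact: (trig_forcing_solution dotH).
    * exact: (trig_forcing_classical semigroupS generatesA rhoA).
    * exists s, (fun n => resolvent A (i_omega T n) (c n)); split => // n _.
      by have [] := resolvent_eqP (rhoA n) (c n).
  + move=> p p1; have p0 : 0 < p by exact: lt_le_trans p1.
    split; first by move=> P; exact: (trig_poly_Lp_per dotH).
    by move=> F FL e e0; exact: (trig_poly_dense T_gt0 p0).
  + split; first by move=> P; exact: (trig_poly_Lp_per dotH).
    move=> _ [s [c [us _ /funext ->]]].
    exists (fun t => \sum_(n <- s) fourier_mode T n t *:
      resolvent A (i_omega T n) (c n)).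
    by apply: uniq_sol; exact: (trig_forcing_solution dotH).
- by move=> F FL [u uF]; exact: (periodic_mild_response dotH) uF.
- by move=> F FR; exact: (response_fourier_solution dotH).
Qed.
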